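(* Let $(G_n)$ be a sequence of connected graphs, $G_n$ of order $n$. If $\delta(G_n)\ge3$ for all $n$, then $$\operatorname{diam}(G_n)=(1+o(1))\frac{3n}{4}\quad\Longleftrightarrow\quad\mu(G_n)=(1+o(1))\frac{2\pi^2}{n^2}.$$ For a sequence $(G_n)$ of connected quartic ($4$-regular) graphs, $G_n$ of order $n$, $$\operatorname{diam}(G_n)=(1+o(1))\frac{3n}{5}\quad\Longleftrightarrow\quad\mu(G_n)=(1+o(1))\frac{4\pi^2}{n^2}.$$ In particular, the first equivalence holds for cubic ($3$-regular) graphs.
   Context: All graphs are finite, simple and undirected. $\mu(G)$ is the algebraic connectivity (second smallest Laplacian eigenvalue), $\delta(G)$ the minimum degree, $\operatorname{diam}(G)$ the diameter. Asymptotics are as $n\to\infty$ through orders for which the relevant class is nonempty (for cubic graphs, even $n$). *)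

(* Defs.v *)
From mathcomp Require Import all_boot all_order all_algebra.
From mathcomp Require Import polyrcf.
From mathcomp Require Import all_classical all_reals all_analysis.
Import Order.TTheory GRing.Theory Num.Theory numFieldNormedType.Exports.

Set Implicit Arguments.
Unset Strict Implicit.
Unset Printing Implicit Defensive.

Local Open Scope classical_set_scope.
Local Open Scope ring_scope.

Record sgraph (n : nat) := SGraph {
  adj :> rel 'I_n;
  adj_sym : symmetric adj;
  adj_irrefl : irreflexive adj
}.

Definition degree n (G : sgraph n) (x : 'I_n) : nat := #|G x|.

(* Every degree is less than [n], so the default value [n] of the minimum is
   only seen by the graph without vertices. *)
Definition min_degree n (G : sgraph n) : nat :=
  (\big[minn/n]_(x < n) degree G x)%N.

Definition regular (k : nat) n (G : sgraph n) : bool := [forall x, degree G x == k].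

Definition gconnected n (G : sgraph n) : bool :=
  (0 < n)%N && [forall x, forall y, connect G x y].

Definition walk n (G : sgraph n) (x y : 'I_n) (k : nat) : bool :=
  [exists p : k.-tuple 'I_n, path G x p && (last x p == y)].

(* A shortest walk is a path, hence has length less than [n]; the default value
   [n] is only taken when [x] and [y] lie in different components. *)
Definition dist n (G : sgraph n) (x y : 'I_n) : nat :=
  (\big[minn/n]_(k < n | walk G x y k) k)%N.

Definition diam n (G : sgraph n) : nat :=
  (\max_(x < n) \max_(y < n) dist G x y)%N.

Definition laplacian (R : realType) n (G : sgraph n) : 'M[R]_n :=
  \matrix_(i, j) ((degree G i)%:R *+ (i == j) - (G i j)%:R).

(* [rootsR p] lists the distinct real roots of [p] in increasing order. *)
Definition spectrum (R : realType) n (A : 'M[R]_n) : seq R :=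
  flatten [seq nseq (mup a (char_poly A)) a | a <- rootsR (char_poly A)].

Definition algebraic_connectivity (R : realType) n (G : sgraph n) : R :=
  (spectrum (laplacian R G))`_1.

Definition graph_class := forall n, sgraph n -> bool.

Definition connected_min_degree_ge (k : nat) : graph_class :=
  fun n G => gconnected G && (k <= min_degree G)%N.

Definition connected_regular (k : nat) : graph_class :=
  fun n G => gconnected G && regular k G.

Definition orders (C : graph_class) : set nat :=
  [set n | exists G : sgraph n, C n G].

(* The filter of n tending to infinity through the orders of graphs in [C]. *)
Definition orders_oo (C : graph_class) : set_system nat :=
  within (orders C) \oo.

(* f = (1 + o(1)) g along the filter F *)
Definition asymp_eq (R : realType) (F : set_system nat) (f g : nat -> R) : Prop :=
  exists2 e : nat -> R, e n @[n --> F] --> (0 : R) &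
    \forall n \near F, f n = (1 + e n) * g n.

(* The values of [G] outside [orders C] are arbitrary. *)
Definition sequence_in (C : graph_class) (G : forall n, sgraph n) : Prop :=
  forall n, orders C n -> C n (G n).

(* Main.v *)
(** Lower bound on the algebraic connectivity mu. Order the vertices by a Fiedler vector
    f_0 <= ... <= f_(n-1), and let F k = f_k + ... + f_(n-1) >= 0. Summing the eigenvalue
    equations over the vertices i >= k gives
      sum_j m(k, j) (f_j - f_(j-1)) = mu F k,
    where m(k, j) counts the edges crossing both the cut before vertex k and the cut before
    vertex j. Suppose that weights W k on the cuts satisfy
    sum_(|k-j| <= 2) W k m(k, j) >= N for every j. Multiplying by W k sin (k pi / n) and summing,
    one gets N (2 - 2 cos (pi / n)) sum sin (k pi / n) F k <= mu sum W k sin (k pi / n) F k up to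
    a lower order term. Bridges (for minimum degree 3, N = 6), resp. edge cuts of size 2 (for
    quartic graphs, N = 12), cannot be too dense, so that W can be chosen with average at most 3 on
    long intervals, and mu >= (1 - o(1)) N pi^2 / (3 n^2). If mu is asymptotically this small,
    W has average 3 - o(1), so these small cuts occur almost as densely and regularly as the
    degrees permit; each period of the pattern (4, resp. 5, vertices) then costs 3 steps of
    distance, which makes the diameter large.

    Conversely, let L_0, ..., L_D be the sizes of the distance layers from an end of a diameter.
    Three consecutive layers contain a closed neighbourhood, so L_i + L_(i+1) + L_(i+2) >= d + 1
    and D <= 3 n / (d + 1) + O(1). If D is asymptotically this large, almost all of these
    inequalities are equalities, and equality in two consecutive windows forces
    L_i + L_(i+1) + L_(i+2) = tau (r_i + r_(i+1) + r_(i+2)) with r_i = 1 / (L_i L_(i+1)), where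
    tau = 2 for d = 3 and tau = 4 for quartic graphs. Then the cosine of a phase running from
    0 to pi with increments proportional to r_i is a test function for the Rayleigh quotient
    and yields mu <= (1 + o(1)) tau pi^2 / n^2. *)

Require Import Defs.
From mathcomp Require Import all_boot all_order all_algebra all_fingroup.
From mathcomp Require Import polyrcf complex.
From mathcomp Require Import all_classical all_reals all_analysis.
From mathcomp Require Import ring lra zify.

Set Implicit Arguments.
Unset Strict Implicit.
Unset Printing Implicit Defensive.

(** * Edge cuts of an ordered graph *)

(** The bounds mu >= (1 - o(1)) tau pi^2 / n^2 and D <= (1 + o(1)) 3 n / (d + 1) hold
    unconditionally, so each implication only has to turn near equality in one of them into near
    equality in the other. The two halves meet because N = 3 tau. Here tau is the product of three
    consecutive layer sizes in the extremal pattern, 1, 1, 2 resp. 1, 2, 2, since 1/(ab) + 1/(bc) +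
    1/(ca) = (a + b + c)/(abc); the pattern 1, 1, 3 would give 3 and is ruled out for quartic graphs
    by parity.

    A high density of small cuts does not by itself force a large distance: two bridges 4 apart may
    enclose a complete graph, which can be traversed in fewer than 3 steps. W is therefore made
    smaller on such blocks, so that they pull its average below 3. Moreover 3 - W changes sign and
    has a nonnegative sum over an interval only up to a bounded error, so pairing it with a slowly
    varying positive sequence needs an argument of its own. *)

Section OrderedGraph.
Variables (n : nat) (a : nat -> nat -> bool).
Hypothesis a_sym : forall i j, a i j = a j i.
Hypothesis a_irr : forall i, a i i = false.

Definition edges_between (i1 i2 j1 j2 : nat) : nat :=
  \sum_(i1 <= i < i2) \sum_(j1 <= j < j2) a i j.
Local Notation s := edges_between.

(* The number of edges crossing both the cut before [j] and the cut before [k]. *)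
Definition cut_overlap (j k : nat) : nat := s 0 (minn j k) (maxn j k) n.
Local Notation m := cut_overlap.
Definition cut_size (k : nat) : nat := s 0 k k n.
Local Notation c := cut_size.
Definition odegree (i : nat) : nat := \sum_(0 <= j < n) a i j.

Lemma edges_sym i1 i2 j1 j2 : s i1 i2 j1 j2 = s j1 j2 i1 i2.
Proof.
rewrite /s exchange_big_nat; apply: eq_bigr => j _; apply: eq_bigr => i _.
by rewrite a_sym.
Qed.

Lemma edges_catl i1 i2 i3 j1 j2 : i1 <= i2 -> i2 <= i3 ->
  s i1 i3 j1 j2 = s i1 i2 j1 j2 + s i2 i3 j1 j2.
Proof. by move=> h1 h2; rewrite /s (big_cat_nat h1 h2). Qed.

Lemma edges_catr i1 i2 j1 j2 j3 : j1 <= j2 -> j2 <= j3 ->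
  s i1 i2 j1 j3 = s i1 i2 j1 j2 + s i1 i2 j2 j3.
Proof. by move=> h1 h2; rewrite edges_sym (edges_catl _ _ h1 h2) 2!(edges_sym i1). Qed.

Lemma edges_geq i1 i2 j1 j2 : i2 <= i1 -> s i1 i2 j1 j2 = 0.
Proof. by move=> h; rewrite /s big_geq. Qed.

Lemma edges_gt0P i1 i2 j1 j2 :
  reflect (exists i j, [/\ i1 <= i < i2, j1 <= j < j2 & a i j]) (0 < s i1 i2 j1 j2).
Proof.
rewrite lt0n /s sum_nat_seq_neq0; apply: (iffP hasP) => [[k]|[i [j [hi hj aij]]]].
  rewrite mem_index_iota => hk /=; rewrite sum_nat_seq_neq0 => /hasP[j].
  by rewrite mem_index_iota => hj /=; rewrite eqb0 negbK => akj; exists k, j.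
exists i; rewrite ?mem_index_iota //= sum_nat_seq_neq0; apply/hasP; exists j.
  by rewrite mem_index_iota.
by rewrite /= aij.
Qed.

Lemma edges_le_box i1 i2 j1 j2 : s i1 i2 j1 j2 <= (i2 - i1) * (j2 - j1).
Proof.
rewrite /s -(sum_nat_const_nat i1 i2); apply: leq_sum => i _.
rewrite -[X in _ <= X]muln1 -(sum_nat_const_nat j1 j2); apply: leq_sum => j _.
by case: (a i j).
Qed.

(** Ordered pairs are counted, so this is twice the number of edges inside the block, and [r * r.-1]
    means that the block is complete. *)
Definition inner_edges k r := s k (k + r) k (k + r).

Lemma sum_eq_index k l i : k <= i < l -> \sum_(k <= x < l) (x == i) = 1.
Proof.
move=> hi; rewrite (bigD1_seq i) ?mem_index_iota ?iota_uniq //= eqxx big1 ?addn0 //.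
by move=> x /negPf ->.
Qed.

Lemma sum_neq k r : \sum_(k <= x < k + r) \sum_(k <= y < k + r) (x != y) = r * r.-1.
Proof.
transitivity (\sum_(k <= x < k + r) r.-1); last by rewrite sum_nat_const_nat; lia.
apply: eq_big_nat => x hx; apply/eqP; rewrite -(eqn_add2l 1); apply/eqP.
rewrite -{1}(sum_eq_index hx) -big_split /= (eq_bigr (fun=> 1)) => [|y _].
  by rewrite sum_nat_const_nat; lia.
by rewrite eq_sym; case: eqP.
Qed.

Lemma inner_edges_le k r : inner_edges k r <= r * r.-1.
Proof.
rewrite -(sum_neq k); do 2![apply: leq_sum => ? _]; case: eqP => [->|_].
  by rewrite a_irr.
by case: (a _ _).
Qed.

Lemma inner_edges_nonadjacent k r i j : k <= i < k + r -> k <= j < k + r -> i != j ->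
  a i j = false -> inner_edges k r + 2 <= r * r.-1.
Proof.
move=> hi hj ij naij.
have delta i' j' : k <= i' < k + r -> k <= j' < k + r ->
    \sum_(k <= x < k + r) \sum_(k <= y < k + r) (x == i') * (y == j') = 1.
  move=> hi' hj'; under eq_bigr do rewrite -big_distrr sum_eq_index //= muln1.
  exact: sum_eq_index.
have -> : 2 = 1 + 1 by []; rewrite -{1}(delta i j) // -(delta j i) // -(sum_neq k).
rewrite -!big_split /=; apply: leq_sum => x _; rewrite -!big_split /=.
apply: leq_sum => y _.
have [<-|xy] := eqVneq x y.
  rewrite a_irr; case: (eqVneq x i) => [xi|_]; case: (eqVneq x j) => [xj|_] //=.
  by move: ij; rewrite -xi -xj eqxx.
case: (eqVneq x i) => [xi|_]; case: (eqVneq y j) => [yj|_] /=; subst.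
- by rewrite naij (negPf ij).
- by rewrite (negPf ij); case: (a _ _).
- by rewrite [j == i]eq_sym (negPf ij) muln0; case: (a _ _).
case: (eqVneq x j) => [xj|_]; case: (eqVneq y i) => [yi|_] /=; subst => //.
- by rewrite a_sym naij.
- by case: (a _ _).
- by case: (a _ _).
by case: (a _ _).
Qed.

(** An edge leaving the block crosses exactly one of its two bounding cuts, while an edge passing
    over the block crosses both and contributes to no degree inside; the term with [m] on the left
    compensates for the latter. All density statements about small cuts come from this identity. *)
Lemma block_degree_sum k r : k + r <= n ->
  \sum_(k <= i < k + r) odegree i + 2 * m k (k + r) =
  inner_edges k r + c k + c (k + r).
Proof.
move=> krn; rewrite /m /c /inner_edges /minn /maxn.
have -> : \sum_(k <= i < k + r) odegree i = s k (k + r) 0 n by [].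
have kr : k <= k + r by lia.
have -> : (if k < k + r then k else k + r) = k by case: ifP; lia.
have -> : (if k < k + r then k + r else k) = k + r by case: ifP; lia.
rewrite (edges_catr _ _ (leq0n k)); last by lia.
rewrite (edges_catr _ _ kr krn) (edges_catr 0 k kr krn) (edges_catl _ _ (leq0n k) kr).
by rewrite (edges_sym 0 k k); lia.
Qed.

Lemma cut_overlapE j k : j <= k -> m j k = s 0 j k n.
Proof. by move=> jk; rewrite /m (minn_idPl jk) (maxn_idPr jk). Qed.

Lemma cut_overlapC j k : m j k = m k j.
Proof. by rewrite /m minnC maxnC. Qed.

Lemma cut_overlap_diag k : m k k = c k.
Proof. by rewrite /m minnn maxnn. Qed.

Lemma cut_size0 : c 0 = 0. Proof. by rewrite /c edges_geq. Qed.

Lemma cut_size_ge k : n <= k -> c k = 0.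
Proof. by move=> h; rewrite /c edges_sym edges_geq. Qed.

(** Among the edges across the cut before [j], only the one joining the vertices [j.-1] and [j] can
    miss both neighbouring cuts. *)
Lemma cut_neighbours j : 0 < j < n -> c j <= m j j.-1 + m j j.+1 + 1.
Proof.
move=> hj; rewrite cut_overlapC !cut_overlapE; try lia.
rewrite /c (@edges_catl 0 j.-1 j); try lia.
rewrite (@edges_catr j.-1 j j j.+1); try lia.
have := edges_le_box j.-1 j j j.+1; have := @edges_catl 0 j.-1 j j.+1 n.
have -> : (j - j.-1) * (j.+1 - j) = 1 by lia.
by move=> -> ; lia.
Qed.

Lemma cut_overlap0 j : m j 0 = 0.
Proof. by rewrite cut_overlapC cut_overlapE // edges_geq. Qed.

Lemma cut_overlap_ge j k : n <= k -> m j k = 0.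
Proof. by move=> h; rewrite /m edges_sym edges_geq //; apply: leq_trans h (leq_maxr _ _). Qed.

Definition row_weight (W : nat -> nat) j :=
  \sum_(1 <= k < n | (k <= j + 2) && (j <= k + 2)) W k * m j k.

(** Lets a row condition be verified from a few chosen cuts. Their indices may leave the range from
    1 to [n.-1], where the overlap is 0, so rows near the ends need no separate treatment. *)
Lemma row_weight_ge W j (r : seq nat) :
  uniq r -> all (fun k => (k <= j + 2) && (j <= k + 2)) r ->
  \sum_(k <- r) W k * m j k <= row_weight W j.
Proof.
move=> ur /allP ar; rewrite /row_weight; pose P k := (k <= j + 2) && (j <= k + 2).
rewrite (bigID (fun k => 0 < k < n)) /= [X in _ + X]big1 ?addn0; last first.
  move=> k hk; have [->|k0] := posnP k; first by rewrite cut_overlap0 muln0.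
  by rewrite cut_overlap_ge ?muln0 //; lia.
rewrite -big_filter -[X in _ <= X]big_filter.
set r1 := seq.filter _ r; set r2 := seq.filter _ _.
have sub k : k \in r1 -> k \in r2.
  by rewrite !mem_filter mem_index_iota /P => /andP[h1 /ar ->].
have pr : perm_eq [seq k <- r2 | k \in r1] r1.
  apply: uniq_perm => //; rewrite ?filter_uniq ?iota_uniq //.
  move=> k; rewrite mem_filter; apply/andP/idP => [[]//|kr]; split => //.
  exact: sub.
rewrite -(perm_big _ pr) big_filter [X in _ <= X](bigID (mem r1)) /=.
exact: leq_addr.
Qed.

Lemma edges_mono i1 i2 j1 j2 i1' i2' j1' j2' :
  i1' <= i1 -> i2 <= i2' -> j1' <= j1 -> j2 <= j2' ->
  s i1 i2 j1 j2 <= s i1' i2' j1' j2'.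
Proof.
move=> h1 h2 h3 h4.
have [h5|h5] := leqP i2 i1; first by rewrite edges_geq.
have [h6|h6] := leqP j2 j1; first by rewrite edges_sym edges_geq.
rewrite (@edges_catl i1' i1 i2'); try lia.
rewrite (@edges_catl i1 i2 i2'); try lia.
rewrite (@edges_catr i1 i2 j1' j1 j2'); try lia.
by rewrite (@edges_catr i1 i2 j1 j2 j2'); lia.
Qed.

Lemma edges_full i1 i2 j1 j2 :
  (forall i j, i1 <= i < i2 -> j1 <= j < j2 -> a i j) ->
  s i1 i2 j1 j2 = (i2 - i1) * (j2 - j1).
Proof.
move=> h; rewrite /s -(sum_nat_const_nat i1 i2).
apply: eq_big_nat => i hi; rewrite -[RHS]muln1 -(sum_nat_const_nat j1 j2).
by apply: eq_big_nat => j hj; rewrite h.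
Qed.

Lemma inner_edges_complete k r i j : inner_edges k r = r * r.-1 ->
  k <= i < k + r -> k <= j < k + r -> i != j -> a i j.
Proof.
move=> e hi hj ij; case E : (a i j) => //; have := inner_edges_nonadjacent hi hj ij E; lia.
Qed.

End OrderedGraph.

(** * Sums over windows, chains of blocks and lower bounds on distances *)

Lemma sum_window_le (F : nat -> nat) L B i N : 0 < L ->
  (forall k, \sum_(k <= x < k + L) F x <= B) ->
  L * \sum_(i <= x < i + N) F x <= B * (N + L).
Proof.
move=> L0 hF; elim/ltn_ind: N i => N IH i.
have [NL|LN] := ltnP N L.
  have : \sum_(i <= x < i + N) F x <= B.
    by apply: leq_trans (hF i); rewrite (@big_cat_nat _ _ _ (i + N) i (i + L)) ?leq_addr //; lia.
  by move=> h; rewrite mulnC; apply: leq_mul => //; lia.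
rewrite (@big_cat_nat _ _ _ (i + L)) /=; try lia.
have -> : i + N = (i + L) + (N - L) by lia.
have h1 := IH (N - L) _ (i + L); have h2 := hF i.
have {}h1 := h1 ltac:(lia).
rewrite mulnDr; apply: leq_trans (leq_add (leq_mul (leqnn L) h2) h1) _.
by rewrite subnK // mulnDr addnC [L * B]mulnC.
Qed.

Lemma sum_from (F : nat -> nat) k L :
  \sum_(k <= x < k + L) F x = \sum_(0 <= i < L) F (k + i).
Proof.
rewrite -{1}[k]add0n big_addn addKn.
by apply: eq_bigr => i _; rewrite addnC.
Qed.

Lemma sum_shift_ge (F : nat -> nat) n B i : (forall k, F k <= B) ->
  \sum_(0 <= k < n) F k <= \sum_(0 <= k < n) F (k + i) + i * B.
Proof.
move=> hB; have -> : \sum_(0 <= k < n) F (k + i) = \sum_(i <= k < n + i) F k.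
  by rewrite -{2}(add0n i) big_addn addnK.
have h : \sum_(0 <= k < i) F k <= i * B.
  rewrite -[X in X * B]subn0 -sum_nat_const_nat; exact: leq_sum.
apply: leq_trans (_ : \sum_(0 <= k < n + i) F k <= _).
  by rewrite (@big_cat_nat _ _ _ n 0 (n + i)) ?leq_addr.
by rewrite (@big_cat_nat _ _ _ i 0 (n + i)) ?leq_addl //= addnC leq_add2l.
Qed.

Lemma sum_windows_ge (F : nat -> nat) n L B : (forall k, F k <= B) ->
  L * \sum_(0 <= k < n) F k <=
  \sum_(0 <= k < n) \sum_(0 <= i < L) F (k + i) + L * (L * B).
Proof.
move=> hB; rewrite exchange_big_nat /=.
have -> : L * \sum_(0 <= k < n) F k = \sum_(0 <= i < L) \sum_(0 <= k < n) F k.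
  by rewrite sum_nat_const_nat subn0.
have <- : \sum_(0 <= i < L) L * B = L * (L * B) by rewrite sum_nat_const_nat subn0.
rewrite -big_split /= big_seq [X in _ <= X]big_seq.
apply: leq_sum => i; rewrite mem_index_iota => /andP[_ iL].
by apply: leq_trans (sum_shift_ge _ i hB) _; rewrite leq_add2l leq_mul // ltnW.
Qed.

(** [P k D] stands for the property that all vertices from [k] on have distance at least [D]. Good
    blocks of length [L] are disjoint by the last hypothesis, so each of them adds its 3 steps
    independently; the sum stops at [k.+1 - L] because only blocks that end by [k] count. *)
Lemma separated_chain (good : pred nat) (L : nat) (P : nat -> nat -> Prop) :
  0 < L -> P 0 0 -> (forall k D, P k D -> P k.+1 D) ->
  (forall b D, good b -> P b D -> P (b + L) (D + 3)) ->
  (forall b b', good b -> b' < b -> b < b' + L -> ~~ good b') ->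
  forall k, P k (3 * \sum_(0 <= b < k.+1 - L) good b).
Proof.
move=> L0 P0 Pm Ps sep; elim/ltn_ind => k IH.
have [->|k0] := posnP k; first by rewrite big_geq ?muln0 //; lia.
have [kL|Lk] := ltnP k L.
  rewrite big_geq; last by lia.
  by have := IH k.-1 ltac:(lia); rewrite big_geq ?prednK //; try lia; move=> /Pm; rewrite prednK.
have -> : k.+1 - L = (k - L).+1 by lia.
rewrite big_nat_recr //=; case: (boolP (good (k - L))) => g; last first.
  rewrite addn0 -{1}(prednK k0); apply: Pm; have := IH k.-1 ltac:(lia).
  by rewrite prednK.
have := Ps _ _ g (IH (k - L) ltac:(lia)); rewrite subnK //.
rewrite mulnDr; set S1 := \sum_(_ <= _ < _) _; set S2 := \sum_(_ <= _ < _) _.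
suff -> : S2 = S1 by [].
rewrite /S2 (@big_cat_nat _ _ _ ((k - L).+1 - L) 0 (k - L)) //=; last by lia.
rewrite [X in _ + X]big_nat [X in _ + X]big1 ?addn0 // => b hb.
by rewrite (negPf (sep _ _ g _ _)) //; lia.
Qed.

(* [h] increases by at most 1 along an edge inside the tail [b, n) and vanishes where a
   shortest path enters the tail, so [d] exceeds its value there by at least [h]. *)
Lemma potential_lower_bound (n : nat) (a : nat -> nat -> bool) (d h : nat -> nat) b D :
  (forall i, i < n -> 0 < i -> exists2 p, (p < n) && a p i & d i = (d p).+1) ->
  0 < b ->
  (forall i p, b <= i < n -> b <= p < n -> a p i -> h i <= (h p).+1) ->
  (forall i p, b <= i < n -> p < b -> a p i -> h i = 0) ->
  (forall i, b <= i < n -> D <= d i) ->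
  forall i, b <= i < n -> D + h i <= d i.
Proof.
move=> pred b0 lip ent lowD i; have [k] := ubnP (d i); elim: k i => // k IH i dk hi.
have [p /andP[pn api] dp] := pred i ltac:(lia) ltac:(lia).
have [pb|bp] := ltnP p b; first by rewrite (ent i p) // addn0 lowD.
have := IH p ltac:(lia) ltac:(lia); have := lip i p hi ltac:(lia) api; lia.
Qed.

Lemma sum_ge_const_nat (F : nat -> nat) k r d :
  (forall i, k <= i < k + r -> d <= F i) -> r * d <= \sum_(k <= i < k + r) F i.
Proof.
move=> h; have {1}-> : r = k + r - k by lia.
rewrite -sum_nat_const_nat big_seq [X in _ <= X]big_seq; apply: leq_sum => i.
by rewrite mem_index_iota; apply: h.
Qed.

Lemma sum_shift_le (F : nat -> nat) n i : (forall k, n <= k -> F k = 0) ->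
  \sum_(0 <= k < n) F (k + i) <= \sum_(0 <= k < n) F k.
Proof.
move=> h; have -> : \sum_(0 <= k < n) F (k + i) = \sum_(i <= k < n + i) F k.
  by rewrite -{2}(add0n i) big_addn addnK.
apply: leq_trans (_ : \sum_(0 <= k < n + i) F k <= _).
  by rewrite (@big_cat_nat _ _ _ i 0 (n + i)) ?leq_addl.
rewrite (@big_cat_nat _ _ _ n 0 (n + i)) ?leq_addr //=.
rewrite [X in _ + X]big_nat [X in _ + X]big1 ?addn0 // => k /andP[/h //].
Qed.

Lemma sum_ge_two (F : nat -> nat) k l x y : k <= x < l -> k <= y < l -> x != y ->
  F x + F y <= \sum_(k <= z < l) F z.
Proof.
move=> hx hy xy.
rewrite (bigD1_seq x) ?mem_index_iota ?iota_uniq //= leq_add2l.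
rewrite -big_filter (bigD1_seq y) ?filter_uniq ?iota_uniq //= ?leq_addr //.
by rewrite mem_filter mem_index_iota hy eq_sym xy.
Qed.

Lemma cut_size1_unique n a k i j i' j' : cut_size n a k = 1 ->
  i < k -> k <= j < n -> a i j -> i' < k -> k <= j' < n -> a i' j' ->
  i = i' /\ j = j'.
Proof.
rewrite /cut_size /edges_between => e hi hj aij hi' hj' aij'.
have row x y : k <= y < n -> a x y -> 1 <= \sum_(k <= z < n) a x z.
  by move=> hy axy; rewrite (bigD1_seq y) ?mem_index_iota ?iota_uniq //= axy.
have [ii|ii] := eqVneq i i'.
  subst i'; split => //; apply/eqP/negPn/negP => jj.
  have := sum_ge_two (fun z => nat_of_bool (a i z)) hj hj' jj; rewrite aij aij' => h2.
  have : \sum_(k <= z < n) a i z <= 1.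
    by rewrite -[X in _ <= X]e [X in _ <= X](bigD1_seq i) ?mem_index_iota ?iota_uniq //= leq_addr.
  lia.
have := sum_ge_two (fun x => \sum_(k <= z < n) a x z) (k := 0) (l := k) hi hi' ii.
have := row _ _ hj aij; have := row _ _ hj' aij'; rewrite e; lia.
Qed.

(** * Minimum degree three *)

Section Cubic.
Variables (n : nat) (a : nat -> nat -> bool).
Hypothesis a_sym : forall i j, a i j = a j i.
Hypothesis a_irr : forall i, a i i = false.
Hypothesis deg3 : forall i, i < n -> 3 <= odegree n a i.
Hypothesis cut_gt0 : forall k, 0 < k < n -> 0 < cut_size n a k.

Local Notation c := (cut_size n a).
Local Notation m := (cut_overlap n a).
Local Notation inner := (inner_edges a).
Let o k := c k == 1.
(** Complete blocks on four vertices between two bridges. They are as dense in bridges as the good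
    blocks but need not lengthen the distance by 3, so the weight has to detect them: over a period
    it takes the values 6, 1, 1, 1 instead of 6, 2, 2, 2. *)
Let q b := [&& o b, o (b + 4) & inner b 4 == 12].
(* The blocks that lengthen the distance by 3; the average weight over them is 3. *)
Let good b := [&& o b, o (b + 4) & inner b 4 != 12].

Let o_range k : o k -> 0 < k < n.
Proof.
rewrite /o; have [->|k0] := posnP k; first by rewrite cut_size0.
by have [kn|nk] := ltnP k n => //; rewrite (cut_size_ge a_sym).
Qed.

(** By [block_degree_sum], [r] vertices between two bridges require 3 r <= r (r - 1) + 2. This fails
    for r = 1, 2, 3 and holds for r = 4, which is the origin of the period 4. *)
Let o_sep r k : 0 < r <= 3 -> o k -> o (k + r) = false.
Proof.
move=> hr ok; apply/negbTE/negP => okr; have := o_range okr.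
have := @block_degree_sum n a a_sym k r => h kr; have {}h := h ltac:(lia).
have h3 : r * 3 <= \sum_(k <= i < k + r) odegree n a i.
  by apply: sum_ge_const_nat => i hi; apply: deg3; lia.
have := inner_edges_le a_irr k r; move: ok okr; rewrite /o => /eqP ck /eqP ckr.
by case: r hr h h3 kr ckr => [|[|[|[|r]]]] //= _ h h3 kr ckr; lia.
Qed.

Let o_sepb r k : 0 < r <= 3 -> ~~ (o k && o (k + r)).
Proof. by move=> hr; apply/negP => /andP[/(o_sep hr) ->]. Qed.

(* A bridge satisfies its row condition by itself with weight 6. Inside a complete block
   between two bridges 4 apart the overlaps are so large that weight 1 suffices. *)
Definition cubic_weight k :=
  if o k then 6 else if [|| q (k - 1), q (k - 2) | q (k - 3)] then 1 else 2.
Local Notation W := cubic_weight.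

Let q_gt0 b : q b -> 0 < b.
Proof. by case/andP => /o_range /andP[]. Qed.

Let qP k : reflect (exists2 b, q b & b < k < b + 4) [|| q (k - 1), q (k - 2) | q (k - 3)].
Proof.
apply: (iffP or3P) => [h|[b qb hb]].
  by case: h => qb; [exists (k - 1)|exists (k - 2)|exists (k - 3)] => //;
    have := q_gt0 qb; lia.
have : k - 1 = b \/ k - 2 = b \/ k - 3 = b by lia.
by case=> [e|[e|e]]; [apply: Or31|apply: Or32|apply: Or33]; rewrite e.
Qed.

(** Inside a complete block the overlaps in a row are at least 3, 2, 1 or 2, 4, 2, in some order, so
    unit weights give 6. Away from bridges and complete blocks the weights at [j.-1], [j], [j.+1]
    are at least 2, and [cut_neighbours] yields 2 (2 c j - 1) >= 6 because c j >= 2. *)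
Lemma cubic_row j : 0 < j < n -> 6 <= row_weight n a W j.
Proof.
move=> hj; case: (boolP (o j)) => oj.
  apply: leq_trans (@row_weight_ge n a a_sym W j [:: j] _ _) => //=; last by lia.
  by rewrite big_seq1 /W oj cut_overlap_diag (eqP oj).
have cj : 2 <= c j by have := cut_gt0 hj; move: oj; rewrite /o; lia.
case: (qP j) => [[b /and3P[ob ob4 /eqP eb] hb]|nq].
  have b4n := o_range ob4.
  have Wb k : b < k < b + 4 -> 0 < W k by move=> _; rewrite /W; case: ifP => // _; case: ifP.
  have mge k l : b <= k -> k <= l -> l <= b + 4 -> (k - b) * (b + 4 - l) <= m k l.
    move=> h1 h2 h3; rewrite cut_overlapE // -(@edges_full a b k l (b + 4)).
      by apply: edges_mono => //; lia.
    by move=> x y hx hy; apply: (inner_edges_complete a_sym a_irr eb); lia.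
  apply: leq_trans (@row_weight_ge n a a_sym W j [:: b.+1; b.+2; b.+3] _ _) => /=.
  - rewrite !big_cons big_nil addn0.
    have w1 := Wb b.+1 ltac:(lia); have w2 := Wb b.+2 ltac:(lia).
    have w3 := Wb b.+3 ltac:(lia).
    have : [\/ j = b.+1, j = b.+2 | j = b.+3].
      have : j = b.+1 \/ j = b.+2 \/ j = b.+3 by lia.
      by case=> [->|[->|->]]; constructor.
    case=> ->; rewrite ?(cut_overlapC _ _ b.+2 b.+1) ?(cut_overlapC _ _ b.+3).
    + have := mge b.+1 b.+1; have := mge b.+1 b.+2; have := mge b.+1 b.+3; nia.
    + have := mge b.+1 b.+2; have := mge b.+2 b.+2; have := mge b.+2 b.+3; nia.
    + have := mge b.+1 b.+3; have := mge b.+2 b.+3; have := mge b.+3 b.+3; nia.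
  - by rewrite !inE; lia.
  - by lia.
(* Weight 1 occurs only strictly inside a complete block, so a neighbour [j] of such a cut is either
   inside too or one of the two bounding bridges; both are excluded here. *)
have Wn k : j <= k.+1 -> k <= j.+1 -> 2 <= W k.
  move=> h1 h2; rewrite /W; case: ifP => // ok; case: qP => // -[b qb hb].
  case/and3P: (qb) => ob ob4 _; have : b < j < b + 4 \/ j = b \/ j = b + 4 by lia.
  case=> [hbj|[e|e]]; first by case: nq; exists b.
    by move: oj; rewrite e ob.
  by move: oj; rewrite e ob4.
apply: leq_trans (@row_weight_ge n a a_sym W j [:: j.-1; j; j.+1] _ _) => /=.
- rewrite !big_cons big_nil addn0 cut_overlap_diag.
  have := cut_neighbours a_sym hj; have := Wn j.-1 ltac:(lia) ltac:(lia).
  have := Wn j ltac:(lia) ltac:(lia); have := Wn j.+1 ltac:(lia) ltac:(lia).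
  nia.
- by rewrite !inE; lia.
- by lia.
Qed.

Let Wle k : W k <= 2 + 4 * o k.
Proof. by rewrite /W; case: ifP => // _; case: ifP. Qed.

(** Four consecutive cuts contain at most one bridge, so 2 + 4 o has average at most 3. *)
Lemma cubic_density i N : \sum_(i <= k < i + N) W k <= 3 * N + 4.
Proof.
have h : 4 * \sum_(i <= k < i + N) o k <= 1 * (N + 4).
  apply: sum_window_le => // k; rewrite sum_from !big_nat_recr //= big_geq // addn0.
  have := @o_sepb 1 k isT; have := @o_sepb 2 k isT; have := @o_sepb 3 k isT.
  have := @o_sepb 1 (k + 1) isT; have := @o_sepb 2 (k + 1) isT; have := @o_sepb 1 (k + 2) isT.
  rewrite -!addnA /=.
  case: (o k); case: (o (k + 1)); case: (o (k + 2)); case: (o (k + 3)) => //.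
have : \sum_(i <= k < i + N) W k <= \sum_(i <= k < i + N) (2 + 4 * o k).
  by apply: leq_sum => k _; apply: Wle.
rewrite big_split /= -big_distrr /= sum_nat_const_nat; lia.
Qed.

Let o_ge k : n <= k -> o k = false.
Proof. by move=> nk; apply/negbTE/negP => /o_range; lia. Qed.

Let q_sep r k : 0 < r <= 3 -> q k -> q (k + r) = false.
Proof. by move=> hr /and3P[ok _ _]; rewrite /q o_sep. Qed.

(** Five consecutive cuts contain at most one bridge, unless the first and the last are bridges and
    bound a block that is good or complete. Up to bounded terms this gives 5 sum o <= n + sum good +
    sum q. Also sum W <= 2 n + 4 sum o - 3 sum q, and the loss 15 sum q in 5 sum W outweighs the
    gain 4 sum q. Hence an average of W close to 3 forces about n / 4 good blocks. *)
Lemma cubic_defect :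
  n + 5 * \sum_(0 <= k < n) W k <= 4 * \sum_(0 <= b < n) good b + 15 * n + 205.
Proof.
(* The shift by 3 removes the truncated subtractions in the weight. At most one of the three [q]
   holds, and none if [k + 3] is a bridge. *)
have pw k : W (k + 3) + q (k + 2) + q (k + 1) + q k <= 2 + 4 * o (k + 3).
  rewrite /W; have -> : k + 3 - 1 = k + 2 by lia.
  have -> : k + 3 - 2 = k + 1 by lia.
  rewrite addnK; case: ifP => ok3.
    have nq r : r <= 2 -> q (k + r) = false.
      move=> hr; apply/negbTE/negP => /and3P[okr _ _].
      by have := @o_sep (3 - r) (k + r) ltac:(lia) okr; rewrite -addnA subnKC ?ok3 //; lia.
    by have := nq 0; rewrite addn0 !nq // => ->.
  have := @q_sep 1 k isT; have := @q_sep 2 k isT; have := @q_sep 1 (k + 1) isT.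
  rewrite -addnA; case: (q k) => [_ h1 h2|h _ _].
    by rewrite h1 // h2.
  by case: (q (k + 1)) h => [->//|_]; case: (q (k + 2)).
have w : \sum_(0 <= k < n) W k + 3 * \sum_(0 <= k < n) q k <=
    2 * n + 4 * \sum_(0 <= k < n) o k + 21.
  have h0 : \sum_(0 <= k < n) (W (k + 3) + q (k + 2) + q (k + 1) + q k) <=
      \sum_(0 <= k < n) (2 + 4 * o (k + 3)) by apply: leq_sum => k _; apply: pw.
  move: h0; rewrite !big_split /= sum_nat_const_nat.
  rewrite (@big1 _ _ _ _ _ _ (fun=> 0)) //.
  have W6 k : W k <= 6 by apply: leq_trans (Wle k) _; case: (o k).
  have q1 k : nat_of_bool (q k) <= 1 by case: (q k).
  have h1 := sum_shift_ge n 3 W6; have h2 := sum_shift_ge n 2 q1.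
  have h3 := sum_shift_ge n 1 q1.
  have h4 := @sum_shift_le (fun k => nat_of_bool (o k)) n 3.
  have {}h4 := h4 (fun k nk => congr1 nat_of_bool (o_ge nk)).
  move: h1 h2 h3 h4; move=> /=; lia.
have pw2 k : \sum_(0 <= i < 5) o (k + i) <= 1 + good k + q k.
  rewrite !big_nat_recr //= big_geq // add0n addn0 /good /q.
  have := @o_sepb 1 k isT; have := @o_sepb 2 k isT; have := @o_sepb 3 k isT.
  have := @o_sepb 1 (k + 1) isT; have := @o_sepb 2 (k + 1) isT; have := @o_sepb 3 (k + 1) isT.
  have := @o_sepb 1 (k + 2) isT; have := @o_sepb 2 (k + 2) isT; have := @o_sepb 1 (k + 3) isT.
  rewrite -!addnA /=; case: (inner k 4 == 12);
  case: (o k); case: (o (k + 1)); case: (o (k + 2)); case: (o (k + 3)); case: (o (k + 4)) => //.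
have o1 k : nat_of_bool (o k) <= 1 by case: (o k).
have h2 := sum_windows_ge n 5 o1.
have h3 : \sum_(0 <= k < n) \sum_(0 <= i < 5) o (k + i) <=
    \sum_(0 <= k < n) (1 + good k + q k) by apply: leq_sum => k _; apply: pw2.
move: h3; rewrite !big_split /= sum_nat_const_nat; lia.
Qed.

Let pred_step (d : nat -> nat) :=
  forall i, i < n -> 0 < i -> exists2 p, (p < n) && a p i & d i = (d p).+1.

(** The block has two nonadjacent vertices [x] and [y]. Each has at most two neighbours in the
    block, hence an edge leaving it. Since only one edge crosses each bounding cut, one of them is
    the entrance and the other the exit, and passing from the entrance through a third vertex to the
    exit and out takes 3 steps. *)
Lemma cubic_good_step d b D : pred_step d -> good b ->
  (forall i, b <= i < n -> D <= d i) -> forall i, b + 4 <= i < n -> D + 3 <= d i.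
Proof.
move=> pd /and3P[ob ob4 nK4] lowD.
have b4n := o_range ob4; have b0 := o_range ob.
have uni k i j i' j' := @cut_size1_unique n a k i j i' j'.
have {}uni b' : o b' -> forall i j i' j', i < b' -> b' <= j < n -> a i j ->
    i' < b' -> b' <= j' < n -> a i' j' -> i = i' /\ j = j'.
  by move=> /eqP e i j i' j'; apply: uni.
pose down l := 0 < edges_between a 0 b l l.+1.
pose up l := 0 < edges_between a l l.+1 (b + 4) n.
have downP l : reflect (exists2 p, p < b & a p l) (down l).
  apply: (iffP (edges_gt0P _ _ _ _ _)) => [[p [l' [h1 h2 h3]]]|[p h1 h2]].
    by exists p; [lia|have -> : l = l' by lia].
  by exists p, l; split => //; lia.
have upP l : reflect (exists2 p, b + 4 <= p < n & a l p) (up l).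
  apply: (iffP (edges_gt0P _ _ _ _ _)) => [[l' [p [h1 h2 h3]]]|[p h1 h2]].
    by exists p; [lia|have -> : l = l' by lia].
  by exists l, p; split => //; lia.
have [x [y [hx hy xy naxy]]] : exists x y,
    [/\ b <= x < b + 4, b <= y < b + 4, x != y & a x y = false].
  case: (boolP (all (fun x => all (fun y => (x == y) || a x y) (iota b 4)) (iota b 4))).
    move=> /allP h; case/negP: nK4; apply/eqP.
    have -> : 12 = 4 * 4.-1 by []; rewrite -(sum_neq b); apply: eq_big_nat => x hx.
    apply: eq_big_nat => y hy; have /allP/(_ y) := h x ltac:(rewrite mem_iota; lia).
    rewrite mem_iota => /(_ hy); have [->|_ /= ->//] := eqVneq x y.
    by rewrite a_irr.
  move=> /allPn[x xb /allPn[y yb]]; rewrite negb_or => /andP[xy /negbTE naxy].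
  by exists x, y; rewrite !mem_iota in xb yb.
have out z t : b <= z < b + 4 -> b <= t < b + 4 -> z != t -> a z t = false -> down z || up z.
  move=> hz ht zt nazt; have := deg3 (i := z) ltac:(lia); apply: contraLR.
  rewrite negb_or /down /up -!leqNgt !leqn0 => /andP[/eqP d0 /eqP u0].
  have -> : odegree n a z = edges_between a z z.+1 0 n.
    by rewrite /edges_between big_nat1.
  rewrite (@edges_catr a a_sym z z.+1 0 b n) ?(edges_sym a_sym z) ?d0; try lia.
  rewrite edges_sym // (@edges_catr a a_sym z z.+1 b (b + 4) n) ?u0; try lia.
  rewrite /edges_between big_nat1 add0n addn0.
  have : \sum_(b <= j < b + 4) (a z j + (j == z) + (j == t)) <= \sum_(b <= j < b + 4) 1.
    apply: leq_sum => j _; have [->|jz] := eqVneq j z; first by rewrite a_irr (negPf zt).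
    by have [->|_] := eqVneq j t; rewrite ?nazt //; case: (a z j).
  rewrite !big_split /= !sum_eq_index // sum_nat_const_nat; lia.
have dd z t : b <= z < b + 4 -> b <= t < n -> down z -> down t -> z = t.
  move=> hz ht /downP[p pb paz] /downP[p' pb' pat].
  by have [] := uni b ob p z p' t; try lia.
have uu z t : z < b + 4 -> t < b + 4 -> up z -> up t -> z = t.
  move=> hz ht /upP[p pb paz] /upP[p' pb' pat].
  by have [] := uni (b + 4) ob4 z p t p'; try lia.
have nayx : a y x = false by rewrite a_sym.
have yx : y != x by rewrite eq_sym.
have key z t : b <= z < b + 4 -> b <= t < b + 4 -> up z -> down t -> z != t /\ a z t = false.
  move=> hz ht uz dt; case/orP: (out x y hx hy xy naxy) => [dx|ux].
    case/orP: (out y x hy hx yx nayx).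
      by move=> dy; move: xy; have -> : x = y; [apply: dd => //; lia|rewrite eqxx].
    move=> uy; have -> : t = x by apply: dd => //; lia.
    by have -> : z = y by apply: uu => //; lia.
  case/orP: (out y x hy hx yx nayx).
    move=> dy; have -> : t = y by apply: dd => //; lia.
    by have -> : z = x by apply: uu => //; lia.
  by move=> uy; move: xy; have -> : x = y; [apply: uu => //; lia|rewrite eqxx].
(* An edge over the whole block would be the only edge across both cuts and leave none for [x]. *)
have nojump p i : p < b -> b + 4 <= i < n -> a p i -> False.
  move=> pb hi api; case/orP: (out x y hx hy xy naxy) => [/downP[p' h1 h2]|/upP[p' h1 h2]].
    by have [] := uni b ob p i p' x; lia.
  by have [] := uni (b + 4) ob4 p i x p'; lia.
(* The distance from the entrance, truncated to a potential: 0 at the entrance, 2 at the exit, 1 at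
   the other vertices of the block, 3 beyond it. *)
pose h i := if b + 4 <= i then 3 else if up i then 2 else if down i then 0 else 1.
have hb : forall i, b <= i < n -> D + h i <= d i.
  apply: (potential_lower_bound pd) => //.
  - by lia.
  - move=> i p hi hp api; rewrite /h; case: ifP => hi4.
      case: ifP => // hp4; have -> // : up p.
      by apply/upP; exists i => //; lia.
    case: ifP => [ui|_]; last by do 3?case: ifP.
    case: ifP => // hp4; case: ifP => // _; case: ifP => // dp.
    have [//||_] := key i p _ _ ui dp; try lia.
    by rewrite a_sym api.
  - move=> i p hi pb api; rewrite /h; case: ifP => hi4.
      by case: (nojump p i) => //; lia.
    have di : down i by apply/downP; exists p.
    rewrite di; case: ifP => // ui.
    by case: (key i i _ _ ui di); rewrite ?eqxx; lia.
move=> i hi; have := hb i ltac:(lia); rewrite /h; case: ifP; lia.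
Qed.

Lemma cubic_distance d : 0 < n -> pred_step d ->
  exists2 i, i < n & 3 * \sum_(0 <= b < n) good b <= d i.
Proof.
move=> n0 pd; exists n.-1; first by lia.
have -> : \sum_(0 <= b < n) good b = \sum_(0 <= b < n.-1.+1 - 4) good b.
  rewrite prednK // (@big_cat_nat _ _ _ (n - 4) 0 n) //=; try lia.
  rewrite [X in _ + X]big_nat [X in _ + X]big1 ?addn0 // => b hb.
  by case: (boolP (good b)) => // /and3P[_ /o_range]; lia.
apply: (@separated_chain good 4 (fun k D => forall i, k <= i < n -> D <= d i)) => //.
- by move=> k D h i hi; apply: h; lia.
- by move=> b D g lowD i hi; apply: (cubic_good_step pd g lowD).
- move=> b b' /and3P[ob _ _] h1 h2; apply/negP => /and3P[ob' _ _].
  have := @o_sep (b - b') b' ltac:(lia) ob'; rewrite subnKC ?ob //; lia.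
by lia.
Qed.

End Cubic.

(** * Quartic graphs *)

Lemma sum_shift_le_bounded (F : nat -> nat) n B i : (forall k, F k <= B) ->
  \sum_(0 <= k < n) F (k + i) <= \sum_(0 <= k < n) F k + i * B.
Proof.
move=> hB; have -> : \sum_(0 <= k < n) F (k + i) = \sum_(i <= k < n + i) F k.
  by rewrite -{2}(add0n i) big_addn addnK.
have h : \sum_(n <= k < n + i) F k <= i * B.
  by rewrite -{2}(addKn n i) -sum_nat_const_nat; apply: leq_sum.
apply: leq_trans (_ : \sum_(0 <= k < n + i) F k <= _).
  by rewrite (@big_cat_nat _ _ _ i 0 (n + i)) ?leq_addl.
by rewrite (@big_cat_nat _ _ _ n 0 (n + i)) ?leq_addr //= leq_add2l.
Qed.

Section Quartic.
Variables (n : nat) (a : nat -> nat -> bool).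
Hypothesis a_sym : forall i j, a i j = a j i.
Hypothesis a_irr : forall i, a i i = false.
Hypothesis deg4 : forall i, i < n -> odegree n a i = 4.
Hypothesis cut_gt0 : forall k, 0 < k < n -> 0 < cut_size n a k.

Local Notation c := (cut_size n a).
Local Notation m := (cut_overlap n a).
Local Notation inner := (inner_edges a).
Local Notation s := (edges_between a).
Let o k := c k == 2.
(** Vertex [b] then forms a layer by itself and the next four vertices are forced to be complete. No
    adjacency condition is needed, in contrast to minimum degree 3: regularity leaves each of the
    four exactly one edge out of their block. *)
Let good b := [&& o b, o (b + 1) & o (b + 5)].

Let o_range k : o k -> 0 < k < n.
Proof.
rewrite /o; have [->|k0] := posnP k; first by rewrite cut_size0.
by have [kn|nk] := ltnP k n => //; rewrite (cut_size_ge a_sym).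
Qed.

Let blk k r : k + r <= n -> r * 4 + 2 * m k (k + r) = inner k r + c k + c (k + r).
Proof.
move=> h; rewrite -block_degree_sum //; congr (_ + _).
rewrite (eq_big_nat _ _ (F2 := fun=> 4)) => [|i hi]; last by rewrite deg4; lia.
by rewrite sum_nat_const_nat; lia.
Qed.

(** The block identity for one vertex. It shows that consecutive cut sizes have equal parity, so all
    are even, and it determines the overlap of neighbouring cuts from their sizes. *)
Let step k : k < n -> 4 + 2 * m k k.+1 = c k + c k.+1.
Proof.
move=> kn; have := @blk k 1; have := inner_edges_le a_irr k 1; rewrite addn1; lia.
Qed.

Let c_even k : k <= n -> ~~ odd (c k).
Proof.
elim: k => [|k IH] kn; first by rewrite cut_size0.
by have := IH (ltnW kn); have := step kn; lia.
Qed.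

Let c_ge4 k : 0 < k < n -> o k = false -> 4 <= c k.
Proof. by move=> hk; rewrite /o; have := cut_gt0 hk; have := @c_even k; lia. Qed.

(** A block of [r] vertices between two cuts of size 2 requires 4 r <= r (r - 1) + 4, which fails
    for r = 2, 3 and is an equality for r = 1 and r = 4. Hence such cuts come at best in adjacent
    pairs with period 5. *)
Let o_sep r k : 1 < r <= 3 -> ~~ (o k && o (k + r)).
Proof.
move=> hr; apply/negP => /andP[ok okr]; have := o_range okr.
have := @blk k r; have := inner_edges_le a_irr k r; move: ok okr; rewrite /o => /eqP -> /eqP ->.
have : r = 2 \/ r = 3 by lia.
by case=> ->; lia.
Qed.

(** The vertices on either side of the cut have total degree at most r (r - 1) + 2, so 4 r forces r
    >= 5. This makes the truncated subtractions around a cut of size 2 harmless. *)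
Let o_far k : o k -> 5 <= k /\ k + 5 <= n.
Proof.
move=> ok; have hk := o_range ok; move: ok; rewrite /o => /eqP ck.
have h1 := @blk 0 k; have h2 := inner_edges_le a_irr 0 k.
have h3 := @blk k (n - k); have h4 := inner_edges_le a_irr k (n - k).
rewrite add0n cut_size0 ck in h1; rewrite subnKC ?ck ?(@cut_size_ge n a a_sym n) // in h3;
  last by lia.
by split; rewrite leqNgt; apply/negP => hk5;
  [have {}h1 := h1 ltac:(lia) | have {}h3 := h3 ltac:(lia)]; nia.
Qed.

(* With cuts of size 2 at b, b + 1, b + 5, b + 6, ... the weights over a period are
   6, 6, 0, 3, 0, of average 3. *)
Definition quartic_weight k :=
  if o k then 6 else if o (k - 1) || o (k + 1) then 0
  else if o (k - 2) && o (k + 2) then 3 else 2.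
Local Notation W := quartic_weight.

Let Wge2 k : o k = false -> o (k - 1) = false -> o (k + 1) = false -> 2 <= W k.
Proof. by rewrite /W => -> -> ->; case: ifP. Qed.

Let vertex_degree z : z < n -> s z z.+1 0 n = 4.
Proof. by move=> zn; rewrite -(deg4 zn) /edges_between big_nat1. Qed.

(** A cut of size 2 gives 6 times 2. Next to such a cut the overlap with it is (c j - 2) / 2, which
    suffices if c j >= 6; if c j = 4 it gives 6, and the other 6 come from the opposite side, as 3
    times 2 or as 2 times 2 plus 2 times 1. In the remaining rows c j >= 4, with weight 3 if cuts of
    size 2 lie at distance 2 on both sides, and otherwise 2 times 4 plus 2 times 2 from a neighbour
    unless c j >= 6. *)
Lemma quartic_row j : 0 < j < n -> 12 <= row_weight n a W j.
Proof.
move=> hj.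
have row r := @row_weight_ge n a a_sym W j r.
case: (boolP (o j)) => oj.
  apply: leq_trans (row [:: j] _ _) => //=; last by lia.
  by rewrite big_seq1 /W oj cut_overlap_diag (eqP oj).
have cj := c_ge4 hj (negbTE oj).
case: (boolP (o (j - 1))) => ojm.
  have jm := o_far ojm; set k := j - 1 in ojm jm *.
  have ej : j = k.+1 by rewrite /k; lia.
  have mjk : 2 + c j = 4 + 2 * m k j by have := @step k; rewrite -ej (eqP ojm); lia.
  have Wk : W k = 6 by rewrite /W ojm.
  have [c6|c6] := leqP 6 (c j).
    apply: leq_trans (row [:: k] _ _) => //=; last by lia.
    by rewrite big_seq1 Wk cut_overlapC; lia.
  have cj4 : c j = 4 by have := @c_even j; lia.
  have o2 := @o_sep 2 k isT; have o3 := @o_sep 3 k isT; rewrite ojm /= in o2 o3.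
  have mj1 : 2 * m j j.+1 = c j.+1 by have := @step j; lia.
  have oj1 : o j.+1 = false by apply/negbTE; have -> : j.+1 = k + 2 by lia.
  have oj2 : o j.+2 = false by apply/negbTE; have -> : j.+2 = k + 3 by lia.
  have cj1 : 4 <= c j.+1 by apply: c_ge4; lia.
  have Wj1 : W j.+1 = if o (j + 3) then 3 else 2.
    rewrite /W oj1; have -> : j.+1 - 1 = j by lia.
    have -> : j.+1 + 1 = j.+2 by lia.
    have -> : j.+1 - 2 = k by lia.
    have -> : j.+1 + 2 = j + 3 by lia.
    by rewrite (negbTE oj) oj2 ojm.
  case: (boolP (o (j + 3))) Wj1 => oj3 Wj1.
    apply: leq_trans (row [:: k; j.+1] _ _) => /=.
    + by rewrite !big_cons big_nil Wk Wj1 cut_overlapC; lia.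
    + by rewrite !inE; lia.
    + by lia.
  have Wj2 : 2 <= W j.+2.
    apply: Wge2; rewrite ?subn1 //.
    by apply/negbTE; have -> : j.+2 + 1 = j + 3 by lia.
  (* Only one of the two edges across the cut [k] ends at vertex [k], so three edges go forward from
     [k]; at most two of them end at [j] and [j.+1], and the third crosses both cuts. *)
  have mj2 : 1 <= m j j.+2.
    rewrite cut_overlapE; last by lia.
    apply: leq_trans (edges_mono a_sym (leq0n k) (leqnn j) (leqnn j.+2) (leqnn n)).
    have v := @vertex_degree k ltac:(lia).
    have e1 := @edges_catr a a_sym k k.+1 0 k n ltac:(lia) ltac:(lia).
    have e2 := @edges_catr a a_sym k k.+1 k k.+1 n ltac:(lia) ltac:(lia).
    have e3 := @edges_catr a a_sym k k.+1 k.+1 k.+3 n ltac:(lia) ltac:(lia).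
    have b3 := edges_le_box a k k.+1 k.+1 k.+3.
    have kk : s k k.+1 k k.+1 = 0 by rewrite /edges_between !big_nat1 a_irr.
    have ck : c k = 2 by apply/eqP.
    have e4 := @edges_catr a a_sym 0 k k k.+1 n ltac:(lia) ltac:(lia).
    have := edges_sym a_sym 0 k k k.+1.
    move: ck mjk; rewrite /cut_size cut_overlapE; last by lia.
    rewrite ej in cj4 *; rewrite /cut_size in cj4; rewrite cj4; lia.
  apply: leq_trans (row [:: k; j.+1; j.+2] _ _) => /=.
  - rewrite !big_cons big_nil Wk Wj1 cut_overlapC; nia.
  - by rewrite !inE; lia.
  - by lia.
case: (boolP (o (j + 1))) => ojp.
  rewrite addn1 in ojp; have jm := o_far ojp; set k := j.+1 in ojp jm *.
  have mjk : 2 + c j = 4 + 2 * m j k by have := @step j; rewrite -/k (eqP ojp); lia.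
  have Wk : W k = 6 by rewrite /W ojp.
  have [c6|c6] := leqP 6 (c j).
    apply: leq_trans (row [:: k] _ _) => //=; last by lia.
    by rewrite big_seq1 Wk; lia.
  have cj4 : c j = 4 by have := @c_even j; lia.
  have o2 : o (j - 1) = false by apply/negbTE/ojm.
  have o3 : o (j - 2) = false.
    apply/negbTE; have := @o_sep 3 (j - 2) isT.
    have -> : j - 2 + 3 = k by rewrite /k; lia.
    by rewrite ojp andbT.
  have mj1 : 2 * m j (j - 1) = c (j - 1).
    have := @step (j - 1); have -> : (j - 1).+1 = j by lia.
    by rewrite (cut_overlapC _ _ j); lia.
  have cj1 : 4 <= c (j - 1) by apply: c_ge4; lia.
  have Wj1 : W (j - 1) = if o (j - 3) then 3 else 2.
    rewrite /W o2; have -> : j - 1 - 1 = j - 2 by lia.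
    have -> : j - 1 + 1 = j by lia.
    have -> : j - 1 - 2 = j - 3 by lia.
    have -> : j - 1 + 2 = k by lia.
    by rewrite (negbTE oj) o3 ojp andbT.
  case: (boolP (o (j - 3))) Wj1 => oj3 Wj1.
    apply: leq_trans (row [:: k; j - 1] _ _) => /=.
    + by rewrite !big_cons big_nil Wk Wj1; lia.
    + by rewrite !inE; lia.
    + by lia.
  have Wj2 : 2 <= W (j - 2).
    apply: Wge2 => //; first by apply/negbTE; have -> : j - 2 - 1 = j - 3 by lia.
    by have -> : j - 2 + 1 = j - 1 by lia.
  have mj2 : 1 <= m j (j - 2).
    rewrite cut_overlapC cut_overlapE; last by lia.
    apply: leq_trans (edges_mono a_sym (leqnn 0) (leqnn (j - 2)) (leqnn j) (_ : j.+1 <= n));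
      last by lia.
    rewrite edges_sym //.
    have v := @vertex_degree j ltac:(lia).
    have e1 := @edges_catr a a_sym j j.+1 0 (j - 2) n ltac:(lia) ltac:(lia).
    have e2 := @edges_catr a a_sym j j.+1 (j - 2) j n ltac:(lia) ltac:(lia).
    have e3 := @edges_catr a a_sym j j.+1 j j.+1 n ltac:(lia) ltac:(lia).
    have b3 := edges_le_box a j j.+1 (j - 2) j.
    have kk : s j j.+1 j j.+1 = 0 by rewrite /edges_between !big_nat1 a_irr.
    have ck : c k = 2 by apply/eqP.
    have e4 := @edges_catl a 0 j j.+1 j.+1 n ltac:(lia) ltac:(lia).
    move: ck mjk; rewrite cj4 /cut_size /k cut_overlapE; last by lia.
    lia.
  apply: leq_trans (row [:: k; j - 1; j - 2] _ _) => /=.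
  - rewrite !big_cons big_nil Wk Wj1; nia.
  - by rewrite !inE; lia.
  - by lia.
have Wj : W j = if o (j - 2) && o (j + 2) then 3 else 2.
  by rewrite /W (negbTE oj) (negbTE ojm) (negbTE ojp).
have [c6|c6] := leqP 6 (c j).
  apply: leq_trans (row [:: j] _ _) => //=; last by lia.
  by rewrite big_seq1 cut_overlap_diag Wj; case: ifP => _; lia.
have cj4 : c j = 4 by have := @c_even j; lia.
case: (boolP (o (j - 2) && o (j + 2))) Wj => [_ Wj|ojj Wj].
  apply: leq_trans (row [:: j] _ _) => //=; last by lia.
  by rewrite big_seq1 cut_overlap_diag Wj cj4.
case: (boolP (~~ o (j + 2) && (j.+1 < n))) => [/andP[oj2 jn]|hp].
  have cj1 : 4 <= c j.+1 by apply: c_ge4; rewrite // -addn1; apply/negbTE.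
  have mj1 : 2 * m j j.+1 = c j.+1 by have := @step j; lia.
  have Wj1 : 2 <= W j.+1.
    apply: Wge2; rewrite ?subn1 ?addn1; apply/negbTE => //; first by rewrite -addn1.
    by rewrite -addn2.
  apply: leq_trans (row [:: j; j.+1] _ _) => /=.
  - by rewrite !big_cons big_nil cut_overlap_diag Wj cj4; nia.
  - by rewrite !inE; lia.
  - by lia.
case: (boolP (~~ o (j - 2) && (1 < j))) => [/andP[oj2 jn]|hm].
  have cj1 : 4 <= c (j - 1) by apply: c_ge4; [lia|apply/negbTE].
  have mj1 : 2 * m j (j - 1) = c (j - 1).
    have := @step (j - 1); have -> : (j - 1).+1 = j by lia.
    by rewrite (cut_overlapC _ _ j); lia.
  have Wj1 : 2 <= W (j - 1).
    apply: Wge2; apply/negbTE => //; last by rewrite subnK //; lia.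
    by rewrite -subnDA.
  apply: leq_trans (row [:: j; j - 1] _ _) => /=.
  - by rewrite !big_cons big_nil cut_overlap_diag Wj cj4; nia.
  - by rewrite !inE; lia.
  - by lia.
(* What remains has [j] next to one end of the ordering and a cut of size 2 at distance 2 on the
   other side, or [j] next to both ends. The former contradicts [o_far], the latter [2 < n]. *)
have n2 : 2 < n.
  have := @blk 0 n; have := inner_edges_le a_irr 0 n;
    rewrite add0n cut_size0 (@cut_size_ge n a a_sym n) //.
  by nia.
have f1 := @o_far (j - 2); have f2 := @o_far (j + 2).
by case: (o (j - 2)) (o (j + 2)) ojj hp hm f1 f2 => [] [] //= _ h1 h2 h3 h4; lia.
Qed.

Let u k := nat_of_bool (o k && o (k + 1)).
Let v k := nat_of_bool (o k && o (k + 4)).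

(** Linearizes the weight in the small cuts and in their pairs at distance 1 ([u]) and 4 ([v]).
    After summation over [k] the terms in [o] cancel up to the boundary, and what is left of the
    weight is 2 + 4 u + v. *)
Let weight_identity k : W (k + 2) + 2 * o (k + 1) + 2 * o (k + 3) =
  2 + 4 * o (k + 2) + 2 * u (k + 1) + 2 * u (k + 2) + v k.
Proof.
rewrite /W /u /v -!addnA addnK /=; have -> : k + 2 - 1 = k + 1 by lia.
have := @o_sep 2 k isT; have := @o_sep 3 k isT; have := @o_sep 2 (k + 1) isT.
have := @o_sep 3 (k + 1) isT; have := @o_sep 2 (k + 2) isT; rewrite -!addnA /=.
by case: (o k); case: (o (k + 1)); case: (o (k + 2)); case: (o (k + 3)); case: (o (k + 4)).
Qed.

(** Five is attained by one adjacent pair and one pair at distance 4. The separations from [o_sep]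
    leave finitely many configurations of the nine cuts involved. *)
Let pair_window k : \sum_(0 <= i < 5) (4 * u (k + i) + v (k + i)) <= 5.
Proof.
rewrite !big_nat_recr //= big_geq // /u /v.
have := @o_sep 2 k isT; have := @o_sep 3 k isT.
have := @o_sep 2 (k + 1) isT; have := @o_sep 3 (k + 1) isT.
have := @o_sep 2 (k + 2) isT; have := @o_sep 3 (k + 2) isT.
have := @o_sep 2 (k + 3) isT; have := @o_sep 3 (k + 3) isT.
have := @o_sep 2 (k + 4) isT; have := @o_sep 3 (k + 4) isT.
have := @o_sep 2 (k + 5) isT; have := @o_sep 3 (k + 5) isT.
have := @o_sep 2 (k + 6) isT.
rewrite -!addnA /= !addn0.
case: (o k) => /=; case: (o (k + 1)) => //=; case: (o (k + 2)) => //=;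
case: (o (k + 3)) => //=; case: (o (k + 4)) => //=; case: (o (k + 5)) => //=;
by case: (o (k + 6)) => //=; case: (o (k + 7)) => //=; case: (o (k + 8)).
Qed.

(** Stability of the previous bound: if two successive windows both attain 5, a good block starts in
    the first of them. A single full window does not suffice for this conclusion, which is why two
    are compared. *)
Let pair_windows k :
  1 + \sum_(0 <= i < 5) (4 * u (k + i) + v (k + i)) +
  \sum_(0 <= i < 5) (4 * u (k + 1 + i) + v (k + 1 + i)) <=
  10 + \sum_(0 <= i < 5) good (k + i).
Proof.
rewrite !big_nat_recr //= !big_geq // /u /v /good.
have := @o_sep 2 k isT; have := @o_sep 3 k isT.
have := @o_sep 2 (k + 1) isT; have := @o_sep 3 (k + 1) isT.
have := @o_sep 2 (k + 2) isT; have := @o_sep 3 (k + 2) isT.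
have := @o_sep 2 (k + 3) isT; have := @o_sep 3 (k + 3) isT.
have := @o_sep 2 (k + 4) isT; have := @o_sep 3 (k + 4) isT.
have := @o_sep 2 (k + 5) isT; have := @o_sep 3 (k + 5) isT.
have := @o_sep 2 (k + 6) isT; have := @o_sep 3 (k + 6) isT; have := @o_sep 2 (k + 7) isT.
rewrite -!addnA /= !addn0.
case: (o k) => /=; case: (o (k + 1)) => //=; case: (o (k + 2)) => //=;
case: (o (k + 3)) => //=; case: (o (k + 4)) => //=; case: (o (k + 5)) => //=;
by case: (o (k + 6)) => //=; case: (o (k + 7)) => //=; case: (o (k + 8)) => //=; case: (o (k + 9)).
Qed.

Let W6 k : W k <= 6.
Proof. by rewrite /W; do 3![case: ifP => // _]. Qed.

Let o1 k : nat_of_bool (o k) <= 1. Proof. by case: (o k). Qed.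
Let u1 k : u k <= 1. Proof. by rewrite /u; case: (_ && _). Qed.

Let weight_sum i N : \sum_(i <= k < i + N) W k <=
  2 * N + \sum_(i <= k < i + N) (4 * u k + v k) + 24.
Proof.
rewrite (sum_from W) (sum_from (fun k => 4 * u k + v k)).
have h1 := @sum_shift_ge (fun x => W (i + x)) N 6 2 (fun=> W6 _).
have key : \sum_(0 <= x < N) W (i + x + 2) + 2 * \sum_(0 <= x < N) o (i + x + 1)
    + 2 * \sum_(0 <= x < N) o (i + x + 3) =
  2 * N + 4 * \sum_(0 <= x < N) o (i + x + 2) + 2 * \sum_(0 <= x < N) u (i + x + 1)
    + 2 * \sum_(0 <= x < N) u (i + x + 2) + \sum_(0 <= x < N) v (i + x).
  have -> : 2 * N = \sum_(0 <= x < N) 2 by rewrite sum_nat_const_nat; lia.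
  rewrite !big_distrr -!big_split; apply: eq_bigr => x _; exact: weight_identity.
have -> : \sum_(0 <= x < N) (4 * u (i + x) + v (i + x)) =
    4 * \sum_(0 <= x < N) u (i + x) + \sum_(0 <= x < N) v (i + x).
  by rewrite big_distrr -big_split.
have sh (F : nat -> nat) (r : nat) : (forall k, F k <= 1) ->
    \sum_(0 <= x < N) F (i + x + r) <= \sum_(0 <= x < N) F (i + x) + r.
  move=> F1; have := @sum_shift_le_bounded (fun x => F (i + x)) N 1 r (fun=> F1 _).
  by rewrite muln1 => h; apply: leq_trans h; apply: leq_sum => x _; rewrite addnA.
have so (r r' : nat) : r' <= r -> \sum_(0 <= x < N) nat_of_bool (o (i + x + r')) <=
    \sum_(0 <= x < N) nat_of_bool (o (i + x + r)) + (r - r').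
  move=> rr; have := @sum_shift_ge (fun x => nat_of_bool (o (i + x + r'))) N 1 (r - r') (fun=> o1 _).
  rewrite muln1; move/leq_trans; apply; rewrite leq_add2r; apply: leq_sum => x _.
  by have -> : i + (x + (r - r')) + r' = i + x + r by lia.
have so' (r r' : nat) : r <= r' -> \sum_(0 <= x < N) nat_of_bool (o (i + x + r')) <=
    \sum_(0 <= x < N) nat_of_bool (o (i + x + r)) + (r' - r).
  move=> rr; have := @sum_shift_le_bounded (fun x => nat_of_bool (o (i + x + r))) N 1 (r' - r)
    (fun=> o1 _).
  rewrite muln1 => h; apply: leq_trans h; apply: leq_sum => x _.
  by have -> : i + (x + (r' - r)) + r = i + x + r' by lia.
have := sh u 1 u1; have := sh u 2 u1.
have := so 3 2 isT; have := so' 1 2 isT.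
have h1' : \sum_(0 <= x < N) W (i + (x + 2)) = \sum_(0 <= x < N) W (i + x + 2).
  by apply: eq_bigr => x _; rewrite addnA.
rewrite h1' in h1.
move: key h1; lia.
Qed.

Lemma quartic_density i N : \sum_(i <= k < i + N) W k <= 3 * N + 29.
Proof.
have h : 5 * \sum_(i <= k < i + N) (4 * u k + v k) <= 5 * (N + 5).
  by apply: sum_window_le => // k; rewrite sum_from; apply: pair_window.
have := weight_sum i N; lia.
Qed.

Let good_ge k : n <= k -> nat_of_bool (good k) = 0.
Proof. by move=> nk; rewrite /good; case: (boolP (o k)) => // /o_range; lia. Qed.

(** Summing [pair_windows] over all [k] counts 4 u + v ten times and each good block at most five
    times; [weight_sum] translates 4 u + v into the weight. *)
Lemma quartic_defect :
  n + 10 * \sum_(0 <= k < n) W k <= 5 * \sum_(0 <= b < n) good b + 30 * n + 1000.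
Proof.
have h1 := weight_sum 0 n; rewrite add0n in h1.
pose F k := 4 * u k + v k.
have {}h1 : \sum_(0 <= k < n) W k <= 2 * n + \sum_(0 <= k < n) F k + 24 := h1.
have F5 k : F k <= 5 by rewrite /F /u /v; do 2!case: (_ && _).
have h2 := sum_windows_ge n 5 F5.
have h3 : 5 * \sum_(0 <= k < n) F k <=
    \sum_(0 <= k < n) \sum_(0 <= i < 5) F (k + 1 + i) + 150.
  have := @sum_windows_ge (fun k => F (k + 1)) n 5 5 (fun=> F5 _).
  have := sum_shift_ge n 1 F5.
  have -> : \sum_(0 <= k < n) \sum_(0 <= i < 5) F (k + i + 1) =
    \sum_(0 <= k < n) \sum_(0 <= i < 5) F (k + 1 + i).
    by do 2![apply: eq_bigr => ? _]; rewrite addnAC.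
  lia.
have h4 : \sum_(0 <= k < n) (1 + \sum_(0 <= i < 5) F (k + i) + \sum_(0 <= i < 5) F (k + 1 + i))
    <= \sum_(0 <= k < n) (10 + \sum_(0 <= i < 5) good (k + i)).
  by apply: leq_sum => k _; apply: pair_windows.
have h5 : \sum_(0 <= k < n) \sum_(0 <= i < 5) good (k + i) <= 5 * \sum_(0 <= b < n) good b.
  rewrite exchange_big_nat /=.
  have -> : 5 * \sum_(0 <= b < n) good b = \sum_(0 <= i < 5) \sum_(0 <= b < n) good b.
    by rewrite sum_nat_const_nat.
  by apply: leq_sum => i _; apply: sum_shift_le => k; apply: good_ge.
move: h4; rewrite !big_split /= !sum_nat_const_nat.
lia.
Qed.

Let pred_step (d : nat -> nat) :=
  forall i, i < n -> 0 < i -> exists2 p, (p < n) && a p i & d i = (d p).+1.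

(** The degree count is tight, so vertices [b + 1] to [b + 4] are complete and no edge passes over
    them or over [b]. Every path therefore goes through [b], and a neighbour of [b] in the complete
    block has already used its four edges, so leaving the block takes a second vertex of it. *)
Lemma quartic_good_step d b D : pred_step d -> good b ->
  (forall i, b <= i < n -> D <= d i) -> forall i, b + 5 <= i < n -> D + 3 <= d i.
Proof.
move=> pd /and3P[ob ob1 ob5] lowD.
have b5n := o_range ob5; have b0 := o_range ob.
have hb : inner (b + 1) 4 = 4 * 4.-1 /\ m (b + 1) (b + 5) = 0.
  have := @blk (b + 1) 4; have -> : b + 1 + 4 = b + 5 by lia.
  rewrite (eqP ob1) (eqP ob5).
  by have := inner_edges_le a_irr (b + 1) 4; lia.
have [K4 nj1] := hb.
have nj0 : m b (b + 1) = 0.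
  have := @blk b 1; rewrite (eqP ob) (eqP ob1); have := inner_edges_le a_irr b 1; lia.
have nojump x y i p : m x y = 0 -> x <= y -> i < x -> y <= p < n -> a i p = false.
  move=> m0 xy hi hp; case E : (a i p) => //.
  have : 0 < m x y by rewrite cut_overlapE //; apply/edges_gt0P; exists i, p.
  by rewrite m0.
pose up l := 0 < s l l.+1 (b + 5) n.
have upP l p : b + 5 <= p < n -> a l p -> up l.
  by move=> h1 h2; apply/edges_gt0P; exists l, p; split => //; lia.
have nup z : b + 1 <= z < b + 5 -> a b z -> up z -> False.
  move=> hz abz uz; have hv := @vertex_degree z ltac:(lia).
  have e1 := @edges_catr a a_sym z z.+1 0 b n ltac:(lia) ltac:(lia).
  have e2 := @edges_catr a a_sym z z.+1 b b.+1 n ltac:(lia) ltac:(lia).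
  have e3 := @edges_catr a a_sym z z.+1 b.+1 (b + 5) n ltac:(lia) ltac:(lia).
  have w1 : 0 < s z z.+1 b b.+1 by apply/edges_gt0P; exists z, b; rewrite a_sym; split => //; lia.
  have w2 : 3 <= s z z.+1 b.+1 (b + 5).
    rewrite /edges_between big_nat1.
    have : \sum_(b.+1 <= j < b + 5) 1 <= \sum_(b.+1 <= j < b + 5) (a z j + (j == z)).
      rewrite big_seq [X in _ <= X]big_seq; apply: leq_sum => j; rewrite mem_index_iota => hj.
      have [->|jz] := eqVneq j z; first by rewrite addn1.
      by rewrite (inner_edges_complete a_sym a_irr K4) //; lia.
    by rewrite big_split /= sum_nat_const_nat sum_eq_index; lia.
  move: uz; rewrite /up; lia.
pose h i := if b + 5 <= i then 3 else if i == b then 0 else if up i then 2 else 1.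
have hh : forall i, b <= i < n -> D + h i <= d i.
  apply: (potential_lower_bound pd) => //.
  - by lia.
  - move=> i p hi hp api; rewrite /h; case: ifP => hi5.
      case: ifP => // hp5; case: eqP => [pb|pb].
        by move: api; rewrite pb (nojump (b + 1) (b + 5)) //; lia.
      by rewrite (upP p i) //; lia.
    case: eqP => // ib; case: ifP => // ui; case: ifP => // hp5.
    case: eqP => [pb|pb]; last by case: ifP.
    by case: (nup i) => //; [lia|rewrite -pb].
  - move=> i p hi pb api; rewrite /h.
    have -> : i = b.
      apply/eqP; case: eqP => // ib.
      by move: api; rewrite (nojump b (b + 1)) //; lia.
    by rewrite eqxx; case: ifP => //; lia.
move=> i hi; have := hh i ltac:(lia); rewrite /h; case: ifP; lia.
Qed.

Lemma quartic_distance d : 0 < n -> pred_step d ->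
  exists2 i, i < n & 3 * \sum_(0 <= b < n) good b <= d i.
Proof.
move=> n0 pd; exists n.-1; first by lia.
have -> : \sum_(0 <= b < n) good b = \sum_(0 <= b < n.-1.+1 - 5) good b.
  rewrite prednK // (@big_cat_nat _ _ _ (n - 5) 0 n) //=; try lia.
  rewrite [X in _ + X]big_nat [X in _ + X]big1 ?addn0 // => b hb.
  by case: (boolP (good b)) => // /and3P[_ _ /o_range]; lia.
apply: (@separated_chain good 5 (fun k D => forall i, k <= i < n -> D <= d i)) => //.
- by move=> k D h i hi; apply: h; lia.
- by move=> b D g lowD i hi; apply: (quartic_good_step pd g lowD).
- move=> b b' /and3P[ob ob1 _] h1 h2; apply/negP => /and3P[ob' ob1' _].
  (* Starts 4 apart are excluded through the second cut of the earlier block, which is 3 before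
     [b]. *)
  have : b = b' + 1 \/ b = b' + 2 \/ b = b' + 3 \/ b = b' + 1 + 3 by lia.
  case=> [e|[e|[e|e]]]; move: ob ob1; rewrite e.
  + by rewrite -addnA; have := @o_sep 2 b' isT; rewrite ob' /= => /negPf -> _.
  + by have := @o_sep 2 b' isT; rewrite ob' /= => /negPf ->.
  + by have := @o_sep 3 b' isT; rewrite ob' /= => /negPf ->.
  + by have := @o_sep 3 (b' + 1) isT; rewrite ob1' /= => /negPf ->.
by lia.
Qed.

End Quartic.

Import Order.TTheory GRing.Theory Num.Theory numFieldNormedType.Exports.
Local Open Scope classical_set_scope.
Local Open Scope ring_scope.

(** * The Laplacian spectrum *)

Section Spectrum.
Local Open Scope sesquilinear_scope.

(** The unitary matrix may be complex although the eigenvalues are real. For this reason the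
    quadratic forms below are evaluated on complex vectors, through the energies of their real and
    imaginary parts. *)
Lemma real_symmetric_unitarily_diagonalizable (R : realType) n (A : 'M[R]_n) :
  A^T = A -> exists P : 'M[R[i]]_n, exists d : 'I_n -> R,
    P \is unitarymx /\
    map_mx (real_complex R) A =
      P^t* *m diag_mx (\row_i (d i)%:C%C) *m P.
Proof.
move=> sA; set B := map_mx (real_complex R) A.
have hB : B \is hermsymmx.
  apply: realsym_hermsym.
    by apply/is_hermitianmxP; rewrite expr0 scale1r map_mx_id //; apply/matrixP => i j;
      rewrite !mxE -[in LHS]sA mxE.
  by apply/mxOverP => i j; rewrite mxE complex_real.
have := hermitian_spectral_diag_real hB.
have /hermitian_normalmx/orthomx_spectralP := hB.
set P := spectralmx B; set D := spectral_diag B => eB rD.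
exists P, (fun i => complex.Re (D 0 i)); split; first exact: spectral_unitarymx.
have -> : \row_i (complex.Re (D 0 i))%:C%C = D.
  by apply/rowP => i; rewrite mxE RRe_real //; exact: (mxOverP rD).
by rewrite -invmx_unitary ?spectral_unitarymx.
Qed.

Lemma char_poly_conjugate (F : fieldType) n (P A : 'M[F]_n) :
  P \in unitmx -> char_poly (invmx P *m A *m P) = char_poly A.
Proof.
move=> uP; rewrite /char_poly /char_poly_mx !map_mxM /=.
have eX : 'X%:M = map_mx polyC (invmx P) *m 'X%:M *m map_mx polyC P :> 'M[{poly F}]_n.
  by rewrite scalar_mxC -mulmxA -map_mxM mulVmx // map_mx1 mulmx1.
rewrite {1}eX -mulmxBl -mulmxBr !det_mulmx mulrC mulrA -det_mulmx -map_mxM mulmxV //.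
by rewrite map_mx1 det1 mul1r.
Qed.

Lemma spectrum_perm (R : realType) n (A : 'M[R]_n) (s : seq R) :
  char_poly A = \prod_(a <- s) ('X - a%:P) ->
  sorted <=%R (spectrum A) /\ perm_eq (spectrum A) s.
Proof.
rewrite /spectrum; set p := char_poly A => ep.
have p0 : p != 0 by apply/monic_neq0/char_poly_monic.
split.
  have : sorted <%R (rootsR p) by apply: sorted_roots.
  elim: (rootsR p) => [|a r IH] //= pr.
  rewrite sorted_pairwise; last exact: le_trans.
  rewrite pairwise_cat; apply/and3P; split.
  - apply/allrelP => x y /nseqP[-> _] /flatten_mapP[b br /nseqP[-> _]].
    by rewrite ltW //; move: (order_path_min lt_trans pr) => /allP; apply.
  - by rewrite -sorted_pairwise; [elim: mup => //= -[//|k] /= ->; rewrite lexx|exact: le_trans].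
  - by rewrite -sorted_pairwise; [exact/IH/(path_sorted pr)|exact: le_trans].
apply/allP => /= x _; apply/eqP.
transitivity (mup x p); last by rewrite ep mu_prod_XsubC.
rewrite count_flatten -map_comp sumnE big_map.
under eq_bigr do rewrite /= count_nseq /=.
have ur : uniq (rootsR p) by apply/lt_sorted_uniq/sorted_roots.
case: (boolP (x \in rootsR p)) => xr.
  rewrite (bigD1_seq x) //= eqxx mul1n big1 ?addn0 // => a /negPf ax.
  by rewrite ax.
rewrite big1_seq => [|a /andP[_ ar]]; last first.
  by have [ax|//] := eqVneq a x; rewrite -ax ar in xr.
rewrite mupNroot //; apply: contra xr => rx.
by rewrite -(roots_on_rootsR p0) rx andbT in_itv.
Qed.

(** Singles out one index [i0] of a smallest eigenvalue: annihilating that coordinate alone makes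
    the form at least the second eigenvalue times the squared norm. *)
Lemma second_eigenvalue_split (R : realType) n (A : 'M[R]_n) (d : 'I_n -> R) :
  (1 < n)%N -> char_poly A = \prod_i ('X - (d i)%:P) ->
  exists i0 i1, [/\ i0 != i1, d i1 = (spectrum A)`_1, d i0 <= (spectrum A)`_1 &
    forall i, i != i0 -> (spectrum A)`_1 <= d i].
Proof.
move=> n1 cp.
have [ss ps] : sorted <=%R (spectrum A) /\
    perm_eq (spectrum A) [tuple d i | i < n].
  by apply: spectrum_perm; rewrite cp big_tuple; apply: eq_bigr => i _; rewrite tnth_mktuple.
have /tuple_permP[p sp] := ps.
have nth_s (k : 'I_n) : (spectrum A)`_k = d (p k).
  by rewrite sp -(tnth_nth 0) !tnth_mktuple.
have szs : size (spectrum A) = n by rewrite (perm_size ps) size_tuple.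
have le_nth i j : (i <= j)%N -> (j < n)%N -> (spectrum A)`_i <= (spectrum A)`_j.
  by move=> ij jn; apply: (sorted_leq_nth le_trans le_refl 0 ss); rewrite ?inE ?szs //;
    apply: leq_ltn_trans jn.
have n0 : (0 < n)%N by apply: ltn_trans n1.
exists (p (Ordinal n0)), (p (Ordinal n1)); split.
- by rewrite (inj_eq perm_inj).
- by rewrite -nth_s.
- by rewrite -nth_s le_nth.
move=> i; have [j ->] : exists j, i = p j by exists (p^-1%g i); rewrite permKV.
move=> jn0.
rewrite -nth_s le_nth // lt0n; apply: contra jn0 => /eqP j0.
by apply/eqP; congr (p _); apply/val_inj.
Qed.

Lemma degree_sum n (G : sgraph n) x : degree G x = (\sum_w G x w)%N.
Proof.
rewrite /degree -sum1_card big_mkcond; apply: eq_bigr => w _.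
by have -> : (w \in G x) = G x w by []; case: (G x w).
Qed.

Lemma degreeE (F : pzSemiRingType) n (G : sgraph n) i :
  (degree G i)%:R = \sum_j (G i j)%:R :> F.
Proof. by rewrite degree_sum natr_sum. Qed.

Lemma laplacian_form (F : comPzRingType) n (G : sgraph n) (u v : 'I_n -> F) :
  (\sum_i \sum_j ((degree G i)%:R *+ (i == j) - (G i j)%:R) * (u i * v j)) *+ 2 =
  \sum_i \sum_j (G i j)%:R * ((u i - u j) * (v i - v j)).
Proof.
have -> : \sum_i \sum_j ((degree G i)%:R *+ (i == j) - (G i j)%:R) * (u i * v j) =
  \sum_i \sum_j ((G i j)%:R * (u i * v i) - (G i j)%:R * (u i * v j)).
  apply: eq_bigr => i _; under eq_bigr do rewrite mulrBl.
  rewrite !sumrB; congr (_ - _).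
  rewrite (bigD1 i) //= eqxx big1 ?addr0 => [|j /negPf ji]; last first.
    by rewrite eq_sym ji mulr0n mul0r.
  by rewrite mulr1n degreeE mulr_suml.
rewrite mulr2n {2}exchange_big /= -big_split; apply: eq_bigr => i _ /=.
rewrite -big_split; apply: eq_bigr => j _ /=.
rewrite (adj_sym G j i); ring.
Qed.

(** Edges occur as ordered pairs, so this is twice the Laplacian quadratic form; hence the factors
    [*+ 2]. *)
Definition energy (R : realType) n (G : sgraph n) (g : 'I_n -> R) : R :=
  \sum_i \sum_j (G i j)%:R * (g i - g j) ^+ 2.

Lemma energy_ge0 (R : realType) n (G : sgraph n) (g : 'I_n -> R) : 0 <= energy G g.
Proof. by do 2![apply: sumr_ge0 => ? _]; rewrite mulr_ge0 ?sqr_ge0 ?ler0n. Qed.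

Lemma connected_const n (G : sgraph n) (T : Type) (g : 'I_n -> T) :
  gconnected G -> (forall i j, G i j -> g i = g j) -> forall i j, g i = g j.
Proof.
move=> /andP[_ /forallP cG] h i j.
move/forallP/(_ j)/connectP: (cG i) => [p pp ->].
by elim: p i pp => //= k p IH i /andP[/h -> /IH].
Qed.

Lemma energy_eq0 (R : realType) n (G : sgraph n) (g : 'I_n -> R) :
  gconnected G -> energy G g = 0 -> forall i j, g i = g j.
Proof.
move=> cG /eqP; rewrite psumr_eq0 => [/allP E0|i _]; last first.
  by apply: sumr_ge0 => ? _; rewrite mulr_ge0 ?sqr_ge0 ?ler0n.
apply: (connected_const cG) => i j Gij.
have := E0 i (mem_index_enum _); rewrite psumr_eq0 => [/allP/(_ j (mem_index_enum _))|k _].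
  by rewrite Gij mul1r sqrf_eq0 subr_eq0 => /eqP.
by rewrite mulr_ge0 ?sqr_ge0 ?ler0n.
Qed.

Lemma laplacian_sym (R : realType) n (G : sgraph n) : (laplacian R G)^T = laplacian R G.
Proof.
apply/matrixP => i j; rewrite !mxE (adj_sym G j i) [j == i]eq_sym.
by case: eqP => // ->.
Qed.

Lemma unitary_diag_form (C : numClosedFieldType) n (P D : 'M[C]_n) (d : 'I_n -> C)
    (v : 'rV[C]_n) : D = P^t* *m diag_mx (\row_i d i) *m P ->
  (v *m D *m v^t*) 0 0 = \sum_i d i * ((v *m P^t*) 0 i * ((v *m P^t*) 0 i)^*).
Proof.
move=> ->; set w := v *m P^t*.
have -> : v *m (P^t* *m diag_mx (\row_i d i) *m P) *m v^t* =
    w *m diag_mx (\row_i d i) *m w^t*.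
  by rewrite /w trmx_mul map_mxM /= trmxCK !mulmxA.
by rewrite mul_mx_diag !mxE; apply: eq_bigr => i _; rewrite !mxE; ring.
Qed.

Lemma re_normsq_ge0 (R : rcfType) (z : R[i]) : 0 <= complex.Re (`|z| ^+ 2).
Proof. by rewrite -add_Re2_Im2 addr_ge0 ?sqr_ge0. Qed.

Lemma re_normsq0 (R : rcfType) : complex.Re (`|0 : R[i]| ^+ 2) = 0.
Proof. by rewrite normr0 expr0n. Qed.

Section Laplacian.
Variables (R : realType) (n : nat) (G : sgraph n).
Local Notation L := (laplacian R G).
Local Notation toC := (real_complex R).

Lemma laplacian_complex_form (v : 'rV[R[i]]_n) :
  ((v *m map_mx toC L *m v^t*) 0 0) *+ 2 =
  (energy G (fun i => complex.Re (v 0 i)) + energy G (fun i => complex.Im (v 0 i)))%:C%C.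
Proof.
transitivity (\sum_i \sum_j (G i j)%:R *
   ((v 0 i - v 0 j) * ((v 0 i)^* - (v 0 j)^*)) : R[i]).
  rewrite -(@laplacian_form _ _ _ (fun i => v 0 i) (fun j => (v 0 j)^*)).
  congr (_ *+ 2); rewrite mxE exchange_big; apply: eq_bigr => j _ /=.
  rewrite !mxE mulr_suml; apply: eq_bigr => i _ /=.
  by rewrite !mxE rmorphB rmorphMn !rmorph_nat; ring.
rewrite /energy -big_split rmorph_sum; apply: eq_bigr => i _ /=.
rewrite -big_split rmorph_sum; apply: eq_bigr => j _ /=.
rewrite -mulrDr rmorphM rmorph_nat; congr (_ * _).
by rewrite -rmorphB -normCK -add_Re2_Im2; case: (v 0 i) (v 0 j) => [? ?] [? ?] /=.
Qed.

Lemma complex_norm_form (v : 'rV[R[i]]_n) :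
  (v *m v^t*) 0 0 = (\sum_i (complex.Re (v 0 i) ^+ 2 + complex.Im (v 0 i) ^+ 2))%:C%C.
Proof.
rewrite rmorph_sum mxE; apply: eq_bigr => i _ /=.
by rewrite !mxE -normCK add_Re2_Im2.
Qed.

Lemma laplacian_unitary_diag : exists P : 'M[R[i]]_n, exists d : 'I_n -> R,
  [/\ P \is unitarymx, char_poly L = \prod_i ('X - (d i)%:P),
   forall v : 'rV[R[i]]_n,
    energy G (fun i => complex.Re (v 0 i)) + energy G (fun i => complex.Im (v 0 i)) =
    (\sum_i d i * complex.Re (`|(v *m P^t*) 0 i| ^+ 2)) *+ 2 &
   forall v : 'rV[R[i]]_n,
    \sum_i (complex.Re (v 0 i) ^+ 2 + complex.Im (v 0 i) ^+ 2) =
    \sum_i complex.Re (`|(v *m P^t*) 0 i| ^+ 2)].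
Proof.
have [P [d [uP eL]]] := real_symmetric_unitarily_diagonalizable (laplacian_sym R G).
have reC (z : R[i]) : (complex.Re (`|z| ^+ 2))%:C%C = `|z| ^+ 2.
  by rewrite RRe_real // realX // normr_real.
exists P, d; split => // [|v|v].
- apply: (map_poly_inj toC); rewrite map_char_poly eL rmorph_prod.
  rewrite -(invmx_unitary uP) char_poly_conjugate ?unitarymx_unit //.
  rewrite char_poly_trig ?diag_mx_is_trig //; apply: eq_bigr => i _ /=.
  by rewrite map_polyXsubC !mxE eqxx mulr1n.
- apply: (@complexI R); rewrite -laplacian_complex_form (unitary_diag_form _ eL).
  rewrite rmorphMn rmorph_sum; congr (_ *+ 2); apply: eq_bigr => i _ /=.
  by rewrite rmorphM /= reC normCK.
apply: (@complexI R); rewrite -complex_norm_form.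
have -> : v *m v^t* = (v *m P^t*) *m (v *m P^t*)^t*.
  rewrite trmx_mul map_mxM trmxCK mulmxA -(mulmxA v).
  by rewrite -(invmx_unitary uP) mulVmx ?unitarymx_unit // mulmx1.
rewrite rmorph_sum mxE; apply: eq_bigr => i _ /=.
by rewrite !mxE reC normCK.
Qed.

Hypothesis cG : gconnected G.
Hypothesis n1 : (1 < n)%N.
Local Notation mu := (algebraic_connectivity R G).

Lemma orthogonal_combination (F : fieldType) (a b : F) :
  exists x y, (x, y) != (0, 0) /\ x * a + y * b = 0.
Proof.
have [->|a0] := eqVneq a 0.
  by exists 1, 0; rewrite mulr0 mul0r addr0 xpair_eqE oner_eq0.
exists (- b), a; rewrite xpair_eqE (negPf a0) andbF; split => //; ring.
Qed.

(** The span of the constants and [g] contains a nonzero vector without component at [i0], whose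
    form is at least mu times its squared norm. Its constant part is orthogonal to [g], adds nothing
    to the energy and only increases the norm. *)
Lemma algebraic_connectivity_energy (g : 'I_n -> R) : \sum_i g i = 0 ->
  mu * (\sum_i g i ^+ 2) *+ 2 <= energy G g.
Proof.
move=> g0; have [P [d [uP cp fE fN]]] := laplacian_unitary_diag.
have [i0 [i1 [_ _ _ dmu]]] := second_eigenvalue_split n1 cp.
have : exists x y : R[i], (x, y) != (0, 0) /\
    ((\row_i (x + y * (g i)%:C%C)) *m P^t*) 0 i0 = 0.
  have [x [y [xy0 xyE]]] := orthogonal_combination
    (((const_mx 1 : 'rV_n) *m P^t*) 0 i0) (((\row_i (g i)%:C%C) *m P^t*) 0 i0).
  exists x, y; split => //; rewrite -{}xyE !mxE !mulr_sumr -big_split.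
  by apply: eq_bigr => i _ /=; rewrite !mxE; ring.
move=> [[x1 x2] [[y1 y2] [xy0 w0]]].
set v := (\row_i _ : 'rV_n) in w0.
have reE i : complex.Re (v 0 i) = x1 + y1 * g i by rewrite mxE /=; ring.
have imE i : complex.Im (v 0 i) = x2 + y2 * g i by rewrite mxE /=; ring.
have n0 : 0 < n%:R :> R by rewrite ltr0n ltnW.
have E2 a b : energy G (fun i => a + b * g i) = b ^+ 2 * energy G g.
  rewrite /energy mulr_sumr; apply: eq_bigr => i _; rewrite mulr_sumr.
  by apply: eq_bigr => j _; ring.
have N2 a b : \sum_i (a + b * g i) ^+ 2 = a ^+ 2 * n%:R + b ^+ 2 * \sum_i g i ^+ 2.
  transitivity (\sum_i (a ^+ 2 + (a * b *+ 2 * g i + b ^+ 2 * g i ^+ 2))).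
    by apply: eq_bigr => i _; ring.
  rewrite !big_split /= sumr_const card_ord -!mulr_sumr g0 mulr0 add0r.
  by rewrite mulr_natr.
have le : mu * (\sum_i (complex.Re (v 0 i) ^+ 2 + complex.Im (v 0 i) ^+ 2)) *+ 2 <=
    energy G (fun i => complex.Re (v 0 i)) + energy G (fun i => complex.Im (v 0 i)).
  rewrite fE fN ler_pMn2r // mulr_sumr; apply: ler_sum => i _.
  have [->|ii0] := eqVneq i i0; first by rewrite w0 re_normsq0 !mulr0.
  by apply: ler_wpM2r; [exact: re_normsq_ge0|exact: dmu].
move: le; rewrite big_split /=.
under eq_bigr do rewrite reE; under [X in _ + X]eq_bigr do rewrite imE.
have -> : (fun i => complex.Re (v 0 i)) = (fun i => x1 + y1 * g i) by apply/funext.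
have -> : (fun i => complex.Im (v 0 i)) = (fun i => x2 + y2 * g i) by apply/funext.
rewrite !E2 !N2; set E := energy G g; set S := \sum_i _.
have E0 : 0 <= E by apply: energy_ge0.
have S0 : 0 <= S by apply: sumr_ge0 => i _; apply: sqr_ge0.
have [mu0|mu0] := leP mu 0; first by move=> _; nra.
move=> le.
have hx : 0 <= (x1 ^+ 2 + x2 ^+ 2) * (mu * n%:R).
  apply: mulr_ge0; first by rewrite addr_ge0 ?sqr_ge0.
  by apply: mulr_ge0; apply: ltW.
(* If the coefficient of [g] vanishes, the vector is a nonzero constant of energy 0, which is
   impossible for positive mu. *)
have [y0|y0] := eqVneq (y1 ^+ 2 + y2 ^+ 2) 0; last first.
  have yp : 0 < y1 ^+ 2 + y2 ^+ 2 by rewrite lt_def y0 addr_ge0 ?sqr_ge0.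
  by rewrite -(ler_pM2l yp); nra.
move: y0 => /eqP; rewrite paddr_eq0 ?sqr_ge0 // !sqrf_eq0 => /andP[/eqP y10 /eqP y20].
have x0 : x1 ^+ 2 + x2 ^+ 2 <= 0.
  by rewrite -(pmulr_lle0 _ (mulr_gt0 mu0 n0)) mulrC; move: le; rewrite y10 y20; lra.
have /eqP : x1 ^+ 2 + x2 ^+ 2 = 0 by apply/eqP; rewrite eq_le x0 addr_ge0 ?sqr_ge0.
rewrite paddr_eq0 ?sqr_ge0 // !sqrf_eq0 => /andP[/eqP x10 /eqP x20].
by move: xy0; rewrite x10 x20 y10 y20 eqxx.
Qed.

(** Otherwise a nonzero combination of the eigenvectors at [i0] and [i1] with entries summing to 0
    has energy at most 0; by connectivity it is constant, hence 0. *)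
Lemma algebraic_connectivity_gt0 : 0 < mu.
Proof.
have [P [d [uP cp fE fN]]] := laplacian_unitary_diag.
have [i0 [i1 [i01 dmu dmu0 _]]] := second_eigenvalue_split n1 cp.
rewrite ltNge; apply/negP => mu0.
have [x [y [xy0 xyE]]] := orthogonal_combination
    ((P *m const_mx 1 : 'cV_n) i0 0) ((P *m const_mx 1 : 'cV_n) i1 0).
pose w : 'rV_n := x *: delta_mx 0 i0 + y *: delta_mx 0 i1.
pose v := w *m P.
have vP : v *m P^t* = w by rewrite /v mulmxtVK.
have v1 : \sum_i v 0 i = 0.
  transitivity ((v *m (const_mx 1 : 'cV_n)) 0 0).
    by rewrite mxE; apply: eq_bigr => i _; rewrite [X in _ * X]mxE mulr1.
  have rE k (M : 'cV[R[i]]_n) z : (z *: row k M) 0 0 = z * M k 0 by rewrite !mxE.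
  by rewrite -mulmxA mulmxDl -!scalemxAl -!rowE mxE !rE.
have w0 i : i != i0 -> i != i1 -> w 0 i = 0.
  by move=> /negPf h0 /negPf h1; rewrite !mxE eqxx h0 h1 /= !mulr0 addr0.
have E0 : energy G (fun i => complex.Re (v 0 i)) + energy G (fun i => complex.Im (v 0 i)) <= 0.
  rewrite fE pmulrn_lle0 // sumr_le0 // => i _; rewrite vP.
  have [->|h0] := eqVneq i i0.
    by apply: mulr_le0_ge0 (re_normsq_ge0 _); exact: le_trans dmu0 mu0.
  have [->|h1] := eqVneq i i1; first by apply: mulr_le0_ge0 (re_normsq_ge0 _); rewrite dmu.
  by rewrite w0 // re_normsq0 mulr0.
have eR := energy_ge0 G (fun i => complex.Re (v 0 i)).
have eI := energy_ge0 G (fun i => complex.Im (v 0 i)).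
have cst (g : 'I_n -> R) : energy G g = 0 -> \sum_i g i = 0 -> forall i, g i = 0.
  move=> /(energy_eq0 cG) c s i; move: s.
  under eq_bigr do rewrite (c _ i).
  rewrite sumr_const card_ord => /eqP; rewrite mulrn_eq0 => /orP[/eqP n0|/eqP //].
  by move: n1; rewrite n0.
have v0 : v = 0.
  apply/rowP => i; rewrite [RHS]mxE; apply/eqP; rewrite eq_complex; apply/andP; split; apply/eqP.
    by apply: (cst (fun i => complex.Re (v 0 i))); [lra|rewrite -raddf_sum v1].
  by apply: (cst (fun i => complex.Im (v 0 i))); [lra|rewrite -raddf_sum v1].
have {}w0 : w = 0 by rewrite -vP v0 mul0mx.
have := congr1 (fun u : 'rV_n => (u 0 i0, u 0 i1)) w0.
rewrite !mxE !eqxx /= [i1 == i0]eq_sym (negPf i01) /= !mulr0 !mulr1 addr0 add0r => /eqP.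
by rewrite (negPf xy0).
Qed.

Lemma fiedler_vector : exists f : 'I_n -> R,
  [/\ exists i, f i != 0, \sum_i f i = 0 &
    forall i, \sum_j (G i j)%:R * (f i - f j) = mu * f i].
Proof.
have [P [d [uP cp fE fN]]] := laplacian_unitary_diag.
have [i0 [i1 [_ dmu _ _]]] := second_eigenvalue_split n1 cp.
have : root (char_poly L) mu.
  by rewrite /algebraic_connectivity -dmu cp; apply/rootP;
    rewrite horner_prod (bigD1 i1) //= !hornerE subrr mul0r.
rewrite -eigenvalue_root_char => /eigenvalueP[v vL v0].
have eE i : \sum_j (G i j)%:R * (v 0 i - v 0 j) = mu * v 0 i.
  move/rowP/(_ i): vL; rewrite !mxE => <-.
  under [RHS]eq_bigr do rewrite mxE mulrBr.
  rewrite sumrB [X in _ = X - _](bigD1 i) //= eqxx mulr1n [X in _ + X - _]big1 ?addr0 => [|j ji];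
    last by rewrite (negPf ji) mulr0.
  rewrite degreeE mulr_sumr -sumrB; apply: eq_bigr => j _.
  by rewrite (adj_sym G j i); ring.
exists (fun i => v 0 i); split => //.
  by move/rV0Pn: v0.
apply/eqP; rewrite -(mulrI_eq0 _ (lregP (lt0r_neq0 algebraic_connectivity_gt0))).
apply/eqP; rewrite mulr_sumr; under eq_bigr do rewrite -eE.
(* The terms are antisymmetric in the two ends of an edge, so mu times the sum of the entries is
   0. *)
set S := LHS; suff : S = - S by move=> h; lra.
rewrite {1}/S exchange_big -sumrN /=; apply: eq_bigr => i _.
by rewrite -sumrN; apply: eq_bigr => j _; rewrite (adj_sym G j i); ring.
Qed.
End Laplacian.

End Spectrum.

(** * The lower bound on the algebraic connectivity *)

Section Sequences.
Variable R : realFieldType.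
Implicit Types (x psi F phi : nat -> R).

(* Replacing the partial sums of [x] by their running maximum changes them by at most [C] and
   makes the increments nonnegative. *)
Lemma almost_nondecreasing_sum x psi (C L b : R) (n p q : nat) :
  (forall i N, - C <= \sum_(i <= k < i + N) x k) -> 0 <= C ->
  (forall k, 0 <= psi k) -> psi n = 0 ->
  (forall k, (k < n)%N -> `|psi k.+1 - psi k| <= L) ->
  0 <= b -> (p <= q <= n)%N -> (forall k, (p <= k < q)%N -> b <= psi k) ->
  b * (\sum_(p <= k < q) x k - C) - C * (n%:R * L) <= \sum_(0 <= k < n) x k * psi k.
Proof.
move=> hx C0 psi0 psin hL b0 hpq hb.
pose U k := \sum_(0 <= i < k) x i.
pose fix V k := if k is k'.+1 then Num.max (V k') (U k) else U 0%N.
have US k : U k.+1 = U k + x k by rewrite /U big_nat_recr.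
have UV k : U k <= V k by case: k => [|k] //=; rewrite le_max lexx orbT.
have Umon i N : U i - C <= U (i + N)%N.
  by have := hx i N; rewrite /U (@big_cat_nat _ _ _ i 0 (i + N)) ?leq_addr //=; lra.
have VU k : V k <= U k + C.
  have : forall j, (k <= j)%N -> V k <= U j + C.
    elim: k => [|k IH] j kj /=.
      by have := Umon 0%N j; rewrite add0n; lra.
    rewrite ge_max IH /=; last exact: ltnW.
    by have := Umon k.+1 (j - k.+1)%N; rewrite subnKC //; lra.
  by apply.
pose y k := V k.+1 - V k; pose E k := V k - U k.
have y0 k : 0 <= y k by rewrite subr_ge0 /= le_max lexx.
have E0 k : 0 <= E k by rewrite subr_ge0.
have EC k : E k <= C by rewrite /E; have := VU k; lra.
have -> : \sum_(0 <= k < n) x k * psi k =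
    \sum_(0 <= k < n) y k * psi k - (E n * psi n - E 0%N * psi 0%N)
    + \sum_(0 <= k < n) E k.+1 * (psi k.+1 - psi k).
  rewrite -(@telescope_sumr _ 0 n (fun k => E k * psi k)) // -sumrB -big_split /=.
  by apply: eq_bigr => k _; rewrite /y /E US; ring.
have -> : E 0%N = 0 by rewrite /E /= subrr.
rewrite psin mul0r mulr0 subrr subr0.
have h1 : - (C * (n%:R * L)) <= \sum_(0 <= k < n) E k.+1 * (psi k.+1 - psi k).
  rewrite mulrCA -mulrN mulr_natl -[n in X in X <= _]subn0 -sumr_const_nat.
  rewrite big_nat [X in _ <= X]big_nat; apply: ler_sum => k /andP[_ kn].
  have hk := hL k kn; have L0 : 0 <= L := le_trans (normr_ge0 _) hk.
  move: hk; rewrite ler_norml => /andP[hk _].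
  have e1 : 0 <= E k.+1 * (psi k.+1 - psi k + L) by apply: mulr_ge0 => //; lra.
  have e2 : 0 <= (C - E k.+1) * L by apply: mulr_ge0 => //; have := EC k.+1; lra.
  lra.
have h2 : b * (\sum_(p <= k < q) x k - C) <= \sum_(0 <= k < n) y k * psi k.
  have /andP[pq qn] := hpq.
  apply: (@le_trans _ _ (b * (V q - V p))).
    apply: ler_wpM2l => //; have := UV q; have := VU p.
    by rewrite /U (@big_cat_nat _ _ _ p 0 q) //=; lra.
  rewrite -(@telescope_sumr _ p q V) // (@big_cat_nat _ _ _ q 0 n) //=.
  rewrite (@big_cat_nat _ _ _ p 0 q) //= mulr_sumr.
  apply: (@le_trans _ _ (\sum_(p <= i < q) y i * psi i)).
    rewrite big_nat [X in _ <= X]big_nat; apply: ler_sum => k hk.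
    by rewrite mulrC ler_wpM2l ?y0 // hb.
  rewrite addrAC lerDr addr_ge0 //; apply: sumr_ge0 => k _; exact: mulr_ge0.
lra.
Qed.

Lemma discrete_green F phi n :
  F 0%N = 0 -> F n = 0 -> phi 0%N = 0 -> phi n = 0 ->
  \sum_(1 <= k < n) phi k * (2 * F k - F k.+1 - F k.-1) =
  \sum_(1 <= k < n) F k * (2 * phi k - phi k.+1 - phi k.-1).
Proof.
move=> F0 Fn p0 pn; case: n Fn pn => [|n] Fn pn; first by rewrite !big_geq.
apply/eqP; rewrite -subr_eq0 -sumrB.
pose T k := F k.-1 * phi k - phi k.-1 * F k.
rewrite (eq_big_nat _ _ (F2 := fun k => T k.+1 - T k)); last first.
  by move=> k hk; rewrite /T /=; ring.
by rewrite telescope_sumr // /T /= F0 Fn p0 pn !mul0r !mulr0 subrr.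
Qed.

Lemma le_sum_nat_const (c : R) k l F : (k <= l)%N ->
  (forall i, (k <= i < l)%N -> c <= F i) -> (l - k)%:R * c <= \sum_(k <= i < l) F i.
Proof.
move=> kl h; rewrite mulr_natl -sumr_const_nat big_nat [X in _ <= X]big_nat.
exact: ler_sum.
Qed.

Lemma ge_sum_nat_const (c : R) k l F : (k <= l)%N ->
  (forall i, (k <= i < l)%N -> F i <= c) -> \sum_(k <= i < l) F i <= (l - k)%:R * c.
Proof.
move=> kl h; rewrite mulr_natl -sumr_const_nat big_nat [X in _ <= X]big_nat.
exact: ler_sum.
Qed.

Lemma tail_average (f : nat -> R) n k l :
  (forall i j, (i <= j < n)%N -> f i <= f j) -> (k <= l <= n)%N ->
  (n - l)%:R * \sum_(k <= i < n) f i <= (n - k)%:R * \sum_(l <= i < n) f i.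
Proof.
move=> sf /andP[kl ln]; rewrite (@big_cat_nat _ _ _ l k n) //=.
have [->|lltn] := eqVneq l n; first by rewrite subnn mul0r big_geq // mulr0.
have hl : (l < n)%N by lia.
have h1 := @ge_sum_nat_const (f l) k l f kl (fun i hi => sf i l ltac:(lia)).
have h2 := @le_sum_nat_const (f l) l n f ln (fun i hi => sf l i ltac:(lia)).
have -> : (n - k)%:R = (n - l)%:R + (l - k)%:R :> R by rewrite -natrD; congr _%:R; lia.
rewrite mulrDr mulrDl addrC lerD2l.
apply: (@le_trans _ _ ((n - l)%:R * ((l - k)%:R * f l))).
  by apply: ler_wpM2l.
by rewrite mulrCA; apply: ler_wpM2l.
Qed.

Lemma head_average (f : nat -> R) n k l :
  (forall i j, (i <= j < n)%N -> f i <= f j) -> (k <= l <= n)%N ->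
  l%:R * \sum_(0 <= i < k) f i <= k%:R * \sum_(0 <= i < l) f i.
Proof.
move=> sf /andP[kl ln]; rewrite (@big_cat_nat _ _ _ k 0 l) //=.
have [->|kll] := eqVneq k l; first by rewrite (@big_geq _ _ _ l) // addr0.
have hl : (k < l)%N by lia.
have h1 := @ge_sum_nat_const (f k) 0 k f (leq0n _) (fun i hi => sf i k ltac:(lia)).
have h2 := @le_sum_nat_const (f k) k l f kl (fun i hi => sf k i ltac:(lia)).
have -> : l%:R = k%:R + (l - k)%:R :> R by rewrite -natrD; congr _%:R; lia.
rewrite subn0 in h1; rewrite mulrDr mulrDl lerD2l.
apply: (@le_trans _ _ ((l - k)%:R * (k%:R * f k))).
  by apply: ler_wpM2l.
by rewrite mulrCA; apply: ler_wpM2l.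
Qed.
End Sequences.

Lemma cut_overlap_indicator n (a : nat -> nat -> bool) k x :
  (forall i j, a i j = a j i) -> (k <= n)%N -> (x <= n)%N ->
  cut_overlap n a k x =
  (\sum_(k <= i < n) \sum_(0 <= j < k) ((j < x) && (x <= i)) * a i j)%N.
Proof.
move=> a_sym kn xn; rewrite /cut_overlap edges_sym // /edges_between.
have lo (G : nat -> nat) : (\sum_(maxn k x <= i < n) G i = \sum_(k <= i < n) (x <= i) * G i)%N.
  rewrite (@big_cat_nat _ _ _ (maxn k x) k n) //=; try lia.
  rewrite [X in (_ = X + _)%N]big_nat [X in (_ = X + _)%N]big1 ?add0n => [|i hi].
    by apply: eq_big_nat => i hi; rewrite (_ : (x <= i)%N) ?mul1n //; lia.
  by rewrite leqNgt (_ : (i < x)%N) //; lia.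
have hi (G : nat -> nat) : (\sum_(0 <= j < minn k x) G j = \sum_(0 <= j < k) (j < x) * G j)%N.
  rewrite (@big_cat_nat _ _ _ (minn k x) 0 k) //=; try lia.
  rewrite [X in (_ = _ + X)%N]big_nat [X in (_ = _ + X)%N]big1 ?addn0 => [|i hi].
    by apply: eq_big_nat => i hi; rewrite (_ : (i < x)%N) ?mul1n //; lia.
  by rewrite ltnNge (_ : (x <= i)%N) //; lia.
rewrite lo; apply: eq_bigr => i _; rewrite hi big_distrr /=.
by apply: eq_bigr => j _; rewrite mulnA; case: (x <= i)%N; case: (j < x)%N.
Qed.

(** * Tail sums of a sorted eigenvector *)

Section OrderedEigenvector.
Variables (R : realFieldType) (n : nat) (a : nat -> nat -> bool) (f : nat -> R) (mu : R).
Hypothesis a_sym : forall i j, a i j = a j i.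
Hypothesis f_sorted : forall i j, (i <= j < n)%N -> f i <= f j.
Hypothesis f_eigen : forall i, (i < n)%N ->
  \sum_(0 <= j < n) (a i j)%:R * (f i - f j) = mu * f i.
Hypothesis f_sum0 : \sum_(0 <= i < n) f i = 0.
Hypothesis f_neq0 : exists2 i, (i < n)%N & f i != 0.

Local Notation m := (cut_overlap n a).
Definition tail_sum k := \sum_(k <= i < n) f i.
Local Notation F := tail_sum.
Let g k := f k - f k.-1.

Let g_ge0 k : (k < n)%N -> 0 <= g k.
Proof. by move=> kn; rewrite subr_ge0 f_sorted //; lia. Qed.

Let diff_sum i j : (j <= i < n)%N ->
  f i - f j = \sum_(1 <= x < n) (j < x <= i)%N%:R * g x.
Proof.
move=> hij; rewrite -(@telescope_sumr _ j i f); last by lia.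
have -> : \sum_(j <= k < i) (f k.+1 - f k) = \sum_(j.+1 <= x < i.+1) g x.
  by rewrite -[j.+1]addn1 big_addn subn1; apply: eq_bigr => x _; rewrite /g addn1.
rewrite (@big_cat_nat _ _ _ j.+1 1 n) //=; try lia.
rewrite (@big_cat_nat _ _ _ i.+1 j.+1 n) //=; try lia.
rewrite [X in _ = X + _]big_nat [X in _ = X + _]big1 ?add0r => [|x hx]; last first.
  by rewrite ltnNge (_ : (x <= j)%N) ?mul0r //; lia.
rewrite [X in _ = _ + X]big_nat [X in _ = _ + X]big1 ?addr0 => [|x hx]; last first.
  by rewrite [(x <= i)%N]leqNgt (_ : (i < x)%N) ?andbF ?mul0r //; lia.
by apply: eq_big_nat => x hx; rewrite (_ : (j < x <= i)%N) ?mul1r //; lia.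
Qed.

(** Edges with both ends in the tail cancel by antisymmetry. Over each remaining edge the difference
    of [f] is the sum of the gaps at the cuts it crosses, and all these edges cross the cut before
    [k]. *)
Lemma cut_flow k : (k <= n)%N -> \sum_(1 <= x < n) (m k x)%:R * g x = mu * F k.
Proof.
move=> kn.
have -> : mu * F k = \sum_(k <= i < n) \sum_(0 <= j < k) (a i j)%:R * (f i - f j).
  transitivity (\sum_(k <= i < n) \sum_(0 <= j < n) (a i j)%:R * (f i - f j)).
    by rewrite /F mulr_sumr; apply: eq_big_nat => i hi; rewrite f_eigen //; lia.
  have -> : \sum_(k <= i < n) \sum_(0 <= j < n) (a i j)%:R * (f i - f j) =
    \sum_(k <= i < n) \sum_(0 <= j < k) (a i j)%:R * (f i - f j) +
    \sum_(k <= i < n) \sum_(k <= j < n) (a i j)%:R * (f i - f j).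
    by rewrite -big_split; apply: eq_bigr => i _; rewrite (@big_cat_nat _ _ _ k 0 n).
  rewrite addrC; set S := (X in X + _ = _); suff : S = - S by move=> h; lra.
  rewrite {1}/S exchange_big_nat -sumrN /=; apply: eq_bigr => i _.
  by rewrite -sumrN; apply: eq_bigr => j _; rewrite a_sym; ring.
transitivity (\sum_(k <= i < n) \sum_(0 <= j < k) \sum_(1 <= x < n)
    ((j < x <= i) * a i j)%N%:R * g x).
  rewrite [RHS](eq_bigr (fun i => \sum_(1 <= x < n) \sum_(0 <= j < k)
    ((j < x <= i) * a i j)%N%:R * g x)); last by move=> i _; rewrite exchange_big_nat.
  rewrite exchange_big_nat /=; apply: eq_big_nat => x hx.
  rewrite cut_overlap_indicator //; last by lia.
  rewrite natr_sum mulr_suml; apply: eq_bigr => i _.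
  by rewrite natr_sum mulr_suml.
apply: eq_big_nat => i hi; apply: eq_big_nat => j hj.
rewrite diff_sum; last by lia.
by rewrite mulr_sumr; apply: eq_bigr => x _; rewrite natrM; ring.
Qed.

Lemma tail_sum0 : F 0 = 0. Proof. exact: f_sum0. Qed.
Lemma tail_sum_n : F n = 0. Proof. by rewrite /F big_geq. Qed.

Lemma tail_sum_step k : (k < n)%N -> F k = f k + F k.+1.
Proof. by move=> kn; rewrite /F big_ltn. Qed.

Lemma tail_sum_head k : (k <= n)%N -> F k = - \sum_(0 <= i < k) f i.
Proof.
by move=> kn; have := f_sum0; rewrite (@big_cat_nat _ _ _ k 0 n) //= => /eqP;
  rewrite addr_eq0 => /eqP ->; rewrite opprK.
Qed.

Lemma tail_sum_ge0 k : (k <= n)%N -> 0 <= F k.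
Proof.
move=> kn; have [->|kn0] := eqVneq k n; first by rewrite tail_sum_n.
have h : (0 <= k <= n)%N by lia.
have := tail_average f_sorted h; rewrite -/(F k) -/(F 0) tail_sum0 mulr0 subn0.
by rewrite pmulr_rge0 // ltr0n; lia.
Qed.

Lemma tail_sum_max : exists2 l, (l <= n)%N & 0 < F l /\
  forall k, (k <= n)%N -> F k <= F l.
Proof.
pose l := [arg max_(i > ord0 : 'I_n.+1) F i]%O.
have lmax k : (k <= n)%N -> F k <= F l.
  rewrite -ltnS => kn; rewrite /l; case: arg_maxP => //= i _ h.
  exact: (h (Ordinal kn)).
exists l; [by rewrite -ltnS|split => //].
rewrite lt_def tail_sum_ge0 -1?ltnS // andbT; apply/eqP => Fl0.
have F0 k : (k <= n)%N -> F k = 0.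
  by move=> kn; apply/eqP; rewrite eq_le tail_sum_ge0 // -Fl0 lmax.
have [i hi] := f_neq0; have := tail_sum_step hi; rewrite !F0 //; last by lia.
by rewrite addr0 => <-; rewrite eqxx.
Qed.

(** [F] is concave because [f] is sorted, so it lies above the tent of height [M] over the position
    of its maximum. The product k (n - k) / n^2 is below every such tent, so that position is
    irrelevant. *)
Lemma tail_sum_lower M k : (forall k, (k <= n)%N -> F k <= M) ->
  (exists2 l, (l <= n)%N & F l = M) -> (k <= n)%N ->
  M * (k%:R * (n - k)%:R) <= n%:R ^+ 2 * F k.
Proof.
move=> hM [l ln Fl] kn.
have F0 := tail_sum_ge0 kn; have M0 : 0 <= M by rewrite -Fl tail_sum_ge0.
have nk : (n - k)%:R <= n%:R :> R by rewrite ler_nat leq_subr.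
have k0 : 0 <= k%:R :> R by []. have nk0 : 0 <= (n - k)%:R :> R by [].
have kn' : k%:R <= n%:R :> R by rewrite ler_nat.
have [kl|lk] := leqP k l.
  have h : (k <= l <= n)%N by rewrite kl.
  have := head_average f_sorted h; move: Fl F0; rewrite !tail_sum_head // => Fl F0 hh.
  have ln' : l%:R <= n%:R :> R by rewrite ler_nat.
  set S := \sum_(0 <= i < k) f i in F0 hh *; set T := \sum_(0 <= i < l) f i in Fl hh.
  have : k%:R * M <= n%:R * - S.
    rewrite -Fl mulrN; apply: (@le_trans _ _ (l%:R * - S)); first by lra.
    by apply: ler_wpM2r.
  move=> h2; apply: (@le_trans _ _ (n%:R * (k%:R * M))).
    by have := ler_wpM2l (mulr_ge0 k0 M0) nk; lra.
  by have := ler_wpM2l (ler0n R n) h2; lra.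
have h : (l <= k <= n)%N by lia.
have := tail_average f_sorted h; rewrite -/(F k) -/(F l) Fl => hh.
have ln' : (n - l)%:R <= n%:R :> R by rewrite ler_nat leq_subr.
have h2 : (n - k)%:R * M <= n%:R * F k.
  by apply: le_trans hh _; apply: ler_wpM2r.
apply: (@le_trans _ _ (n%:R * ((n - k)%:R * M))).
  by have := ler_wpM2l (mulr_ge0 nk0 M0) kn'; lra.
by have := ler_wpM2l (ler0n R n) h2; lra.
Qed.

Hypothesis mu_gt0 : 0 < mu.
Hypothesis cut_gt0 : forall k, (0 < k < n)%N -> (0 < cut_size n a k)%N.

(* Every cut is crossed by an edge, so each gap of [f] is at most [mu * M]. *)
Lemma eigenvector_bound M i : (forall k, (k <= n)%N -> F k <= M) -> (i < n)%N ->
  `|f i| <= n%:R * (mu * M).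
Proof.
move=> hM hi.
have gM x : (0 < x < n)%N -> g x <= mu * M.
  move=> hx; apply: (@le_trans _ _ (mu * F x)); last by rewrite ler_pM2l // hM //; lia.
  rewrite -cut_flow; last by lia.
  rewrite (bigD1_seq x) ?mem_index_iota ?iota_uniq //=.
  apply: (@le_trans _ _ ((m x x)%:R * g x)).
    have g0 := g_ge0 (k := x); rewrite -[X in X <= _]mul1r ler_wpM2r ?g0 //; try lia.
    by rewrite cut_overlap_diag ler1n cut_gt0.
  rewrite lerDl big_seq_cond sumr_ge0 // => y; rewrite mem_index_iota => hy.
  by rewrite mulr_ge0 // g_ge0 //; lia.
have tot : f n.-1 - f 0%N <= n%:R * (mu * M).
  rewrite -(@telescope_sumr _ 0 n.-1 f); last by lia.
  apply: le_trans (ge_sum_nat_const (c := mu * M) (leq0n _) _) _.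
    by move=> j hj; apply: (gM j.+1); lia.
  apply: ler_wpM2r; last by rewrite ler_nat; lia.
  by rewrite mulr_ge0 ?(ltW mu_gt0) // -tail_sum_n hM.
have f0 : f 0%N <= 0.
  rewrite leNgt; apply/negP => f0; have := le_sum_nat_const (leq0n n) (F := f) (c := f 0%N).
  move=> /(_ (fun i hi => @f_sorted 0%N i ltac:(lia))); rewrite f_sum0 subn0 leNgt.
  by rewrite mulr_gt0 // ltr0n; lia.
have fn : 0 <= f n.-1.
  rewrite leNgt; apply/negP => fn; have := ge_sum_nat_const (leq0n n) (F := f) (c := f n.-1).
  move=> /(_ (fun i hi => @f_sorted i n.-1 ltac:(lia))); rewrite f_sum0 subn0 leNgt.
  by rewrite nmulr_llt0 ?ltr0n //; lia.
have h1 : f 0%N <= f i by apply: f_sorted; lia.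
have h2 : f i <= f n.-1 by apply: f_sorted; lia.
by rewrite ler_norml; apply/andP; split; lra.
Qed.

End OrderedEigenvector.

(** * Estimates for sine and cosine *)

Section Trigonometry.
Variable R : realType.
Implicit Types x y d : R.

Lemma sin_mvt x d : 0 <= d -> exists2 c, x <= c <= x + d & sin (x + d) - sin x = cos c * d.
Proof.
move=> d0; have xd : x <= x + d by rewrite lerDl.
have [c] := @MVT_segment R sin cos x (x + d) xd (fun y _ => is_derive_sin y)
  (continuous_subspaceT (@continuous_sin R)).
by rewrite in_itv /= => h ->; exists c => //; rewrite addrC addKr.
Qed.

Lemma cos_mvt x d : 0 <= d -> exists2 c, x <= c <= x + d & cos (x + d) - cos x = - sin c * d.
Proof.
move=> d0; have xd : x <= x + d by rewrite lerDl.
have [c] := @MVT_segment R cos (fun y => - sin y) x (x + d) xd (fun y _ => is_derive_cos y)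
  (continuous_subspaceT (@continuous_cos R)).
by rewrite in_itv /= => h ->; exists c => //; rewrite addrC addKr.
Qed.

Lemma sin_lipschitz x y : `|sin y - sin x| <= `|y - x|.
Proof.
wlog xy : x y / x <= y => [H|].
  by case/orP: (le_total x y) => /H //; rewrite distrC [`|x - y|]distrC.
have [c _] := sin_mvt x (d := y - x) ltac:(lra); rewrite subrKC => ->.
by rewrite normrM -[leRHS]mul1r ler_wpM2r // cos_max.
Qed.

Lemma cos_lipschitz x y : `|cos y - cos x| <= `|y - x|.
Proof.
wlog xy : x y / x <= y => [H|].
  by case/orP: (le_total x y) => /H //; rewrite distrC [`|x - y|]distrC.
have [c _] := cos_mvt x (d := y - x) ltac:(lra); rewrite subrKC => ->.
by rewrite normrM normrN -[leRHS]mul1r ler_wpM2r // sin_max.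
Qed.

Lemma sin_first_order x d : 0 <= d -> `|sin (x + d) - sin x - cos x * d| <= d ^+ 2.
Proof.
move=> d0; have [c hc ->] := sin_mvt x d0.
rewrite -mulrBl normrM (ger0_norm d0) expr2 ler_wpM2r //.
apply: le_trans (cos_lipschitz _ _) _; rewrite ger0_norm; lra.
Qed.

Lemma cos_increment x d : 0 <= d -> `|cos (x + d) - cos x| <= d * (`|sin x| + d).
Proof.
move=> d0; have [c hc ->] := cos_mvt x d0.
rewrite normrM normrN (ger0_norm d0) mulrC ler_wpM2l //.
rewrite -[sin c](subrK (sin x)) addrC; apply: le_trans (ler_normD _ _) _.
rewrite lerD2l; apply: le_trans (sin_lipschitz _ _) _; rewrite ger0_norm; lra.
Qed.

(** 2 - 2 cos x = 4 sin^2 (x / 2), and sin t >= t - t^2. *)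
Lemma cos_lower x : 0 <= x <= 1 -> x ^+ 2 * (1 - x) <= 2 - 2 * cos x.
Proof.
move=> hx; have -> : cos x = cos ((x / 2) *+ 2) by congr cos; field.
rewrite cos_mulr2n cos2sin2.
have := sin_first_order 0 (d := x / 2) ltac:(lra).
rewrite add0r sin0 cos0 ler_norml => /andP[h _].
have h2 : 0 <= x / 2 - (x / 2) ^+ 2 by nra.
have h3 : (x / 2 - (x / 2) ^+ 2) ^+ 2 <= sin (x / 2) ^+ 2 by rewrite lerXn2r ?nnegrE //; lra.
nra.
Qed.

Lemma sin_middle x y : 0 < x <= pi / 2 -> x <= y <= pi - x -> sin x <= sin y.
Proof.
move=> hx hy; have mono := @ltr_sin R.
have key z : x <= z <= pi / 2 -> sin x <= sin z.
  move=> hz; have [->//|xz] := eqVneq x z.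
  apply/ltW; rewrite mono ?in_itv /=; [by rewrite lt_neqAle xz; lra|lra|lra].
have [h|h] := leP y (pi / 2); first by apply: key; lra.
have -> : sin y = sin (pi - y) by rewrite sinB sinpi cospi mul0r sub0r mulN1r opprK.
by apply: key; lra.
Qed.
End Trigonometry.

(** * Testing the weighted cut equations with a sine wave *)

Section LowerBound.
Variables (R : realType) (n : nat) (a : nat -> nat -> bool) (f : nat -> R) (mu : R).
Hypothesis a_sym : forall i j, a i j = a j i.
Hypothesis f_sorted : forall i j, (i <= j < n)%N -> f i <= f j.
Hypothesis f_eigen : forall i, (i < n)%N ->
  \sum_(0 <= j < n) (a i j)%:R * (f i - f j) = mu * f i.
Hypothesis f_sum0 : \sum_(0 <= i < n) f i = 0.
Hypothesis f_neq0 : exists2 i, (i < n)%N & f i != 0.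
Hypothesis mu_gt0 : 0 < mu.
Hypothesis cut_gt0 : forall k, (0 < k < n)%N -> (0 < cut_size n a k)%N.
Variables (W : nat -> nat) (N C : nat).
Hypothesis row : forall j, (0 < j < n)%N -> (N <= row_weight n a W j)%N.
Hypothesis density : forall i M, (\sum_(i <= k < i + M) W k <= 3 * M + C)%N.

Local Notation m := (cut_overlap n a).
Local Notation F := (tail_sum n f).

(** Multiplying the cut equations by W k (phi k + eta) makes the coefficient of each gap at least N
    phi j: rows only involve cuts at distance at most 2, where [phi] is smaller by at most [eta].
    The gaps are nonnegative as [f] is sorted. *)
Lemma weighted_cut_inequality (phi : nat -> R) (eta : R) :
  (forall k, (k <= n)%N -> 0 <= phi k) -> 0 <= eta ->
  (forall j k, (k <= n)%N -> (j <= n)%N -> (k <= j + 2)%N && (j <= k + 2)%N -> phi j <= phi k +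
    eta) ->
  N%:R * \sum_(1 <= j < n) phi j * (f j - f j.-1) <=
  mu * \sum_(1 <= k < n) (W k)%:R * (phi k + eta) * F k.
Proof.
move=> phi0 eta0 near.
have -> : mu * \sum_(1 <= k < n) (W k)%:R * (phi k + eta) * F k =
  \sum_(1 <= j < n) (\sum_(1 <= k < n) (W k)%:R * (m j k)%:R * (phi k + eta)) * (f j - f j.-1).
  transitivity (\sum_(1 <= j < n) \sum_(1 <= k < n)
     (W k)%:R * (phi k + eta) * ((m k j)%:R * (f j - f j.-1))).
    rewrite exchange_big_nat mulr_sumr /=; apply: eq_big_nat => k hk.
    rewrite -mulr_sumr (cut_flow a_sym f_eigen) //; [ring|lia].
  apply: eq_bigr => j _; rewrite mulr_suml; apply: eq_bigr => k _.
  by rewrite (cut_overlapC n a k j); ring.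
rewrite mulr_sumr big_nat [X in _ <= X]big_nat; apply: ler_sum => j hj.
rewrite mulrA; apply: ler_wpM2r; first by rewrite subr_ge0 f_sorted //; lia.
apply: (@le_trans _ _ ((row_weight n a W j)%:R * phi j)).
  by apply: ler_wpM2r; [apply: phi0; lia|rewrite ler_nat row].
rewrite /row_weight natr_sum mulr_suml big_mkcond /=.
rewrite big_nat [X in _ <= X]big_nat; apply: ler_sum => k hk.
have w0 : 0 <= (W k)%:R * (m j k)%:R :> R by rewrite mulr_ge0.
case: ifP => hjk; last by rewrite mulr_ge0 // addr_ge0 // phi0 //; lia.
by rewrite natrM ler_wpM2l // near //; lia.
Qed.

Definition wave k : R := sin (k%:R * (pi / n%:R)).
Local Notation psi := (fun k => wave k * F k).
Local Notation lam := (2 - 2 * cos (pi / n%:R) : R).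

Lemma wave_step k : (0 < k)%N -> 2 * wave k - wave k.+1 - wave k.-1 = lam * wave k.
Proof.
case: k => // k _ /=; rewrite /wave; set t := pi / n%:R.
have -> : k.+2%:R * t = k.+1%:R * t + t by rewrite -[k.+2]addn1 natrD; ring.
have -> : k%:R * t = k.+1%:R * t - t by rewrite -[k.+1]addn1 natrD; ring.
by rewrite sinD sinB; ring.
Qed.

Lemma wave_ge0 k : (k <= n)%N -> 0 <= wave k.
Proof.
move=> kn; apply: sin_ge0_pi; have [n0|n0] := posnP n.
  by rewrite n0 invr0 mulr0 mulr0 lexx pi_ge0.
have n0' : 0 < n%:R :> R by rewrite ltr0n.
rewrite mulr_ge0 ?divr_ge0 ?pi_ge0 //= mulrCA ger_pMr ?pi_gt0 //.
by rewrite ler_pdivrMr // mul1r ler_nat.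
Qed.

Lemma wave_le1 k : wave k <= 1. Proof. exact: sin_le1. Qed.
Lemma wave0 : wave 0 = 0. Proof. by rewrite /wave mul0r sin0. Qed.
Lemma wave_n : (0 < n)%N -> wave n = 0.
Proof. by move=> n0; rewrite /wave mulrC divfK ?sinpi // pnatr_eq0; lia. Qed.

Lemma wave_lipschitz j k : `|wave j - wave k| <= `|j%:R - k%:R| * (pi / n%:R).
Proof.
apply: le_trans (sin_lipschitz _ _) _; rewrite -mulrBl normrM [X in _ * X]ger0_norm //.
by rewrite divr_ge0 ?pi_ge0.
Qed.

Lemma wave_energy : (0 < n)%N ->
  \sum_(1 <= j < n) wave j * (f j - f j.-1) = lam * \sum_(0 <= k < n) psi k.
Proof.
move=> n0; transitivity (\sum_(1 <= k < n) wave k * (2 * F k - F k.+1 - F k.-1)).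
  apply: eq_big_nat => k hk; congr (_ * _).
  have h1 := @tail_sum_step R n f k ltac:(lia).
  have := @tail_sum_step R n f k.-1 ltac:(lia); rewrite prednK; last by lia.
  by lra.
rewrite discrete_green ?tail_sum_n ?tail_sum0 ?wave0 ?wave_n //.
rewrite [in RHS]big_ltn //= wave0 mul0r add0r mulr_sumr.
by apply: eq_big_nat => k hk; rewrite wave_step; [ring|lia].
Qed.

(** The error term in [M] is bounded when n^2 mu is, while the sum of [psi] has order n M. It
    consists of the loss through [eta], at most 2 pi (3 + C) M, and of the loss from treating the
    partial sums of 3 - W as nondecreasing, where [psi] changes by at most M (pi / n + n mu) per
    step. The last term is what is gained if W falls short of 3 on the interval from [p] to [q]. *)
Lemma lower_bound_core (M b : R) (p q : nat) :
  (0 < n)%N -> (forall k, (k <= n)%N -> F k <= M) -> 0 <= b -> (p <= q <= n)%N ->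
  (forall k, (p <= k < q)%N -> b * M <= psi k) ->
  N%:R * (lam * \sum_(0 <= k < n) psi k) <=
  mu * (3 * \sum_(0 <= k < n) psi k
        + M * (C%:R * (pi + n%:R ^+ 2 * mu) + 2 * pi * (3 + C%:R))
        - b * M * (\sum_(p <= k < q) (3 - (W k)%:R) - C%:R)).
Proof.
move=> n0 hM b0 hpq hb.
have n0' : 0 < n%:R :> R by rewrite ltr0n.
have Fge k : (k <= n)%N -> 0 <= F k by exact: tail_sum_ge0.
have M0 : 0 <= M by rewrite -(tail_sum_n n f) hM.
have pin : 0 <= pi / n%:R :> R by rewrite divr_ge0 ?pi_ge0.
set th := pi / n%:R in pin *; pose eta : R := 2 * th.
have eta0 : 0 <= eta by rewrite /eta; lra.
rewrite -wave_energy //.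
apply: le_trans (weighted_cut_inequality (phi := wave) (eta := eta) _ eta0 _) _.
- exact: wave_ge0.
- move=> j k hk hj hjk; rewrite -lerBlDl; apply: le_trans (ler_norm _) _.
  apply: le_trans (wave_lipschitz _ _) _; rewrite /eta ler_wpM2r //.
  by rewrite ler_norml; case/andP: hjk; rewrite -!(ler_nat R) !natrD => h1 h2; apply/andP; split; lra.
apply: ler_wpM2l; first exact: ltW.
have -> : \sum_(1 <= k < n) (W k)%:R * (wave k + eta) * F k =
    \sum_(0 <= k < n) (W k)%:R * (wave k + eta) * F k.
  by rewrite [in RHS]big_ltn //= tail_sum0 // mulr0 add0r.
have -> : \sum_(0 <= k < n) (W k)%:R * (wave k + eta) * F k =
    3 * \sum_(0 <= k < n) psi k - \sum_(0 <= k < n) (3 - (W k)%:R) * psi k +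
    eta * \sum_(0 <= k < n) (W k)%:R * F k.
  rewrite !mulr_sumr -sumrB -big_split; apply: eq_bigr => k _ /=; ring.
have e1 : eta * \sum_(0 <= k < n) (W k)%:R * F k <= M * (2 * pi * (3 + C%:R)).
  have h : \sum_(0 <= k < n) (W k)%:R * F k <= (3 * n%:R + C%:R) * M.
    apply: (@le_trans _ _ (\sum_(0 <= k < n) (W k)%:R * M)).
      rewrite big_nat [X in _ <= X]big_nat; apply: ler_sum => k hk.
      by rewrite ler_wpM2l // hM //; lia.
    rewrite -mulr_suml ler_wpM2r // -natr_sum -natrM -natrD ler_nat.
    by have := density 0 n; rewrite add0n.
  apply: le_trans (ler_wpM2l eta0 h) _; rewrite /eta /th.
  have -> : 2 * (pi / n%:R) * ((3 * n%:R + C%:R) * M) = M * (2 * pi * (3 + C%:R / n%:R)).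
    by field; rewrite lt0r_neq0.
  apply: ler_wpM2l => //; apply: ler_wpM2l; first by rewrite mulr_ge0 ?pi_ge0.
  by rewrite lerD2l ler_piMr // invf_le1 // ler1n.
pose psi' k := psi (minn k n).
have psi'E k : (k <= n)%N -> psi' k = psi k by rewrite /psi' => /minn_idPl ->.
have e2 : b * M * (\sum_(p <= k < q) (3 - (W k)%:R) - C%:R)
    - C%:R * (n%:R * (M * (th + n%:R * mu))) <=
    \sum_(0 <= k < n) (3 - (W k)%:R) * psi k.
  have -> : \sum_(0 <= k < n) (3 - (W k)%:R) * psi k = \sum_(0 <= k < n) (3 - (W k)%:R) * psi' k.
    by apply: eq_big_nat => k hk; rewrite psi'E //; lia.
  apply: almost_nondecreasing_sum => //.
  - move=> i M'; rewrite sumrB sumr_const_nat addKn -natr_sum.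
    by have := density i M'; rewrite -(ler_nat R) natrD natrM -[3 *+ M']mulr_natr; lra.
  - by move=> k; rewrite /psi' mulr_ge0 ?wave_ge0 ?Fge ?geq_minr.
  - by rewrite psi'E // wave_n // mul0r.
  - move=> k hk; rewrite !psi'E //; last exact: ltnW.
    have -> : wave k.+1 * F k.+1 - wave k * F k =
      (wave k.+1 - wave k) * F k.+1 - wave k * f k.
      by rewrite (tail_sum_step f hk); ring.
    apply: le_trans (ler_normB _ _) _; rewrite !normrM mulrDr; apply: lerD.
      rewrite mulrC (ger0_norm (Fge _ hk)).
      apply: ler_pM => //; [exact: Fge|exact: hM|].
      apply: le_trans (wave_lipschitz _ _) _.
      by rewrite -natr1 addrAC subrr add0r normr1 mul1r.
    rewrite (ger0_norm (wave_ge0 (ltnW hk))).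
    have h := eigenvector_bound a_sym f_sorted f_eigen f_sum0 mu_gt0 cut_gt0 hM hk.
    apply: (@le_trans _ _ (1 * (n%:R * (mu * M)))).
      by apply: ler_pM => //; [exact/wave_ge0/ltnW|exact: wave_le1].
    by rewrite mul1r le_eqVlt; apply/orP; left; apply/eqP; ring.
  - exact: mulr_ge0.
  - by move=> k hk; rewrite psi'E; [apply: hb|lia].
have e3 : n%:R * (M * (th + n%:R * mu)) = M * (pi + n%:R ^+ 2 * mu).
  by rewrite /th; field; rewrite lt0r_neq0.
rewrite e3 in e2; lra.
Qed.

End LowerBound.

(** * From bounded errors to asymptotic bounds *)

Record fiedler_ordering (R : realType) n (a : nat -> nat -> bool) (f : nat -> R) (mu : R) : Prop := {
  fo_sym : forall i j, a i j = a j i;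
  fo_sorted : forall i j, (i <= j < n)%N -> f i <= f j;
  fo_eigen : forall i, (i < n)%N -> \sum_(0 <= j < n) (a i j)%:R * (f i - f j) = mu * f i;
  fo_sum0 : \sum_(0 <= i < n) f i = 0;
  fo_neq0 : exists2 i, (i < n)%N & f i != 0;
  fo_gt0 : 0 < mu;
  fo_cut : forall k, (0 < k < n)%N -> (0 < cut_size n a k)%N }.

Record cut_weighting n a (W : nat -> nat) (N C : nat) : Prop := {
  cw_row : forall j, (0 < j < n)%N -> (N <= row_weight n a W j)%N;
  cw_density : forall i M, (\sum_(i <= k < i + M) W k <= 3 * M + C)%N }.

(** Lower bound for the wave times the tail sum, relative to the maximum of the tail sums, at
    positions between d n and (1 - d) n: the sine comes from the wave, d (1 - d) from concavity. *)
Definition middle_factor (R : realType) (d : R) : R := sin (pi * d) * (d * (1 - d)).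
Local Notation beta := middle_factor.

Definition drift_bound (R : realType) (C : nat) (K0 : R) : R :=
  C%:R * (pi + K0) + 2 * pi * (3 + C%:R).

Section Epsilon.
Variables (R : realType) (N C : nat).

Lemma middle_factor_gt0 (d : R) : 0 < d <= 1 / 2 -> 0 < beta d.
Proof.
move=> hd; have p0 := @pi_gt0 R; rewrite /beta mulr_gt0 //; last by rewrite mulr_gt0; lra.
apply: sin_gt0_pi; apply/andP; split; first by rewrite mulr_gt0; lra.
by rewrite -[ltRHS]mulr1 ltr_pM2l; lra.
Qed.

Lemma middle_factor_le1 (d : R) : 0 < d <= 1 / 2 -> beta d <= 1.
Proof.
move=> hd; have s0 : 0 <= sin (pi * d).
  have p0 := @pi_gt0 R; apply: sin_ge0_pi; apply/andP; split.
    by rewrite mulr_ge0; lra.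
  by rewrite -[leRHS]mulr1 ler_pM2l; lra.
have d1 : d * (1 - d) <= 1 by nra.
have d0 : 0 <= d * (1 - d) by nra.
by rewrite /beta -[leRHS]mulr1 ler_pM // sin_le1.
Qed.

Section Fixed.
Variables (n : nat) (a : nat -> nat -> bool) (f : nat -> R) (mu : R) (W : nat -> nat).
Hypothesis fo : fiedler_ordering n a f mu.
Hypothesis cw : cut_weighting n a W N C.
Hypothesis n4 : (4 <= n)%N.
Local Notation F := (tail_sum n f).
Local Notation psi := (fun k => wave R n k * F k).

Let n00 : (0 < n)%N. Proof. by lia. Qed.
Let n0 : 0 < n%:R :> R. Proof. by rewrite ltr0n; lia. Qed.

Let middle_bound M d k : (forall k, (k <= n)%N -> F k <= M) ->
  (exists2 l, (l <= n)%N & F l = M) -> 0 < d <= 1 / 2 -> (k <= n)%N ->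
  d * n%:R <= k%:R <= (1 - d) * n%:R -> beta d * M <= psi k.
Proof.
move=> hM exM hd kn hk; case: fo => s1 s2 s3 s4 s5 s6 s7.
have M0 : 0 <= M by rewrite -(tail_sum_n n f) hM.
have p0 := @pi_gt0 R.
have := tail_sum_lower s2 s4 hM exM kn; rewrite natrB // => h.
have h1 : d * (1 - d) * M <= F k.
  rewrite -(ler_pM2l (exprn_gt0 2 n0)); apply: le_trans h.
  have : 0 <= (k%:R - d * n%:R) * ((1 - d) * n%:R - k%:R) by apply: mulr_ge0; lra.
  by move=> /(mulr_ge0 M0); lra.
rewrite /beta -mulrA; apply: ler_pM => //.
- by apply: sin_ge0_pi; apply/andP; split; [rewrite mulr_ge0|rewrite -[leRHS]mulr1 ler_pM2l]; lra.
- by rewrite mulr_ge0 // mulr_ge0; lra.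
apply: sin_middle.
  apply/andP; split; first by rewrite mulr_gt0; lra.
  by rewrite ler_pM2l //; lra.
have -> : k%:R * (pi / n%:R) = pi * (k%:R / n%:R) :> R by ring.
have -> : pi - pi * d = pi * (1 - d) :> R by ring.
rewrite !ler_pM2l // ler_pdivlMr // ler_pdivrMr //; lra.
Qed.

Let psi_sum M : (forall k, (k <= n)%N -> F k <= M) ->
  (exists2 l, (l <= n)%N & F l = M) ->
  n%:R / 4 * (beta (1 / 4 : R) * M) <= \sum_(0 <= k < n) psi k <= n%:R * M.
Proof.
move=> hM exM; case: (fo) => s1 s2 s3 s4 s5 s6 s7.
have M0 : 0 <= M by rewrite -(tail_sum_n n f) hM.
have psi0 k : (k <= n)%N -> 0 <= psi k.
  by move=> kn; rewrite mulr_ge0 ?wave_ge0 // (tail_sum_ge0 s2).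
apply/andP; split; last first.
  have := @ge_sum_nat_const R M 0 n psi (leq0n n); rewrite subn0; apply => k hk.
  rewrite -[leRHS]mul1r; apply: ler_pM.
  - by apply: wave_ge0; lia.
  - by apply: (tail_sum_ge0 s2) => //; lia.
  - exact: wave_le1.
  - by apply: hM; lia.
set p := (n %/ 4).+1; set q := (n - n %/ 4)%N.
have hpq : (p <= q <= n)%N by rewrite /p /q; lia.
rewrite (@big_cat_nat _ _ _ q 0 n) //=; last by lia.
rewrite (@big_cat_nat _ _ _ p 0 q) //=; last by lia.
have h1 : (q - p)%:R * (beta (1 / 4 : R) * M) <= \sum_(p <= k < q) psi k.
  apply: le_sum_nat_const => [|k hk]; first by lia.
  apply: middle_bound => //; [lra|lia|].
  have : (n <= 4 * k)%N by rewrite /p in hk; lia.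
  have : (4 * k <= 3 * n)%N by rewrite /q in hk; lia.
  by rewrite -!(ler_nat R) !natrM => *; apply/andP; split; lra.
have h2 : 0 <= \sum_(0 <= k < p) psi k by rewrite big_nat sumr_ge0 // => k hk; apply: psi0; lia.
have h3 : 0 <= \sum_(q <= k < n) psi k by rewrite big_nat sumr_ge0 // => k hk; apply: psi0; lia.
have b0 : 0 <= beta (1 / 4 : R) * M by rewrite mulr_ge0 // ltW // middle_factor_gt0 //; lra.
have : (n <= 4 * (q - p))%N by rewrite /p /q; lia.
rewrite -(ler_nat R) natrM => h4.
have h5 : n%:R / 4 * (beta (1 / 4 : R) * M) <= (q - p)%:R * (beta (1 / 4 : R) * M).
  by apply: ler_wpM2r => //; lra.
lra.
Qed.

Local Notation K := (n%:R ^+ 2 * mu).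
Local Notation A := (drift_bound C).

Let lam_lower : pi <= n%:R :> R -> pi ^+ 2 * (1 - pi / n%:R) <= n%:R ^+ 2 * (2 - 2 * cos (pi /
  n%:R)) :> R.
Proof.
move=> hn; have := @cos_lower R (pi / n%:R).
have h01 : 0 <= (pi / n%:R : R) <= 1.
  by rewrite divr_ge0 ?pi_ge0 //= ler_pdivrMr // mul1r.
move=> /(_ h01); rewrite -(ler_pM2l (exprn_gt0 2 n0)).
have -> : n%:R ^+ 2 * ((pi / n%:R) ^+ 2 * (1 - pi / n%:R)) = pi ^+ 2 * (1 - pi / n%:R) :> R.
  by field; rewrite lt0r_neq0.
by [].
Qed.

Lemma eigenvalue_lower_fixed (K0 : R) : K <= K0 -> pi <= n%:R :> R ->
  N%:R * (pi ^+ 2 * (1 - pi / n%:R)) <= K * (3 + 4 * A K0 / (beta (1 / 4 : R) * n%:R)).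
Proof.
move=> hK hn; case: (fo) => s1 s2 s3 s4 s5 s6 s7.
have [l ln [M0 hM]] := tail_sum_max s2 s4 s5; set M := F l in M0 hM.
have exM : exists2 l, (l <= n)%N & F l = M by exists l.
have /andP[S1 S2] := psi_sum hM exM.
have bp : 0 < beta (1 / 4 : R) by apply: middle_factor_gt0; lra.
have S0 : 0 < \sum_(0 <= k < n) psi k.
  by apply: lt_le_trans S1; apply: mulr_gt0; [exact: divr_gt0|exact: mulr_gt0].
have hb : forall k : nat, (0 <= k < 0)%N -> 0 * M <= psi k by [].
have := lower_bound_core s1 s2 s3 s4 s6 s7 (cw_row cw) (cw_density cw)
  (M := M) (b := 0) (p := 0) (q := 0) n00 hM (lexx 0) isT hb.
rewrite !mul0r subr0.
set S := \sum_(0 <= k < n) psi k in S0 S1 S2 *.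
set lam := 2 - _ => h.
have K0' : 0 <= K by rewrite mulr_ge0 ?sqr_ge0 // ltW.
have A0 : 0 <= A K0.
  have h0 := le_trans K0' hK; have p0 := pi_ge0 R; rewrite /drift_bound.
  apply: addr_ge0; first by apply: mulr_ge0 => //; exact: addr_ge0.
  by apply: mulr_ge0; [exact: mulr_ge0|exact: addr_ge0].
have hA : C%:R * (pi + n%:R ^+ 2 * mu) + 2 * pi * (3 + C%:R) <= A K0.
  by rewrite /drift_bound lerD2r ler_wpM2l // lerD2l.
have MS : M <= 4 / (beta (1 / 4 : R) * n%:R) * S.
  rewrite -ler_pdivrMl; last by rewrite divr_gt0 // mulr_gt0.
  by rewrite invf_div; lra.
have h2 : N%:R * lam * S <= mu * (3 + 4 * A K0 / (beta (1 / 4 : R) * n%:R)) * S.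
  rewrite -[leLHS]mulrA; apply: le_trans h _; rewrite -[leRHS]mulrA ler_wpM2l ?(ltW s6) //.
  rewrite [leRHS]mulrDl. rewrite lerD2l; apply: (@le_trans _ _ (M * A K0)).
    by apply: ler_wpM2l => //; exact: ltW.
  apply: le_trans (ler_wpM2r A0 MS) _; rewrite le_eqVlt; apply/orP; left; apply/eqP.
  by field; rewrite !lt0r_neq0.
rewrite ler_pM2r // in h2.
have h3 := ler_wpM2l (ltW (exprn_gt0 2 n0)) h2.
rewrite -[leRHS]mulrA; apply: le_trans h3.
by rewrite [leRHS]mulrCA ler_wpM2l // lam_lower.
Qed.

(** Cutting off both ends of length about d n costs at most 6 d n + 6 of the defect e n, hence at
    most half of it up to a constant. Half of what remains absorbs the bounded errors for large [n],
    and the final quarter is compared with the sum of [psi], which is at most n M. *)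
Lemma eigenvalue_lower_defect (K0 e d : R) : K <= K0 -> pi <= n%:R :> R ->
  0 < e -> 0 < d <= 1 / 4 -> 12 * d <= e ->
  A K0 + beta d * (6 + C%:R) <= beta d * e / 4 * n%:R ->
  e * n%:R <= \sum_(0 <= k < n) (3 - (W k)%:R) ->
  N%:R * (pi ^+ 2 * (1 - pi / n%:R)) <= K * (3 - beta d * e / 4).
Proof.
move=> hK hn e0 hd de hA' defect; case: (fo) => s1 s2 s3 s4 s5 s6 s7.
have [l ln [M0 hM]] := tail_sum_max s2 s4 s5; set M := F l in M0 hM.
have exM : exists2 l, (l <= n)%N & F l = M by exists l.
have /andP[S1 S2] := psi_sum hM exM.
have bp : 0 < beta (1 / 4 : R) by apply: middle_factor_gt0; lra.
have bd : 0 < beta d by apply: middle_factor_gt0; lra.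
have S0 : 0 < \sum_(0 <= k < n) psi k.
  by apply: lt_le_trans S1; apply: mulr_gt0; [exact: divr_gt0|exact: mulr_gt0].
have [p [hp1 hp2]] : exists p : nat, d * n%:R <= p%:R /\ p%:R <= d * n%:R + 1.
  have dn0 : 0 <= d * n%:R by rewrite mulr_ge0 ?ltW //; case/andP: hd.
  have /andP[p1 p2] := Num.Theory.truncn_itv dn0.
  by exists (Num.truncn (d * n%:R)).+1; split; [exact: ltW|rewrite -natr1 lerD2r].
have n4' : 4 <= n%:R :> R by rewrite (ler_nat R 4).
have pp : (p + p <= n)%N.
  have dn : d * n%:R <= 1 / 4 * n%:R by apply: ler_wpM2r => //; case/andP: hd.
  by rewrite -(ler_nat R) natrD; lra.
have hb k : (p <= k < n - p)%N -> beta d * M <= psi k.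
  move=> hk; have hd2 : 0 < d <= 1 / 2 by case/andP: hd => ? ?; apply/andP; split; lra.
  case/andP: hk => pk; rewrite ltn_subRL addnC => /ltnW kp.
  have kn : (k <= n)%N := leq_trans (leq_addr _ _) kp.
  apply: (middle_bound hM exM hd2 kn).
  by move: pk kp; rewrite -!(ler_nat R) natrD => ? ?; apply/andP; split; lra.
have pn : (p <= n)%N := leq_trans (leq_addr _ _) pp.
have hpq : (p <= n - p <= n)%N by rewrite leq_subr leq_subRL // pp.
have := lower_bound_core s1 s2 s3 s4 s6 s7 (cw_row cw) (cw_density cw)
  (M := M) n00 hM (ltW bd) hpq hb.
set S := \sum_(0 <= k < n) psi k in S0 S1 S2 *.
set lam := 2 - _ => h.
have hA : C%:R * (pi + n%:R ^+ 2 * mu) + 2 * pi * (3 + C%:R) <= A K0.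
  by rewrite /drift_bound lerD2r ler_wpM2l // lerD2l.
have hW k : 3 - (W k)%:R <= 3 :> R by rewrite lerBlDr lerDl.
have hx : e / 2 * n%:R - 6 <= \sum_(p <= k < n - p) (3 - (W k)%:R).
  case/andP: hpq => hp3 hp4; have := defect.
  rewrite (@big_cat_nat _ _ _ (n - p) 0 n) //= (@big_cat_nat _ _ _ p 0 (n - p)) //=.
  have := @ge_sum_nat_const R 3 0 p (fun k => 3 - (W k)%:R) (leq0n _) (fun k _ => hW k).
  have := @ge_sum_nat_const R 3 (n - p) n (fun k => 3 - (W k)%:R) (leq_subr _ _) (fun k _ => hW k).
  rewrite subKn //.
  rewrite subn0.
  have : 12 * d * n%:R <= e * n%:R by apply: ler_wpM2r => //; exact: ltW.
  lra.
have h1 : 3 * S + M * (C%:R * (pi + n%:R ^+ 2 * mu) + 2 * pi * (3 + C%:R))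
   - beta d * M * (\sum_(p <= k < n - p) (3 - (W k)%:R) - C%:R) <= (3 - beta d * e / 4) * S.
  have t1 := ler_wpM2l (ltW M0) hA.
  have t2 : beta d * M * (e / 2 * n%:R - 6 - C%:R) <=
     beta d * M * (\sum_(p <= k < n - p) (3 - (W k)%:R) - C%:R).
    by apply: ler_wpM2l; [rewrite mulr_ge0 // ltW|lra].
  have t3 := ler_wpM2l (ltW M0) hA'.
  have t4 : beta d * e / 4 * S <= beta d * e / 4 * (n%:R * M).
    by apply: ler_wpM2l => //; rewrite divr_ge0 // mulr_ge0 // ltW.
  lra.
have h2 : N%:R * lam * S <= mu * (3 - beta d * e / 4) * S.
  rewrite -[leLHS]mulrA; apply: le_trans h _; rewrite -[leRHS]mulrA ler_wpM2l ?(ltW s6) //.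
rewrite ler_pM2r // in h2.
have h3 := ler_wpM2l (ltW (exprn_gt0 2 n0)) h2.
rewrite -[leRHS]mulrA; apply: le_trans h3.
by rewrite [leRHS]mulrCA ler_wpM2l // lam_lower.
Qed.
End Fixed.

Lemma eventually_ge (x : R) : exists n0 : nat, forall n, (n0 <= n)%N -> x <= n%:R.
Proof.
exists (Num.truncn `|x|).+1 => n hn; apply: le_trans (ler_norm x) _.
have /andP[_ /ltW h] := Num.Theory.truncn_itv (normr_ge0 x).
by apply: le_trans h _; rewrite ler_nat.
Qed.

Hypothesis N0 : (0 < N)%N.
Local Notation target := (N%:R / 3 * pi ^+ 2 : R).

Let target_gt0 : 0 < target.
Proof. by rewrite mulr_gt0 ?exprn_gt0 ?pi_gt0 // divr_gt0 // ltr0n. Qed.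

Lemma eigenvalue_lower_bound (e : R) : 0 < e -> exists n0 : nat,
  forall n a f mu W, (n0 <= n)%N -> fiedler_ordering n a f mu -> cut_weighting n a W N C ->
  (1 - e) * target <= n%:R ^+ 2 * mu.
Proof.
move=> e0; have p0 := pi_gt0 R; have t0 := target_gt0.
have b0 : 0 < beta (1 / 4 : R) by apply: middle_factor_gt0; lra.
set A := drift_bound C (3 * target); set B := beta (1 / 4 : R) in b0.
have [n1 hn1] := eventually_ge pi; have [n2 hn2] := eventually_ge (2 * pi / e).
have [n3 hn3] := eventually_ge (8 * A / (3 * B * e)).
exists (maxn (maxn 4 n1) (maxn n2 n3)) => n a f mu W hn fo cw.
move: hn; rewrite !geq_max => /andP[/andP[n4 /hn1 {}hn1] /andP[/hn2 {}hn2 /hn3 {}hn3]].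
have n0 : 0 < n%:R :> R by rewrite ltr0n; exact: leq_trans n4.
(* The error terms are controlled only while n^2 mu is bounded; beyond that the claim is
   immediate. *)
have [hK|/ltW hK] := leP (n%:R ^+ 2 * mu) (3 * target); last first.
  by apply: le_trans hK; apply: ler_wpM2r; [exact: ltW|lra].
have := eigenvalue_lower_fixed fo cw n4 hK hn1; rewrite -/A -/B.
set K := n%:R ^+ 2 * mu => h.
have K0 : 0 <= K by rewrite mulr_ge0 ?sqr_ge0 // ltW // (fo_gt0 fo).
have h1 : 1 - e / 2 <= 1 - pi / n%:R.
  rewrite lerD2l lerN2 ler_pdivrMr //; move: hn2; rewrite ler_pdivrMr //; lra.
have h2 : 4 * A / (B * n%:R) <= 3 * (e / 2).
  have Bn : 0 < B * n%:R by exact: mulr_gt0.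
  have Be : 0 < 3 * B * e by apply: mulr_gt0 => //; exact: mulr_gt0.
  by move: hn3; rewrite !ler_pdivrMr //; lra.
have h3 : 3 * target * (1 - e / 2) <= K * (3 * (1 + e / 2)).
  have e1 : 3 * target * (1 - e / 2) = N%:R * (pi ^+ 2 * (1 - e / 2)) by field.
  have l1 : N%:R * (pi ^+ 2 * (1 - e / 2)) <= N%:R * (pi ^+ 2 * (1 - pi / n%:R)) :> R.
    by apply: ler_wpM2l => //; apply: ler_wpM2l => //; exact: sqr_ge0.
  have l2 : K * (3 + 4 * A / (B * n%:R)) <= K * (3 * (1 + e / 2)).
    by apply: ler_wpM2l => //; lra.
  by rewrite e1; apply: le_trans l1 (le_trans h l2).
have ep : 0 < 3 * (1 + e / 2) by lra.
rewrite -(ler_pM2r ep); apply: le_trans h3.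
have -> : (1 - e) * target * (3 * (1 + e / 2)) = 3 * target * ((1 - e) * (1 + e / 2)) by ring.
by apply: ler_wpM2l; [rewrite mulr_ge0 // ltW|nra].
Qed.

Lemma eigenvalue_near_minimum (e : R) : 0 < e -> exists2 eta : R, 0 < eta & exists n0 : nat,
  forall n a f mu W, (n0 <= n)%N -> fiedler_ordering n a f mu -> cut_weighting n a W N C ->
  n%:R ^+ 2 * mu <= (1 + eta) * target ->
  \sum_(0 <= k < n) (3 - (W k)%:R) <= e * n%:R.
Proof.
move=> e0; have p0 := pi_gt0 R; have t0 := target_gt0.
wlog e1 : e e0 / e <= 1 => [H|].
  have m0 : 0 < Num.min e 1 by rewrite lt_min e0 ltr01.
  have m1 : Num.min e 1 <= 1 by rewrite ge_min lexx orbT.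
  have [eta h0 [n0 h]] := H _ m0 m1; exists eta => //; exists n0 => n a f mu W hn fo cw hK.
  by apply: le_trans (h n a f mu W hn fo cw hK) _; rewrite ler_wpM2r // ge_min lexx.
pose d := e / 12; have hd : 0 < d <= 1 / 4 by rewrite /d; apply/andP; split; lra.
have hd2 : 0 < d <= 1 / 2 by case/andP: hd => ? ?; apply/andP; split; lra.
have b0 := middle_factor_gt0 hd2; have b1 := middle_factor_le1 hd2.
(* Chosen so that 3 - B e / 4 = 3 (1 - g). A defect above e n would then give 1 - g^2 / 2 <= (1 + g)
   (1 - g), a contradiction. *)
set B := beta d in b0 b1; pose g := B * e / 12.
have Be : 0 < B * e by exact: mulr_gt0.
have g0 : 0 < g by exact: divr_gt0.
have g1 : g <= 1 / 12.
  by have Be1 : B * e <= 1 * 1; [apply: ler_pM => //; exact: ltW|rewrite /g; lra].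
exists g => //.
set A := drift_bound C (3 * target).
have [n1 hn1] := eventually_ge pi; have [n2 hn2] := eventually_ge (2 * pi / g ^+ 2).
have [n3 hn3] := eventually_ge ((A + B * (6 + C%:R)) / (B * e / 4)).
exists (maxn (maxn 4 n1) (maxn n2 n3)) => n a f mu W hn fo cw hK.
move: hn; rewrite !geq_max => /andP[/andP[n4 /hn1 {}hn1] /andP[/hn2 {}hn2 /hn3 {}hn3]].
have n0 : 0 < n%:R :> R by rewrite ltr0n; exact: leq_trans n4.
rewrite leNgt; apply/negP => /ltW defect.
have hK3 : n%:R ^+ 2 * mu <= 3 * target.
  by apply: le_trans hK _; apply: ler_wpM2r; [exact: ltW|lra].
have hA : A + B * (6 + C%:R) <= B * e / 4 * n%:R.
  have Be4 : 0 < B * e / 4 by exact: divr_gt0.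
  by move: hn3; rewrite ler_pdivrMr // => h; apply: le_trans h _; rewrite mulrC.
have de : 12 * d <= e by rewrite /d; lra.
have := eigenvalue_lower_defect fo cw n4 hK3 hn1 e0 hd de hA defect.
rewrite -/B; set K := n%:R ^+ 2 * mu in hK *.
have -> : 3 - B * e / 4 = 3 * (1 - g) by rewrite /g; field.
move=> h.
have h1 : 1 - g ^+ 2 / 2 <= 1 - pi / n%:R.
  rewrite lerD2l lerN2 ler_pdivrMr //; move: hn2; rewrite ler_pdivrMr ?exprn_gt0 //; lra.
have e1' : N%:R * (pi ^+ 2 * (1 - pi / n%:R)) = 3 * target * (1 - pi / n%:R) by field;
  rewrite lt0r_neq0.
have h2 : 3 * target * (1 - g ^+ 2 / 2) <= (1 + g) * target * (3 * (1 - g)).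
  apply: (@le_trans _ _ (3 * target * (1 - pi / n%:R))).
    by apply: ler_wpM2l => //; rewrite mulr_ge0 // ltW.
  rewrite -e1'; apply: le_trans h _; apply: ler_wpM2r => //; lra.
have h3 : 0 < target * g ^+ 2 by rewrite mulr_gt0 // exprn_gt0.
lra.
Qed.
End Epsilon.

(** * Distances and the ordering by a Fiedler vector *)

Lemma bigminn_le (I : eqType) (r : seq I) (P : pred I) (F : I -> nat) b i :
  i \in r -> P i -> (\big[minn/b]_(j <- r | P j) F j <= F i)%N.
Proof.
elim: r => // j r IH; rewrite inE big_cons => /orP[/eqP <- ->|ir Pi].
  exact: geq_minl.
by case: ifP => _; [apply: leq_trans (geq_minr _ _) _|]; apply: IH.
Qed.

Section Distance.
Variables (n : nat) (G : sgraph n).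
Hypothesis cG : gconnected G.
Implicit Types x y z : 'I_n.

Lemma walk0 x y : walk G x y 0 = (x == y).
Proof.
apply/existsP/eqP => [[p]|<-]; first by rewrite tuple0 /= => /eqP.
by exists [tuple]; rewrite /= eqxx.
Qed.

Lemma walkS x y k : reflect (exists2 z, walk G x z k & G z y) (walk G x y k.+1).
Proof.
apply: (iffP existsP) => [[p /andP[pp /eqP lp]]|[z /existsP[p /andP[pp /eqP lp]] Gzy]].
  case: p pp lp => p; case: (lastP p) => [|q z] //= sq.
  rewrite rcons_path last_rcons => /andP[pq lq] <-.
  have sq' : size q == k by move: sq; rewrite size_rcons eqSS.
  by exists (last x q) => //; apply/existsP; exists (Tuple sq'); rewrite pq /=.
by exists [tuple of rcons p y]; rewrite rcons_path last_rcons pp lp Gzy /=.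
Qed.

Lemma short_walk x y : exists2 k, (k < n)%N & walk G x y k.
Proof.
have /andP[_ /forallP/(_ x)/forallP/(_ y)/connectP[p pp ->]] := cG.
case/shortenP: pp => q pq uq _; exists (size q).
  have := max_card (mem (x :: q)); rewrite card_ord (card_uniqP uq) /=.
  by [].
by apply/existsP; exists (in_tuple q); rewrite pq /=.
Qed.

Lemma dist_le_walk x y k : walk G x y k -> (dist G x y <= k)%N.
Proof.
have le k' : (k' < n)%N -> walk G x y k' -> (dist G x y <= k')%N.
  by move=> kn w; apply: (@bigminn_le _ _ _ (fun k : 'I_n => nat_of_ord k) n (Ordinal kn)) => //;
    exact: mem_index_enum.
have [kn|nk] := ltnP k n; first exact: le.
by have [k' kn' w'] := short_walk x y; move=> _; apply: leq_trans (le _ kn' w') _; lia.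
Qed.

Lemma dist_walk x y : walk G x y (dist G x y).
Proof.
have : dist G x y = n \/ walk G x y (dist G x y).
  rewrite /dist; apply: (big_ind (fun d => d = n \/ walk G x y d)); [by left| |by move=> i w; right].
    by move=> d1 d2 h1 h2; rewrite /minn; case: ifP => _; [exact: h1|exact: h2].
case=> // dn; have [k kn /dist_le_walk] := short_walk x y; lia.
Qed.

Lemma dist_eq0 x y : dist G x y = 0%N -> x = y.
Proof. by move=> d0; have := dist_walk x y; rewrite d0 walk0 => /eqP. Qed.

Lemma dist_adj x y z : G y z -> (dist G x z <= (dist G x y).+1)%N.
Proof. by move=> Gyz; apply/dist_le_walk/walkS; exists y => //; exact: dist_walk. Qed.

Lemma dist_pred x y k : dist G x y = k.+1 -> exists2 z, dist G x z = k & G z y.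
Proof.
move=> d; have := dist_walk x y; rewrite d => /walkS[z /dist_le_walk hz Gzy].
by exists z => //; have := dist_adj x Gzy; lia.
Qed.

Lemma dist_le_diam x y : (dist G x y <= diam G)%N.
Proof.
rewrite /diam; apply: leq_trans (leq_bigmax (F := fun x => \max_y dist G x y) x).
exact: (leq_bigmax (F := fun y => dist G x y)).
Qed.

Lemma diam_attained : exists x y, dist G x y = diam G.
Proof.
have n0 : (0 < #|'I_n|)%N by rewrite card_ord; case/andP: cG.
rewrite /diam; have [x ->] := @bigop.eq_bigmax _ (fun x => \max_y dist G x y) n0.
by have [y ->] := @bigop.eq_bigmax _ (fun y => dist G x y) n0; exists x, y.
Qed.

Lemma dist_onto x y k : (k <= dist G x y)%N -> exists z, dist G x z = k.
Proof.
move: {2}(dist G x y - k)%N (erefl (dist G x y - k)%N) => m.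
elim: m y => [|m IH] y; first by exists y; lia.
move=> e kd; case D : (dist G x y) => [|d]; first by lia.
by have [z dz _] := dist_pred D; apply: (IH z); lia.
Qed.
End Distance.

(** * Relabelling the vertices along an eigenvector *)

Section SortedGraph.
Variables (R : realType) (n : nat) (G : sgraph n) (f : 'I_n -> R).
Hypothesis cG : gconnected G.
Hypothesis n1 : (1 < n)%N.

Let x0 : 'I_n := Ordinal (ltnW n1).
Let s := sort (fun x y => f x <= f y) (enum 'I_n).
Let v k := nth x0 s k.
Let a i j := [&& (i < n)%N, (j < n)%N & G (v i) (v j)].

Let size_s : size s = n. Proof. by rewrite size_sort size_enum_ord. Qed.
Let mem_s x : x \in s. Proof. by rewrite mem_sort mem_enum. Qed.
Let uniq_s : uniq s. Proof. by rewrite sort_uniq enum_uniq. Qed.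

Let v_index x : v (index x s) = x. Proof. by rewrite /v nth_index. Qed.
Let index_lt x : (index x s < n)%N. Proof. by rewrite -[X in (_ < X)%N]size_s index_mem. Qed.
Let index_v k : (k < n)%N -> index (v k) s = k.
Proof. by move=> kn; rewrite /v index_uniq // size_s. Qed.

Let v_sorted i j : (i <= j < n)%N -> f (v i) <= f (v j).
Proof.
case/andP=> ij jn; have tot : total (fun x y => f x <= f y) by move=> x y; exact: le_total.
have tr : transitive (fun x y => f x <= f y) by move=> y x z; exact: le_trans.
have rf : reflexive (fun x y => f x <= f y) by move=> x; exact: lexx.
apply: (sorted_leq_nth tr rf x0 (sort_sorted tot _)); rewrite ?inE ?size_s //.
exact: leq_ltn_trans jn.
Qed.

Let sum_v (V : nmodType) (h : 'I_n -> V) : \sum_(0 <= k < n) h (v k) = \sum_x h x.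
Proof.
transitivity (\sum_(x <- s) h x); first by rewrite (big_nth x0) size_s.
apply: perm_big.
by rewrite perm_sort /index_enum unlock enumT perm_refl.
Qed.

Let a_sym i j : a i j = a j i.
Proof. by rewrite /a adj_sym andbCA. Qed.

Let a_irr i : a i i = false.
Proof. by rewrite /a adj_irrefl !andbF. Qed.

Let aE i j : (i < n)%N -> (j < n)%N -> a i j = G (v i) (v j).
Proof. by rewrite /a => -> ->. Qed.

Let odegreeE i : (i < n)%N -> odegree n a i = degree G (v i).
Proof.
move=> hi; have := sum_v (fun y => nat_of_bool (G (v i) y)) => h.
rewrite /degree -sum1_card [RHS]big_mkcond /odegree.
transitivity (\sum_(0 <= j < n) nat_of_bool (G (v i) (v j)))%N.
  by apply: eq_big_nat => j hj; rewrite aE //; case/andP: hj.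
rewrite {}h; apply: eq_bigr => y _.
by have -> : (y \in G (v i)) = G (v i) y by []; case: (G _ _).
Qed.

(** If no edge crossed the cut, membership in the initial segment would be constant along edges,
    hence constant on the connected graph. *)
Let cut_gt0 k : (0 < k < n)%N -> (0 < cut_size n a k)%N.
Proof.
move=> hk; apply/edges_gt0P; have kn : (k < n)%N by lia.
have [/existsP[x /existsP[y /and3P[h1 h2 h3]]]|no] :=
  boolP [exists x, exists y, [&& (index x s < k)%N, (k <= index y s)%N & G x y]].
  exists (index x s), (index y s); rewrite h1 h2 index_lt; split => //.
  by rewrite aE ?index_lt // !v_index.
have ncross x y : (index x s < k)%N -> (k <= index y s)%N -> G x y = false.
  move=> hx hy; apply/negbTE; apply: contra no => Gxy.
  by apply/existsP; exists x; apply/existsP; exists y; rewrite hx hy.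
have inv x y : G x y -> (index x s < k)%N = (index y s < k)%N.
  move=> Gxy; case: ltnP => hx; case: ltnP => hy //.
    by rewrite (ncross x y) in Gxy.
  by rewrite adj_sym (ncross y x) in Gxy.
have := connected_const cG inv (v 0%N) (v k).
by rewrite !index_v //; lia.
Qed.

Lemma sorted_fiedler_ordering mu : 0 < mu -> (exists i, f i != 0) -> \sum_i f i = 0 ->
  (forall i, \sum_j (G i j)%:R * (f i - f j) = mu * f i) ->
  fiedler_ordering n a (fun k => f (v k)) mu.
Proof.
move=> mu0 [x fx] sf ef; split => //.
- move=> i hi; rewrite -ef -sum_v; apply: eq_big_nat => j /andP[_ hj].
  by rewrite aE.
- by rewrite sum_v.
- by exists (index x s); rewrite ?v_index.
Qed.

Let pred_step i : (i < n)%N -> (0 < i)%N ->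
  exists2 p, (p < n)%N && a p i & dist G (v 0%N) (v i) = (dist G (v 0%N) (v p)).+1.
Proof.
move=> hi i0; case D : (dist G (v 0%N) (v i)) => [|k].
  have := dist_eq0 cG D => /(congr1 (fun x => index x s)).
  by rewrite !index_v //; lia.
have [z dz Gz] := dist_pred cG D.
by exists (index z s); rewrite ?aE ?index_lt ?v_index ?dz.
Qed.

(** Three times the defect bound plus 15 times the density bound has the form that three times the
    quartic defect bound has directly; 29 and 3000 are the quartic constants. Both classes can then
    be treated alike. *)
Lemma sorted_cubic_weighting : (forall x, (3 <= degree G x)%N) -> exists W,
  cut_weighting n a W 6 29 /\
  (3 * n + 30 * \sum_(0 <= k < n) W k <= 4 * diam G + 90 * n + 3000)%N.
Proof.
move=> deg; have d3 i : (i < n)%N -> (3 <= odegree n a i)%N by move=> hi; rewrite odegreeE.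
exists (cubic_weight n a); split.
  split=> [j hj|i M]; first exact: cubic_row.
  by apply: leq_trans (cubic_density a_sym a_irr d3 i M) _; lia.
have n0 : (0 < n)%N by lia.
have [i hi hd] := cubic_distance a_sym a_irr d3 n0 pred_step.
have := cubic_defect a_sym a_irr d3; have := cubic_density a_sym a_irr d3 0 n.
have := dist_le_diam G (v 0%N) (v i); rewrite add0n.
by lia.
Qed.

Lemma sorted_quartic_weighting : (forall x, degree G x = 4%N) -> exists W,
  cut_weighting n a W 12 29 /\
  (3 * n + 30 * \sum_(0 <= k < n) W k <= 5 * diam G + 90 * n + 3000)%N.
Proof.
move=> deg; have d4 i : (i < n)%N -> odegree n a i = 4%N by move=> hi; rewrite odegreeE.
exists (quartic_weight n a); split.
  split=> [j hj|i M]; first exact: quartic_row.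
  exact: quartic_density.
have n0 : (0 < n)%N by lia.
have [i hi hd] := quartic_distance a_sym a_irr d4 n0 pred_step.
have := quartic_defect a_sym a_irr d4.
have := dist_le_diam G (v 0%N) (v i); lia.
Qed.
End SortedGraph.

(* Up to bounded errors the last condition says that
   diam G >= 3 n / (d + 1) - 30 / (d + 1) * (3 n - \sum_k W k). *)
Definition has_cut_weighting (R : realType) (N d : nat) n (G : sgraph n) : Prop :=
  exists a f W, [/\ fiedler_ordering n a f (algebraic_connectivity R G),
    cut_weighting n a W N 29 &
    (3 * n + 30 * \sum_(0 <= k < n) W k <= d.+1 * diam G + 90 * n + 3000)%N].

Lemma min_degree3_cut_weighting (R : realType) n (G : sgraph n) :
  gconnected G -> (1 < n)%N -> (forall x, (3 <= degree G x)%N) -> has_cut_weighting R 6 3 G.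
Proof.
move=> cG n1 deg; have [f [f0 sf ef]] := fiedler_vector R cG n1.
have [W [h1 h2]] := sorted_cubic_weighting f cG n1 deg.
do 3![eexists]; split; [|exact: h1|exact: h2].
by apply: sorted_fiedler_ordering => //; exact: algebraic_connectivity_gt0.
Qed.

Lemma regular4_cut_weighting (R : realType) n (G : sgraph n) :
  gconnected G -> (1 < n)%N -> (forall x, degree G x = 4%N) -> has_cut_weighting R 12 4 G.
Proof.
move=> cG n1 deg; have [f [f0 sf ef]] := fiedler_vector R cG n1.
have [W [h1 h2]] := sorted_quartic_weighting f cG n1 deg.
do 3![eexists]; split; [|exact: h1|exact: h2].
by apply: sorted_fiedler_ordering => //; exact: algebraic_connectivity_gt0.
Qed.

(** * Cosine test functions on distance layers *)

Lemma pi_lt4 (R : realType) : pi < 4 :> R.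
Proof. by have := @pihalf_lt2 R; lra. Qed.

Lemma cos_double (R : realType) (t : R) : cos (2 * t) = 2 * cos t ^+ 2 - 1.
Proof. by rewrite mulr_natl cos_mulr2n -[cos t ^+ 2 *+ 2]mulr_natl. Qed.

Section Abel.
Variables (R : realFieldType) (z q : nat -> R) (X V : R) (D : nat).
Hypothesis hX : forall i, (i <= D)%N -> `|\sum_(0 <= j < i) z j| <= X.
Hypothesis hV : \sum_(0 <= i < D) `|q i.+1 - q i| <= V.
Hypothesis qD : `|q D| <= 1.

Lemma abel_bound : `|\sum_(0 <= i < D) z i * q i| <= X * (1 + V).
Proof.
pose A i := \sum_(0 <= j < i) z j.
have X0 : 0 <= X by apply: le_trans (hX (leqnn D)).
have A0 : A 0%N = 0 by rewrite /A big_geq.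
have -> : \sum_(0 <= i < D) z i * q i =
    A D * q D - \sum_(0 <= i < D) A i.+1 * (q i.+1 - q i).
  have -> : A D * q D = \sum_(0 <= i < D) (A i.+1 * q i.+1 - A i * q i).
    by rewrite (@telescope_sumr _ 0 D (fun i => A i * q i)) // A0 mul0r subr0.
  rewrite -sumrB; apply: eq_bigr => i _.
  have -> : A i.+1 = A i + z i by rewrite /A big_nat_recr.
  by ring.
apply: le_trans (ler_normB _ _) _; rewrite mulrDr mulr1; apply: lerD.
  by rewrite normrM -[leRHS]mulr1 ler_pM // hX.
apply: le_trans (ler_norm_sum _ _ _) _; apply: le_trans (ler_wpM2l X0 hV).
rewrite mulr_sumr big_nat [leRHS]big_nat; apply: ler_sum => i hi.
by rewrite normrM ler_wpM2r // hX; case/andP: hi.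
Qed.
End Abel.

(** Up to two leftover terms the partial sum splits into disjoint triples; admitting all windows on
    the right only enlarges the bound. *)
Lemma window_partial_sum (R : realFieldType) (z : nat -> R) (Z : R) (D : nat) :
  0 <= Z -> (forall j, (j < D)%N -> `|z j| <= Z) ->
  forall i, (i <= D)%N -> `|\sum_(0 <= j < i) z j| <=
    2 * Z + \sum_(0 <= j < i.+1 - 3) `|z j + z j.+1 + z j.+2|.
Proof.
move=> Z0 hZ; elim/ltn_ind => -[|[|[|i]]] IH hi.
- by rewrite !big_geq // normr0 addr0 mulr_ge0.
- by rewrite big_nat1 big_geq // addr0; have := hZ 0%N hi; lra.
- rewrite !big_nat_recr //= !big_geq // addr0 add0r.
  have h0 := hZ 0%N (ltnW hi); have h1 := hZ 1%N hi.
  apply: le_trans (ler_normD _ _) _; lra.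
have -> : \sum_(0 <= j < i.+3) z j = \sum_(0 <= j < i) z j + (z i + z i.+1 + z i.+2).
  by rewrite !big_nat_recr //= !addrA.
have -> : (i.+4 - 3 = i.+1)%N by rewrite subSS subn2.
have hi' : (i <= D)%N by do 3 apply: ltnW.
have {}IH := IH i (leqW (leqW (leqnn _))) hi'.
apply: le_trans (ler_normD _ _) _; rewrite [X in _ <= _ + X]big_nat_recr //= addrA lerD2r.
apply: le_trans IH _; rewrite lerD2l.
rewrite (@big_cat_nat _ _ _ (i.+1 - 3) 0 i) //= ?lerDl ?sumr_ge0 //.
by rewrite subSS subn2; case: i {hi hi'} => [|[|]] //= i; exact: leqW.
Qed.

(** * Layer sizes as a sequence, its phase and the cosine sums *)

Section LayerSequence.
Variables (R : realType) (dg tau D n : nat) (L : nat -> nat).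
Hypothesis dg4 : (dg <= 4)%N.
Hypothesis tau4 : (0 < tau <= 4)%N.
Hypothesis D3 : (3 <= D)%N.
Hypothesis L_pos : forall i, (i <= D)%N -> (0 < L i)%N.
Hypothesis L_sum : (\sum_(0 <= i < D.+1) L i = n)%N.

Local Notation T j := (L j + L j.+1 + L j.+2)%N.
(** Resistance between two layers if all edges between them were present, each of unit
    resistance. *)
Definition layer_resistance i : R := ((L i * L i.+1)%:R)^-1.
Local Notation r := layer_resistance.

Hypothesis window_ge : forall j, (j < D)%N -> (dg.+1 <= T j)%N.
Hypothesis window_tight : forall j, (j + 3 <= D)%N -> T j = dg.+1 -> T j.+1 = dg.+1 ->
  (T j)%:R = tau%:R * (r j + r j.+1 + r j.+2).

(** Measures how far the layers are from the extremal pattern. As each layer lies in at most three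
    windows, it is at most 3 n - (dg + 1) (D - 1), so it is o(n) when the diameter is asymptotically
    maximal. *)
Definition layer_excess : nat := \sum_(0 <= j < D.-1) (T j - dg.+1).
Local Notation Y := layer_excess.
Local Notation X := (40 * (Y%:R + 1) : R).

Lemma layer_excess_le : (Y + dg.+1 * D.-1 <= 3 * n)%N.
Proof.
have sh i : (i <= 2)%N -> (\sum_(0 <= j < D.-1) L (j + i) <= n)%N.
  move=> hi; rewrite -L_sum; have -> : (\sum_(0 <= j < D.-1) L (j + i) = \sum_(i <= j < D.-1 + i)
    L j)%N.
    by rewrite -{2}(add0n i) big_addn addnK.
  rewrite (@big_cat_nat _ _ _ i 0 D.+1) //=; last by lia.
  rewrite (@big_cat_nat _ _ _ (D.-1 + i) i D.+1) //=; lia.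
have e : (\sum_(0 <= j < D.-1) T j = \sum_(0 <= j < D.-1) (T j - dg.+1) + dg.+1 * D.-1)%N.
  rewrite -[(dg.+1 * _)%N]mulnC -[X in (X * dg.+1)%N]subn0 -sum_nat_const_nat -big_split /=.
  by apply: eq_big_nat => j hj; rewrite subnK // window_ge //; lia.
rewrite /layer_excess -e !big_split /=.
have := sh 0%N isT; have := sh 1%N isT; have := sh 2%N isT.
under eq_bigr do rewrite addn2; under [X in _ -> (X <= _)%N -> _]eq_bigr do rewrite addn1.
under [X in _ -> _ -> (X <= _)%N -> _]eq_bigr do rewrite addn0.
by lia.
Qed.

Let window_le j : (j < D.-1)%N -> (T j <= Y + dg.+1)%N.
Proof.
move=> hj; have : (T j - dg.+1 <= Y)%N.
  by rewrite /layer_excess (bigD1_seq j) ?mem_index_iota ?iota_uniq //= leq_addr.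
lia.
Qed.

Let layer_le j : (j <= D)%N -> (L j <= Y + dg.+1)%N.
Proof.
move=> hj; have [h|h] := ltnP j D.-1; first by have := window_le h; lia.
have h2 : (D - 2 < D.-1)%N by lia.
have := window_le h2; have : j = (D - 2).+1 \/ j = (D - 2).+2 by lia.
by case=> ->; lia.
Qed.

Let r_gt0 i : (i < D)%N -> 0 < r i.
Proof. by move=> hi; rewrite invr_gt0 ltr0n muln_gt0 !L_pos // ltnW. Qed.

Let r_le1 i : r i <= 1.
Proof.
rewrite /r; case: (L i * L i.+1)%N => [|k]; first by rewrite invr0.
by rewrite invf_le1 ?ltr0n // ler1n.
Qed.

Let r_ge0 i : 0 <= r i. Proof. by rewrite invr_ge0. Qed.

Local Notation z := (fun j => (L j)%:R - tau%:R * r j).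

(** A triple sum of [z] vanishes if its window and the next are tight; otherwise their excess is at
    least 1 and 18 times it bounds the triple sum. Summation counts every excess at most twice, and
    single terms are at most Y + 9, so the total is at most 2 (Y + 9) + 36 Y <= 40 (Y + 1). *)
Lemma layer_balance i : (i <= D)%N -> `|\sum_(0 <= j < i) z j| <= X.
Proof.
move=> hi; have Y0 : 0 <= Y%:R :> R by [].
have t4 : tau%:R <= 4 :> R by rewrite (ler_nat R _ 4); case/andP: tau4.
have d4 : dg.+1%:R <= 5 :> R by rewrite (ler_nat R _ 5).
have tr j : 0 <= tau%:R * r j <= 4.
  by rewrite mulr_ge0 //= -[leRHS]mulr1 ler_pM.
have hZ j : (j < D)%N -> `|z j| <= Y%:R + 9.
  move=> /ltnW/layer_le; rewrite -(ler_nat R) natrD => h; have := tr j => /andP[h1 h2].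
  have h3 : 0 <= (L j)%:R :> R by [].
  by rewrite ler_norml; apply/andP; split; lra.
have Z0 : 0 <= Y%:R + 9 :> R by lra.
apply: le_trans (window_partial_sum Z0 hZ hi) _.
pose t j := (T j - dg.+1)%N.
have hG j : (j < D - 2)%N -> `|z j + z j.+1 + z j.+2| <= 18 * (t j + t j.+1)%:R.
  move=> hj; have e : z j + z j.+1 + z j.+2 = (T j)%:R - tau%:R * (r j + r j.+1 + r j.+2).
    by rewrite !natrD; ring.
  have w1 : (dg.+1 <= T j)%N by apply: window_ge; lia.
  have w2 : (dg.+1 <= T j.+1)%N by apply: window_ge; lia.
  have [t0|t1] := posnP (t j + t j.+1)%N.
    have -> : z j + z j.+1 + z j.+2 = 0; last by rewrite normr0 mulr_ge0.
    rewrite e window_tight ?subrr //; first by lia.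
      by rewrite /t in t0; lia.
    by rewrite /t in t0; lia.
  have Tt : (T j)%:R = (t j)%:R + dg.+1%:R :> R by rewrite -natrD /t subnK.
  have one : 1 <= (t j + t j.+1)%:R :> R by rewrite (ler_nat R 1).
  have tt : (t j)%:R <= (t j + t j.+1)%:R :> R by rewrite ler_nat leq_addr.
  have T0 : 0 <= (t j)%:R :> R by [].
  have /andP[a1 b1] := tr j; have /andP[a2 b2] := tr j.+1; have /andP[a3 b3] := tr j.+2.
  have dg0 : 0 <= dg.+1%:R :> R by [].
  by rewrite e Tt ler_norml; apply/andP; split; lra.
have hS : \sum_(0 <= j < i.+1 - 3) `|z j + z j.+1 + z j.+2| <= 36 * Y%:R.
  apply: (@le_trans _ _ (\sum_(0 <= j < D - 2) 18 * (t j + t j.+1)%:R)).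
    have le : (i.+1 - 3 <= D - 2)%N by lia.
    rewrite [leRHS](@big_cat_nat _ _ _ (i.+1 - 3) 0 (D - 2)) //=.
    rewrite -[leLHS]addr0; apply: lerD; last by apply: sumr_ge0 => j _; rewrite mulr_ge0.
    by rewrite big_nat [leRHS]big_nat; apply: ler_sum => j hj; apply: hG; lia.
  rewrite -mulr_sumr -natr_sum.
  have : (\sum_(0 <= j < D - 2) (t j + t j.+1) <= 2 * Y)%N.
    rewrite big_split /= mul2n -addnn; apply: leq_add.
      rewrite /layer_excess (@big_cat_nat _ _ _ (D - 2) 0 D.-1) ?leq_addr //; lia.
    rewrite /layer_excess (@big_cat_nat _ _ _ 1 0 D.-1) //=; last by lia.
    have -> : (\sum_(0 <= j < D - 2) t j.+1 = \sum_(1 <= j < D.-1) t j)%N.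
      transitivity (\sum_(0 + 1 <= j < D.-1) t j)%N; last by [].
      rewrite big_addn; have -> : (D.-1 - 1 = D - 2)%N by lia.
      by apply: eq_bigr => j _; rewrite addn1.
    exact: leq_addl.
  rewrite -(ler_nat R) natrM; lra.
lra.
Qed.

Definition total_resistance : R := \sum_(0 <= i < D) r i.
Local Notation rho := total_resistance.
Definition phase_step i : R := pi * r i / rho.
Local Notation delta := phase_step.
Definition phase i : R := \sum_(0 <= j < i) delta j.
Local Notation theta := phase.

Lemma total_resistance_gt0 : 0 < rho.
Proof.
rewrite /rho big_ltn; last by lia.
by apply: ltr_wpDr; [apply: sumr_ge0|apply: r_gt0; lia].
Qed.
Let rho0 := total_resistance_gt0.

Let delta_ge0 i : 0 <= delta i.
Proof. by apply: divr_ge0; [rewrite mulr_ge0 ?pi_ge0|exact: ltW]. Qed.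

Let delta_le i : delta i <= pi / rho.
Proof.
rewrite /delta ler_pM2r ?invr_gt0 // -[leRHS]mulr1.
by rewrite ler_wpM2l ?pi_ge0.
Qed.

Let theta_step i : theta i.+1 = theta i + delta i.
Proof. by rewrite /theta big_nat_recr. Qed.

Let theta0 : theta 0 = 0. Proof. by rewrite /theta big_geq. Qed.

Let theta_D : theta D = pi.
Proof.
rewrite /theta /phase_step -mulr_suml -mulr_sumr -/rho mulfK //.
exact: lt0r_neq0.
Qed.

Let delta_sq : \sum_(0 <= i < D) delta i ^+ 2 <= pi ^+ 2 / rho.
Proof.
have -> : pi ^+ 2 / rho = \sum_(0 <= i < D) pi / rho * delta i :> R.
  by rewrite -mulr_sumr -/(theta D) theta_D; field; exact: lt0r_neq0.
by apply: ler_sum => i _; rewrite expr2 ler_wpM2r.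
Qed.

(** A Riemann sum for the integral of the cosine from 0 to pi, which is 0; each step errs by at most
    the square of its length. *)
Let sum_delta_cos : `|\sum_(0 <= i < D) delta i * cos (theta i)| <= pi ^+ 2 / rho.
Proof.
have e : \sum_(0 <= i < D) (sin (theta i.+1) - sin (theta i)) = 0.
  by rewrite (@telescope_sumr _ 0 D (fun i => sin (theta i))) // theta_D theta0 sinpi sin0 subrr.
rewrite -normrN -[X in `|X|]add0r -{1}e -sumrB; apply: le_trans delta_sq.
apply: le_trans (ler_norm_sum _ _ _) _; apply: ler_sum => i _.
by rewrite theta_step [delta i * _]mulrC sin_first_order.
Qed.

Let sum_delta_cos2 : `|\sum_(0 <= i < D) delta i * cos (2 * theta i)| <= 2 * (pi ^+ 2 / rho).
Proof.
have e : \sum_(0 <= i < D) (sin (2 * theta i.+1) - sin (2 * theta i)) = 0.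
  rewrite (@telescope_sumr _ 0 D (fun i => sin (2 * theta i))) // theta_D theta0 mulr0 sin0.
  by rewrite mulr_natl sin2pi subrr.
have h : `|2 * \sum_(0 <= i < D) delta i * cos (2 * theta i)| <= 4 * (pi ^+ 2 / rho).
  rewrite -normrN -[X in `|X|]add0r -{1}e mulr_sumr -sumrB.
  apply: le_trans (_ : \sum_(0 <= i < D) 4 * delta i ^+ 2 <= _); last first.
    by rewrite -mulr_sumr ler_wpM2l.
  apply: le_trans (ler_norm_sum _ _ _) _; apply: ler_sum => i _.
  have := @sin_first_order R (2 * theta i) (2 * delta i) ltac:(by rewrite mulr_ge0).
  rewrite theta_step mulrDr exprMn; have -> : 2 ^+ 2 = 4 :> R by rewrite expr2 -natrM.
  by have -> : 2 * (delta i * cos (2 * theta i)) = cos (2 * theta i) * (2 * delta i) by ring.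
by move: h; rewrite normrM ger0_norm //; lra.
Qed.

(** Replaces layer sizes by phase steps: the sum against [z] is small by summation by parts and
    [layer_balance], and the last sum is a Riemann sum in the phase. *)
Let layer_sum (q : nat -> R) : \sum_(0 <= i < D.+1) (L i)%:R * q i =
  (L D)%:R * q D + \sum_(0 <= i < D) z i * q i
  + tau%:R * rho / pi * \sum_(0 <= i < D) delta i * q i.
Proof.
rewrite big_nat_recr //= addrC -addrA; congr (_ + _).
rewrite mulr_sumr -big_split /=; apply: eq_bigr => i _.
have -> : tau%:R * rho / pi * (delta i * q i) = tau%:R * r i * q i.
  rewrite /phase_step; move: (pi : R) (pi_gt0 R) rho0; move: rho (r i) => Q ri P P0 Q0.
  by field; rewrite !lt0r_neq0.
by ring.
Qed.

Let X_ge40 : 40 <= X.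
Proof. by have : 0 <= Y%:R :> R by []; lra. Qed.

Let sum_abs_delta c (q : nat -> R) : 0 <= c -> (forall i, `|q i.+1 - q i| <= c * delta i) ->
  \sum_(0 <= i < D) `|q i.+1 - q i| <= c * pi.
Proof.
move=> c0 h; rewrite -theta_D /theta mulr_sumr; apply: ler_sum => i _; exact: h.
Qed.

Let LD_le : (L D)%:R <= X.
Proof.
have := layer_le (leqnn D); rewrite -(ler_nat R) natrD => h.
have d5 : dg.+1%:R <= 5 :> R by rewrite (ler_nat R _ 5).
have : 0 <= Y%:R :> R by []; lra.
Qed.

Let tau_pi : tau%:R * pi <= 16 :> R.
Proof.
have t4 : tau%:R <= 4 :> R by rewrite (ler_nat R _ 4); case/andP: tau4.
have p4 := pi_lt4 R; have -> : 16 = 4 * 4 :> R by rewrite -natrM.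
by apply: ler_pM => //; [exact: pi_ge0|exact: ltW].
Qed.

Lemma layer_cos_sum : `|\sum_(0 <= i < D.+1) (L i)%:R * cos (theta i)| <= 11 * X.
Proof.
have p4 := pi_lt4 R; have p0 := pi_gt0 R; have X0 : 0 <= X by have := X_ge40; lra.
have hV : \sum_(0 <= i < D) `|cos (theta i.+1) - cos (theta i)| <= 1 * pi.
  apply: (sum_abs_delta (q := fun i => cos (theta i))) => // i.
  apply: le_trans (cos_lipschitz _ _) _.
  by rewrite theta_step addrC addKr ger0_norm // mul1r.
have h1 := abel_bound layer_balance hV (cos_max _).
have h2 : `|tau%:R * rho / pi * \sum_(0 <= i < D) delta i * cos (theta i)| <= 16.
  rewrite normrM ger0_norm; last by rewrite divr_ge0 ?mulr_ge0 // ltW.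
  apply: le_trans (ler_wpM2l _ sum_delta_cos) _.
    by rewrite divr_ge0 ?mulr_ge0 // ltW.
  apply: le_trans tau_pi; rewrite le_eqVlt; apply/orP; left; apply/eqP.
  move: (pi : R) p0 rho0; move: rho => Q P P0 Q0.
  by field; rewrite !lt0r_neq0.
have h3 : `|(L D)%:R * cos (theta D)| <= X.
  by rewrite normrM ger0_norm // -[leRHS]mulr1 ler_pM // cos_max.
rewrite layer_sum; apply: le_trans (ler_normD _ _) _.
have h4 := le_trans (ler_normD _ _) (lerD h3 h1).
have h5 : X * (1 + 1 * pi) <= X * 5 by apply: ler_wpM2l => //; lra.
have := X_ge40; lra.
Qed.

Lemma layer_cos2_sum : `|\sum_(0 <= i < D.+1) (L i)%:R * cos (2 * theta i)| <= 11 * X.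
Proof.
have p4 := pi_lt4 R; have p0 := pi_gt0 R; have X0 : 0 <= X by have := X_ge40; lra.
have hV : \sum_(0 <= i < D) `|cos (2 * theta i.+1) - cos (2 * theta i)| <= 2 * pi.
  apply: (sum_abs_delta (q := fun i => cos (2 * theta i))) => // i.
  apply: le_trans (cos_lipschitz _ _) _.
  by rewrite theta_step -mulrBr addrC addKr ger0_norm // mulr_ge0.
have h1 := abel_bound layer_balance hV (cos_max _).
have h2 : `|tau%:R * rho / pi * \sum_(0 <= i < D) delta i * cos (2 * theta i)| <= 32.
  rewrite normrM ger0_norm; last by rewrite divr_ge0 ?mulr_ge0 // ltW.
  apply: le_trans (ler_wpM2l _ sum_delta_cos2) _.
    by rewrite divr_ge0 ?mulr_ge0 // ltW.
  have -> : tau%:R * rho / pi * (2 * (pi ^+ 2 / rho)) = 2 * (tau%:R * pi) :> R.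
    move: (pi : R) p0 rho0; move: rho => Q P P0 Q0.
    by field; rewrite !lt0r_neq0.
  by have := tau_pi; lra.
have h3 : `|(L D)%:R * cos (2 * theta D)| <= X.
  by rewrite normrM ger0_norm // -[leRHS]mulr1 ler_pM // cos_max.
rewrite layer_sum; apply: le_trans (ler_normD _ _) _.
have h4 := le_trans (ler_normD _ _) (lerD h3 h1).
have h5 : X * (1 + 2 * pi) <= X * 9 by apply: ler_wpM2l => //; lra.
have := X_ge40; lra.
Qed.

Lemma resistance_balance : `|n%:R - tau%:R * rho| <= 2 * X.
Proof.
have -> : n%:R - tau%:R * rho = (L D)%:R + \sum_(0 <= j < D) z j.
  rewrite -L_sum natr_sum big_nat_recr //= sumrB mulr_sumr; ring.
apply: le_trans (ler_normD _ _) _; have -> : 2 * X = X + X by ring.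
by apply: lerD; [rewrite ger0_norm // LD_le|exact: layer_balance].
Qed.

Lemma layer_square_sum : n%:R / 2 - 6 * X <= \sum_(0 <= i < D.+1) (L i)%:R * cos (theta i) ^+ 2.
Proof.
have -> : \sum_(0 <= i < D.+1) (L i)%:R * cos (theta i) ^+ 2 =
    n%:R / 2 + (\sum_(0 <= i < D.+1) (L i)%:R * cos (2 * theta i)) / 2.
  rewrite -L_sum natr_sum !mulr_suml -big_split /=; apply: eq_bigr => i _.
  by rewrite cos_double; field.
have := layer_cos2_sum; rewrite ler_norml => /andP[h _].
by have := X_ge40; lra.
Qed.

(** As the phase steps are pi r_i / rho, a squared increment divided by r_i is about pi / rho times
    the step times sin^2. These terms form a Riemann sum for the integral of sin^2 from 0 to pi,
    which is pi / 2. The hypothesis keeps the steps at most 1, so the higher order terms are at most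
    three times the squared step. *)
Lemma layer_energy : pi <= rho ->
  \sum_(0 <= i < D) (L i * L i.+1)%:R * (cos (theta i.+1) - cos (theta i)) ^+ 2 <=
  pi ^+ 2 / (2 * rho) * (1 + 8 * pi / rho).
Proof.
move=> hrho; have p0 := pi_gt0 R.
have term i : (i < D)%N -> (L i * L i.+1)%:R * (cos (theta i.+1) - cos (theta i)) ^+ 2 <=
    pi / rho * (delta i / 2 - delta i * cos (2 * theta i) / 2 + 3 * delta i ^+ 2).
  move=> hi; have d0 := delta_ge0 i; have d1 : delta i <= 1.
    by apply: le_trans (delta_le i) _; rewrite ler_pdivrMr // mul1r.
  have ri := r_gt0 hi.
  have inc : (cos (theta i.+1) - cos (theta i)) ^+ 2 <= (delta i * (`|sin (theta i)| + delta i)) ^+ 2.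
    have b0 : 0 <= delta i * (`|sin (theta i)| + delta i) by rewrite mulr_ge0 ?addr_ge0.
    rewrite -[leLHS]real_normK ?num_real // theta_step.
    by apply: lerXn2r (cos_increment _ d0); rewrite nnegrE.
  apply: (@le_trans _ _ ((r i)^-1 * (delta i * (`|sin (theta i)| + delta i)) ^+ 2)).
    rewrite /layer_resistance invrK; apply: ler_wpM2l; [exact: ler0n|exact: inc].
  have -> : (r i)^-1 * (delta i * (`|sin (theta i)| + delta i)) ^+ 2 =
      pi / rho * (delta i * (`|sin (theta i)| + delta i) ^+ 2).
    have -> : pi / rho = delta i / r i.
      rewrite /phase_step; move: (pi : R) rho0 ri; move: rho (r i) => Q ri' P Q0 ri0.
      by field; rewrite !lt0r_neq0.
    by move: (r i) ri => ri' ri0; field; exact: lt0r_neq0.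
  apply: ler_wpM2l; first by rewrite divr_ge0 // ltW.
  have -> : cos (2 * theta i) = 1 - 2 * `|sin (theta i)| ^+ 2.
    by rewrite cos_double cos2sin2 real_normK ?num_real //; ring.
  have s1 : 0 <= `|sin (theta i)| <= 1 by rewrite normr_ge0 sin_max.
  set sg := `|sin _| in s1 *; set de := delta i in d0 d1 *.
  have -> : de / 2 - de * (1 - 2 * sg ^+ 2) / 2 + 3 * de ^+ 2 =
     de * (sg + de) ^+ 2 + de ^+ 2 * (3 - 2 * sg - de) by field.
  by rewrite lerDl mulr_ge0 ?sqr_ge0 //; lra.
apply: (@le_trans _ _ (\sum_(0 <= i < D) pi / rho *
   (delta i / 2 - delta i * cos (2 * theta i) / 2 + 3 * delta i ^+ 2))).
  by rewrite big_nat [leRHS]big_nat; apply: ler_sum => i /andP[_]; exact: term.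
have -> : \sum_(0 <= i < D) pi / rho *
     (delta i / 2 - delta i * cos (2 * theta i) / 2 + 3 * delta i ^+ 2) =
   pi / rho * (theta D / 2 - (\sum_(0 <= i < D) delta i * cos (2 * theta i)) / 2
     + 3 * \sum_(0 <= i < D) delta i ^+ 2).
  rewrite -mulr_sumr; congr (_ * _).
  by rewrite {2}/phase !mulr_suml mulr_sumr -sumrB -big_split.
rewrite theta_D.
have -> : pi ^+ 2 / (2 * rho) * (1 + 8 * pi / rho) = pi / rho * (pi / 2 + 4 * (pi ^+ 2 / rho)) :> R.
  move: (pi : R) rho0; move: rho => Q P Q0.
  by field; rewrite !lt0r_neq0.
apply: ler_wpM2l; first by rewrite divr_ge0 // ltW.
have := sum_delta_cos2; rewrite ler_norml => /andP[h _].
have := delta_sq; lra.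
Qed.
End LayerSequence.

(** * Distance layers of a graph *)

Lemma symmetric_sum_even n (F : 'I_n -> 'I_n -> nat) :
  (forall x y, F x y = F y x) -> (forall x, F x x = 0%N) ->
  ~~ odd (\sum_x \sum_y F x y)%N.
Proof.
move=> sF dF.
have -> : (\sum_x \sum_y F x y = \sum_(x < n) \sum_(y < n) (x < y) * F x y + \sum_(x < n) \sum_(y
  < n) (y < x) * F x y)%N.
  rewrite -big_split; apply: eq_bigr => x _; rewrite -big_split; apply: eq_bigr => y _ /=.
  by case: (ltngtP x y) => [|| /val_inj ->]; rewrite ?dF ?mul0n ?mul1n ?addn0 ?add0n.
have -> : (\sum_(x < n) \sum_(y < n) (y < x) * F x y = \sum_(x < n) \sum_(y < n) (x < y) * F x y)%N.
  by rewrite exchange_big; do 2![apply: eq_bigr => ? _]; rewrite sF.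
by rewrite addnn odd_double.
Qed.

Section Layers.
Variables (n : nat) (G : sgraph n) (x : 'I_n).
Hypothesis cG : gconnected G.
Local Notation d := (dist G x).

Definition layer_size i : nat := \sum_w (d w == i).
Local Notation L := layer_size.

Let d_adj w z : G w z -> [/\ (d z <= (d w).+1)%N & (d w <= (d z).+1)%N].
Proof. by move=> Gwz; split; apply: dist_adj => //; rewrite adj_sym. Qed.

Lemma layer_size_gt0 z i : (i <= d z)%N -> (0 < L i)%N.
Proof.
move=> /(dist_onto cG)[w dw]; rewrite /L (bigD1 w) //= dw eqxx; lia.
Qed.

Lemma layer_size_sum D : (forall z, (d z <= D)%N) -> (\sum_(0 <= i < D.+1) L i = n)%N.
Proof.
move=> hD; rewrite /L exchange_big /=.
rewrite (eq_bigr (fun=> 1%N)) => [|w _].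
  by rewrite sum_nat_const card_ord muln1.
rewrite (bigD1_seq (d w)) ?mem_index_iota ?iota_uniq //= ?ltnS // eqxx big1 // => i /negPf.
by rewrite eq_sym => ->.
Qed.

Lemma layer_window_ge j z : d z = j.+1 -> ((degree G z).+1 <= L j + L j.+1 + L j.+2)%N.
Proof.
move=> dz; have -> : ((degree G z).+1 = \sum_w (G z w + (w == z)))%N.
  rewrite big_split /= -degree_sum (bigD1 z) //= eqxx big1 ?addn0 ?addn1 //.
  by move=> w /negPf ->.
rewrite /L -!big_split /=; apply: leq_sum => w _.
have [->|wz] := eqVneq w z; first by rewrite adj_irrefl dz; lia.
case Gzw : (G z w) => //=; have [h1 h2] := d_adj Gzw; rewrite dz in h1 h2; lia.
Qed.

(** Edges inside a layer contribute 0, and all others join consecutive layers, between which there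
    are at most [L i * L i.+1] edges; the factor 2 is due to ordered pairs. *)
Lemma layer_energy_le (R : realType) (h : nat -> R) D : (forall z, (d z <= D)%N) ->
  energy G (fun z => h (d z)) <=
  2 * \sum_(0 <= i < D) (L i * L i.+1)%:R * (h i.+1 - h i) ^+ 2.
Proof.
move=> hD.
have e i : (L i * L i.+1)%:R *+ 2 =
    \sum_z \sum_w ((d z == i) && (d w == i.+1) + (d z == i.+1) && (d w == i))%N%:R :> R.
  have -> : \sum_z \sum_w ((d z == i) && (d w == i.+1) + (d z == i.+1) && (d w == i))%N%:R =
      (\sum_z \sum_w ((d z == i) * (d w == i.+1)) + \sum_z \sum_w ((d z == i.+1) * (d w ==
        i)))%N%:R :> R.
    rewrite -big_split /= natr_sum; apply: eq_bigr => z _.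
    rewrite -big_split /= natr_sum; apply: eq_bigr => w _.
    by rewrite !mulnb.
  have p i' j' : (\sum_z \sum_w ((d z == i') * (d w == j')) = L i' * L j')%N.
    by rewrite /L big_distrl /=; apply: eq_bigr => z _; rewrite big_distrr.
  by rewrite !p natrD mulnC mulr2n.
have -> : 2 * \sum_(0 <= i < D) (L i * L i.+1)%:R * (h i.+1 - h i) ^+ 2 =
  \sum_z \sum_w \sum_(0 <= i < D)
    ((d z == i) && (d w == i.+1) + (d z == i.+1) && (d w == i))%N%:R * (h i.+1 - h i) ^+ 2.
  under [RHS]eq_bigr do rewrite exchange_big /=.
  rewrite [RHS]exchange_big mulr_sumr /=; apply: eq_bigr => i _.
  rewrite mulrA mulr_natl e mulr_suml; apply: eq_bigr => z _.
  by rewrite mulr_suml.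
apply: ler_sum => z _; apply: ler_sum => w _.
have pos i : 0 <= ((d z == i) && (d w == i.+1) + (d z == i.+1) && (d w == i))%N%:R * (h i.+1 - h
  i) ^+ 2 :> R.
  by rewrite mulr_ge0 ?sqr_ge0.
case Gzw : (G z w); last by rewrite mul0r sumr_ge0.
rewrite mul1r; have [h1 h2] := d_adj Gzw.
have [e1|[e1|e1]] : d z = d w \/ d w = (d z).+1 \/ d z = (d w).+1 by lia.
- by rewrite e1 subrr expr0n /=; apply: sumr_ge0 => i _; rewrite mulr_ge0 ?sqr_ge0.
- rewrite (bigD1_seq (d z)) ?mem_index_iota ?iota_uniq //=; last by have := hD w; lia.
  rewrite e1 !eqxx /= -sqrrN opprB -[leLHS]addr0 lerD //; last first.
    by apply: sumr_ge0 => i _; rewrite mulr_ge0 ?sqr_ge0.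
  by rewrite ler_peMl ?sqr_ge0 // (ler_nat R 1) addn_gt0.
rewrite (bigD1_seq (d w)) ?mem_index_iota ?iota_uniq //=; last by have := hD z; lia.
rewrite e1 !eqxx /= -[leLHS]addr0 lerD //; last first.
    by apply: sumr_ge0 => i _; rewrite mulr_ge0 ?sqr_ge0.
by rewrite ler_peMl ?sqr_ge0 // (ler_nat R 1) addn_gt0 orbT.
Qed.

(* Two consecutive singleton layers would give a bridge, while edge cuts are even. *)
Lemma no_bridge_layers (k : nat) i z : ~~ odd k -> (forall w, degree G w = k) ->
  (i < d z)%N -> L i = 1%N -> L i.+1 = 1%N -> False.
Proof.
move=> ek reg hi L1 L2.
pose S w := (d w <= i)%N.
pose e := (\sum_w \sum_v (S w && ~~ S v && G w v))%N.
have e1 : (e <= 1)%N.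
  have -> : 1%N = (\sum_w \sum_v ((d w == i) * (d v == i.+1)))%N.
    under eq_bigr do rewrite -big_distrr /= -/(L i.+1) L2 muln1.
    by rewrite -/(L i) L1.
  apply: leq_sum => w _; apply: leq_sum => v _; rewrite /S.
  case Gwv : (G w v); last by rewrite andbF.
  by have [] := d_adj Gwv; lia.
have e0 : (0 < e)%N.
  have [v dv] := dist_onto cG hi; have [w dw Gwv] := dist_pred cG dv.
  by rewrite /e (bigD1 w) //= (bigD1 v) //= /S dw dv Gwv leqnn ltnn.
have tot : (\sum_w S w * k = \sum_w \sum_v (S w && S v && G w v) + e)%N.
  rewrite /e -big_split; apply: eq_bigr => w _ /=; rewrite -(reg w) degree_sum.
  rewrite -big_split big_distrr; apply: eq_bigr => v _ /=.
  by case: (S w); case: (S v); case: (G w v).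
have := symmetric_sum_even (F := fun w v => S w && S v && G w v).
move=> /(_ _ _)/negP; apply.
- by move=> w v; rewrite adj_sym andbC [S w && _]andbC andbC.
- by move=> w; rewrite adj_irrefl andbF.
have /(congr1 odd) := tot; rewrite oddD (_ : e = 1%N); last by lia.
by rewrite -big_distrl /= oddM (negPf ek) andbF addbT => /esym/negbFE.
Qed.
End Layers.

(** Both windows being tight forces d = a, so the bracket is 1/(ab) + 1/(bc) + 1/(ca) = (a + b +
    c)/(abc), and the only positive sizes with sum 4 are 1, 1, 2, of product 2. *)
Lemma tight_windows3 (R : realType) (a b c d : nat) :
  (0 < a)%N -> (0 < b)%N -> (0 < c)%N -> (0 < d)%N ->
  (a + b + c = 4)%N -> (b + c + d = 4)%N ->
  (a + b + c)%:R = 2 * (((a * b)%:R)^-1 + ((b * c)%:R)^-1 + ((c * d)%:R)^-1) :> R.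
Proof.
move=> a0 b0 c0 d0 h1 h2; have ed : d = a by lia.
have : [\/ [/\ a = 1, b = 1 & c = 2], [/\ a = 1, b = 2 & c = 1] | [/\ a = 2, b = 1 & c = 1]]%N.
  have : (a = 1 /\ b = 1 /\ c = 2) \/ (a = 1 /\ b = 2 /\ c = 1) \/ (a = 2 /\ b = 1 /\ c = 1) by lia.
  by case=> [[? []]|[[? []]|[? []]]]; [constructor 1|constructor 2|constructor 3].
by rewrite h1 ed; case=> -[-> -> ->]; rewrite ?mul1n ?muln1 ?invr1; lra.
Qed.

(** As for sum 4, the factor is the product abc. Sum 5 allows 1, 2, 2 of product 4 and 1, 1, 3 of
    product 3; in every arrangement of the latter, continued by d = a, two consecutive sizes are
    1. *)
Lemma tight_windows4 (R : realType) (a b c d : nat) :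
  (0 < a)%N -> (0 < b)%N -> (0 < c)%N -> (0 < d)%N ->
  (a = 1 -> b = 1 -> False)%N -> (b = 1 -> c = 1 -> False)%N -> (c = 1 -> d = 1 -> False)%N ->
  (a + b + c = 5)%N -> (b + c + d = 5)%N ->
  (a + b + c)%:R = 4 * (((a * b)%:R)^-1 + ((b * c)%:R)^-1 + ((c * d)%:R)^-1) :> R.
Proof.
move=> a0 b0 c0 d0 n1 n2 n3 h1 h2; have ed : d = a by lia.
have : [\/ [/\ a = 1, b = 2 & c = 2], [/\ a = 2, b = 1 & c = 2] | [/\ a = 2, b = 2 & c = 1]]%N.
  have : (a = 1 /\ b = 2 /\ c = 2) \/ (a = 2 /\ b = 1 /\ c = 2) \/ (a = 2 /\ b = 2 /\ c = 1) by lia.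
  by case=> [[? []]|[[? []]|[? []]]]; [constructor 1|constructor 2|constructor 3].
by rewrite h1 ed; case=> -[-> -> ->]; rewrite ?mul1n ?muln1 ?natrM; field.
Qed.

(** [rho] is the total resistance of the layers, [Y] their excess and [X] the resulting error. In 17
    X, the sum of squares accounts for 6 X and the correction to mean zero for 11 X. *)
Definition test_function_bound (R : realType) (tau d : nat) n (G : sgraph n) : Prop :=
  exists (rho X : R) (Y : nat),
    [/\ X = 40 * (Y%:R + 1) /\ (Y + d.+1 * (diam G).-1 <= 3 * n)%N, 0 < rho,
        `|n%:R - tau%:R * rho| <= 2 * X &
        pi <= rho -> algebraic_connectivity R G * (n%:R / 2 - 17 * X) <=
          pi ^+ 2 / (2 * rho) * (1 + 8 * pi / rho)].

Section TestFunction.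
Variables (R : realType) (d tau n : nat) (G : sgraph n).
Hypothesis cG : gconnected G.
Hypothesis n1 : (1 < n)%N.
Hypothesis d4 : (d <= 4)%N.
Hypothesis tau4 : (0 < tau <= 4)%N.
Hypothesis D3 : (3 <= diam G)%N.
Hypothesis deg : forall x, (d <= degree G x)%N.
Hypothesis tight : forall x y j, (j + 3 <= dist G x y)%N ->
  (layer_size G x j + layer_size G x j.+1 + layer_size G x j.+2 = d.+1)%N ->
  (layer_size G x j.+1 + layer_size G x j.+2 + layer_size G x j.+3 = d.+1)%N ->
  (layer_size G x j + layer_size G x j.+1 + layer_size G x j.+2)%:R =
  tau%:R * (layer_resistance R (layer_size G x) j + layer_resistance R (layer_size G x) j.+1
    + layer_resistance R (layer_size G x) j.+2).
Local Notation mu := (algebraic_connectivity R G).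

Lemma energy_shift (g : 'I_n -> R) c : energy G (fun i => g i - c) = energy G g.
Proof. by do 2![apply: eq_bigr => ? _]; congr (_ * _ ^+ 2); ring. Qed.

Lemma algebraic_connectivity_variance (g : 'I_n -> R) :
  mu * (\sum_i g i ^+ 2 - (\sum_i g i) ^+ 2 / n%:R) *+ 2 <= energy G g.
Proof.
have n0 : n%:R != 0 :> R by rewrite pnatr_eq0; lia.
pose c := (\sum_i g i) / n%:R.
have h0 : \sum_i (g i - c) = 0.
  by rewrite sumrB sumr_const card_ord -[c *+ n]mulr_natr /c divfK ?subrr.
have := @algebraic_connectivity_energy R n G n1 _ h0; rewrite energy_shift.
have -> : \sum_i (g i - c) ^+ 2 = \sum_i g i ^+ 2 - (\sum_i g i) ^+ 2 / n%:R; last by [].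
have -> : \sum_i (g i - c) ^+ 2 = \sum_i (g i ^+ 2 - 2 * c * g i + c ^+ 2).
  by apply: eq_bigr => i _; ring.
rewrite big_split sumrB /= sumr_const card_ord -mulr_sumr -[_ *+ n]mulr_natr /c.
by field.
Qed.

Lemma diameter_test_function : test_function_bound R tau d G.
Proof.
have [x [y dxy]] := diam_attained cG.
set D := diam G in dxy *.
have D3' : (3 <= D)%N := D3.
have dD z : (dist G x z <= D)%N by apply: dist_le_diam.
pose L := layer_size G x.
have Lpos i : (i <= D)%N -> (0 < L i)%N by rewrite -dxy; apply: layer_size_gt0.
have Lsum : (\sum_(0 <= i < D.+1) L i = n)%N by apply: layer_size_sum.
have win j : (j < D)%N -> (d.+1 <= L j + L j.+1 + L j.+2)%N.
  move=> hj; have [z dz] : exists z, dist G x z = j.+1 by apply: (dist_onto cG (y := y)); rewrite dxy.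
  by apply: leq_trans (layer_window_ge cG dz); rewrite ltnS.
have tgt j : (j + 3 <= D)%N -> (L j + L j.+1 + L j.+2 = d.+1)%N ->
    (L j.+1 + L j.+2 + L j.+3 = d.+1)%N -> (L j + L j.+1 + L j.+2)%:R =
    tau%:R * (layer_resistance R L j + layer_resistance R L j.+1 + layer_resistance R L j.+2).
  by rewrite -dxy; apply: tight.
pose Y := layer_excess d D L; pose rho := total_resistance R D L.
pose X : R := 40 * (Y%:R + 1); exists rho, X, Y; split.
- by split=> //; exact: (layer_excess_le d4 tau4 D3' Lsum win).
- exact: (total_resistance_gt0 R d4 tau4 D3' Lpos Lsum).
- exact: (resistance_balance d4 tau4 D3' Lsum win tgt).
move=> hrho.
have n0 : 0 < n%:R :> R by rewrite ltr0n; lia.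
pose h i := cos (phase R D L i); pose g z := h (dist G x z).
have Sq (q : nat -> R) : \sum_z q (dist G x z) = \sum_(0 <= i < D.+1) (L i)%:R * q i.
  have -> : \sum_(0 <= i < D.+1) (L i)%:R * q i =
      \sum_(0 <= i < D.+1) \sum_z (dist G x z == i)%:R * q i.
    by apply: eq_bigr => i _; rewrite -mulr_suml -natr_sum.
  rewrite exchange_big; apply: eq_bigr => z _ /=.
  rewrite (bigD1_seq (dist G x z)) ?mem_index_iota ?iota_uniq ?ltnS ?dD //=.
  rewrite eqxx mul1r big1 ?addr0 // => i; rewrite eq_sym => /negPf ->; exact: mul0r.
have s1 : `|\sum_z g z| <= 11 * X.
  by rewrite (Sq h); exact: (layer_cos_sum d4 tau4 D3' Lpos Lsum win tgt).
have s2 : n%:R / 2 - 6 * X <= \sum_z g z ^+ 2.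
  by rewrite (Sq (fun i => h i ^+ 2)); exact: (layer_square_sum d4 tau4 D3' Lpos Lsum win tgt).
(* One factor of the square is at most [n] because cosines are at most 1, so a linear error bound
   results. *)
have s3 : (\sum_z g z) ^+ 2 / n%:R <= 11 * X.
  have gn : `|\sum_z g z| <= n%:R.
    apply: le_trans (ler_norm_sum _ _ _) _.
    apply: (@le_trans _ _ (\sum_(z < n) 1)); last by rewrite sumr_const card_ord.
    by apply: ler_sum => z _; exact: cos_max.
  rewrite ler_pdivrMr // -real_normK ?num_real // expr2.
  by apply: ler_pM.
have en : energy G g <= 2 * (pi ^+ 2 / (2 * rho) * (1 + 8 * pi / rho)).
  apply: le_trans (layer_energy_le cG h dD) _; rewrite ler_pM2l //.
  exact: (layer_energy d4 tau4 D3' Lpos Lsum hrho).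
have mu0 : 0 < mu by exact: algebraic_connectivity_gt0.
have := algebraic_connectivity_variance g; rewrite -mulr_natl => var.
have low : n%:R / 2 - 17 * X <= \sum_z g z ^+ 2 - (\sum_z g z) ^+ 2 / n%:R by lra.
have := ler_wpM2l (ltW mu0) low; lra.
Qed.
End TestFunction.

Lemma min_degree3_test_function (R : realType) n (G : sgraph n) :
  gconnected G -> (1 < n)%N -> (3 <= diam G)%N -> (forall x, (3 <= degree G x)%N) ->
  test_function_bound R 2 3 G.
Proof.
move=> cG n1 D3 deg; apply: diameter_test_function => // x y j hj h1 h2.
by apply: tight_windows3 => //; apply: (layer_size_gt0 cG (z := y)); lia.
Qed.

Lemma regular4_test_function (R : realType) n (G : sgraph n) :
  gconnected G -> (1 < n)%N -> (3 <= diam G)%N -> (forall x, degree G x = 4%N) ->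
  test_function_bound R 4 4 G.
Proof.
move=> cG n1 D3 deg; apply: diameter_test_function => // [x|x y j hj h1 h2].
  by rewrite deg.
have nb i : (i < dist G x y)%N -> layer_size G x i = 1%N -> layer_size G x i.+1 = 1%N -> False.
  exact: (no_bridge_layers cG (k := 4)).
by apply: tight_windows4 => //; first [apply: nb; lia|apply: (layer_size_gt0 cG (z := y)); lia].
Qed.

(** * Asymptotic equivalence *)

(** As [g] is positive, the error can be taken to be f / g - 1. The 1 in the maxima discards n =
    0. *)
Lemma asymp_eqP (R : realType) (C : graph_class) (f g : nat -> R) :
  (forall n, (0 < n)%N -> 0 < g n) ->
  asymp_eq (orders_oo C) f g <->
  forall e : R, 0 < e -> exists n0 : nat, forall n, (n0 <= n)%N -> orders C n ->
    `|f n - g n| <= e * g n.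
Proof.
move=> g0; rewrite /asymp_eq /orders_oo; split => [[u /cvgrPdist_le u0 [N1 _ h1]] e e0|h].
  have [N2 _ h2] := u0 e e0; exists (maxn 1 (maxn N1 N2)) => n.
  rewrite !geq_max => /andP[n0 /andP[n1 n2]] On.
  have := h2 n n2 On; rewrite sub0r normrN => ue.
  rewrite (h1 n n1 On) mulrDl mul1r addrAC subrr add0r normrM.
  by rewrite (gtr0_norm (g0 n n0)) ler_wpM2r // ltW // g0.
exists (fun n => f n / g n - 1); last first.
  exists 1%N => // n /= n0 _; rewrite addrC subrK divfK //.
  by rewrite lt0r_neq0 // g0.
apply/cvgrPdist_le => e e0; have [N hN] := h e e0.
exists (maxn 1 N) => // n /=; rewrite geq_max => /andP[n0 nN] On.
have gn := g0 n n0; rewrite sub0r normrN.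
have -> : f n / g n - 1 = (f n - g n) / g n by rewrite mulrBl divff // lt0r_neq0.
by rewrite normrM normfV (gtr0_norm gn) ler_pdivrMr // hN.
Qed.

Section Equivalence.
Variables (R : realType) (C : graph_class) (d tau : nat).
Hypothesis d04 : (d <= 4)%N.
Hypothesis tau4 : (0 < tau <= 4)%N.
(** With N = 3 tau the lower bound N pi^2 / (3 n^2) coincides with the value tau pi^2 / n^2 reached
    by the test function. *)
Hypothesis weighting : forall n (G : sgraph n), C G -> (1 < n)%N -> has_cut_weighting R (3 * tau) d G.
Hypothesis test_function : forall n (G : sgraph n), C G -> (1 < n)%N -> (3 <= diam G)%N ->
  test_function_bound R tau d G.

Local Notation mu := (algebraic_connectivity R).
Local Notation target := (tau%:R * pi ^+ 2 : R).

Let targetE : (3 * tau)%:R / 3 * pi ^+ 2 = target :> R.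
Proof. by rewrite natrM; field. Qed.

Let d5 : 1 <= (d.+1%:R : R) <= 5.
Proof. by rewrite (ler_nat R 1) (ler_nat R _ 5). Qed.

Lemma connectivity_lower (e : R) : 0 < e -> exists n0 : nat,
  forall n (G : sgraph n), (n0 <= n)%N -> C G -> (1 - e) * target <= n%:R ^+ 2 * mu G.
Proof.
move=> e0; have N0 : (0 < 3 * tau)%N by lia.
have [n0 h] := eigenvalue_lower_bound 29 N0 e0.
exists (maxn 2 n0) => n G; rewrite geq_max => /andP[n1 hn] CG.
have [a [f [W [fo cw _]]]] := weighting CG n1.
by rewrite -targetE; exact: h fo cw.
Qed.

Lemma diameter_lower (e : R) : 0 < e -> exists2 eta : R, 0 < eta & exists n0 : nat,
  forall n (G : sgraph n), (n0 <= n)%N -> C G -> n%:R ^+ 2 * mu G <= (1 + eta) * target ->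
  (1 - e) * (3 * n%:R / d.+1%:R) <= (diam G)%:R.
Proof.
move=> e0; have N0 : (0 < 3 * tau)%N by lia.
(* The defect of W enters with factor 30, so e / 20 costs 3 e n / 2, half of the allowed 3 e n; the
   other half covers the constant 3000 once n >= 2000 / e. *)
have e20 : 0 < e / 20 by lra.
have [eta eta0 [n0 h]] := eigenvalue_near_minimum 29 N0 e20; exists eta => //.
have [n1 hn1] := eventually_ge (2000 / e).
exists (maxn 2 (maxn n0 n1)) => n G; rewrite !geq_max => /andP[n2 /andP[hn /hn1 {}hn1]] CG.
have [a [f [W [fo cw hS]]]] := weighting CG n2.
rewrite -targetE => /(h _ _ _ _ _ hn fo cw).
rewrite sumrB sumr_const_nat subn0 -natr_sum -[3 *+ n]mulr_natr => hW.
move: hS; rewrite -(ler_nat R) !natrD !natrM => hS.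
have {}hn1 : 2000 <= n%:R * e by move: hn1; rewrite ler_pdivrMr.
have dp : 0 < d.+1%:R :> R by rewrite ltr0n.
rewrite mulrA ler_pdivrMr // [leRHS]mulrC; lra.
Qed.

Lemma diameter_upper (e : R) : 0 < e -> exists n0 : nat,
  forall n (G : sgraph n), (n0 <= n)%N -> C G -> (diam G)%:R <= (1 + e) * (3 * n%:R / d.+1%:R).
Proof.
move=> e0; have [n1 hn1] := eventually_ge (2 / e).
exists (maxn 4 n1) => n G; rewrite !geq_max => /andP[n4 /hn1 {}hn1] CG.
have {}hn1 : 2 <= n%:R * e by move: hn1; rewrite ler_pdivrMr.
have n4' : 4 <= n%:R :> R by rewrite (ler_nat R 4).
have dp : 0 < d.+1%:R :> R by rewrite ltr0n.
case/andP: d5 => d1 d5'.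
rewrite mulrA ler_pdivlMr //.
have [D3|D3] := ltnP (diam G) 3.
  have D2 : (diam G)%:R <= 2 :> R by rewrite (ler_nat R _ 2).
  have D0 : 0 <= (diam G)%:R :> R by [].
  have : (diam G)%:R * d.+1%:R <= 2 * 5 :> R by apply: ler_pM => //; exact: ltW.
  lra.
have n2 : (1 < n)%N by apply: leq_trans n4.
have [rho [X [Y [[_ hY] _ _ _]]]] := test_function CG n2 D3.
have : (d.+1 * (diam G).-1 <= 3 * n)%N by apply: leq_trans (leq_addl _ _) hY.
have eD : (diam G)%:R = (diam G).-1%:R + 1 :> R.
  by rewrite natr1 prednK //; apply: ltn_trans D3.
rewrite -(ler_nat R) !natrM eD; lra.
Qed.

Lemma connectivity_upper (e : R) : 0 < e -> exists2 eta : R, 0 < eta & exists n0 : nat,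
  forall n (G : sgraph n), (n0 <= n)%N -> C G ->
  (1 - eta) * (3 * n%:R / d.+1%:R) <= (diam G)%:R -> n%:R ^+ 2 * mu G <= (1 + e) * target.
Proof.
wlog e1 : e / e <= 1 => [H|] e0.
  have m0 : 0 < Num.min e 1 by rewrite lt_min e0 ltr01.
  have m1 : Num.min e 1 <= 1 by rewrite ge_min lexx orbT.
  have [eta h0 [n0 h]] := H _ m1 m0; exists eta => //; exists n0 => n G hn CG hD.
  apply: le_trans (h n G hn CG hD) _; apply: ler_wpM2r.
    by rewrite mulr_ge0 // sqr_ge0.
  by rewrite lerD2l ge_min lexx.
(* Here q = e / (34 * 40). Then 34 X <= e n / 8, which bounds the relative errors both in n / 2 - 17
   X and in n - tau rho by e / 8, and (1 + e / 8) / (1 - e / 8)^2 <= 1 + e for e <= 1. *)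
have [q [q0 q1 qe qX]] : exists q : R, [/\ 0 < q, q <= 1, q <= e &
    forall n Y : R, Y + 1 <= q / 8 * n -> 34 * (40 * (Y + 1)) <= e / 8 * n].
  pose p := e / 34; have pE : 34 * p = e by rewrite /p; field.
  pose q := p / 40; have qE : 40 * q = p by rewrite /q; field.
  exists q; split; try lra.
  move=> n Y hY; have h : 40 * (Y + 1) <= p / 8 * n by rewrite -qE; lra.
  by rewrite -pE; lra.
exists (q / 48); first by lra.
have [n1 hn1] := eventually_ge (2048 / q).
exists (maxn 2 n1) => n G; rewrite !geq_max => /andP[n2 /hn1 {}hn1] CG hD.
have {}hn1 : 2048 <= n%:R * q by move: hn1; rewrite ler_pdivrMr.
have n0 : 0 < n%:R :> R by rewrite ltr0n; apply: ltn_trans n2.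
have n32 : 32 <= n%:R :> R by have := ler_wpM2l (ltW n0) q1; lra.
have ne : 256 <= e * (n%:R / 8) by have := ler_wpM2l (ltW n0) qe; lra.
have {}hn1 : 96 <= n%:R * q by lra.
have dp : 0 < d.+1%:R :> R by rewrite ltr0n.
case/andP: d5 => d1 d5'.
have {}hD : (1 - q / 48) * (3 * n%:R) <= (diam G)%:R * d.+1%:R.
  by rewrite -ler_pdivrMr // -mulrA.
have D3 : (3 <= diam G)%N.
  rewrite -(ler_nat R) leNgt; apply/negP => D3.
  have : (diam G)%:R * d.+1%:R <= 3 * 5 :> R by apply: ler_pM => //; exact: ltW.
  have : q * n%:R <= 1 * n%:R by rewrite ler_wpM2r.
  lra.
have [rho [X [Y [[XE hY] rho0 hrho]]]] := test_function CG n2 D3.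
have t1 : 1 <= tau%:R :> R by rewrite (ler_nat R 1); case/andP: tau4.
have t4 : tau%:R <= 4 :> R by rewrite (ler_nat R _ 4); case/andP: tau4.
have eD : (diam G)%:R = (diam G).-1%:R + 1 :> R.
  by rewrite natr1 prednK //; apply: ltn_trans D3.
have Xn : 34 * X <= e / 8 * n%:R.
  rewrite XE; apply: qX.
  move: hY; rewrite -(ler_nat R) natrD !natrM => hY.
  by move: hD; rewrite eD; lra.
have rn : n%:R * (1 - e / 8) <= tau%:R * rho.
  by move: hrho; rewrite ler_norml => /andP[h1 h2]; lra.
have rho8 : n%:R / 8 <= rho.
  have h1 : tau%:R * rho <= 4 * rho by apply: ler_wpM2r => //; exact: ltW.
  have h2 : n%:R * (1 - e / 8) >= n%:R * (1 / 2).
    by apply: ler_wpM2l; [exact: ltW|lra].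
  lra.
have p4 := pi_lt4 R; have p0 := pi_gt0 R.
have prho : pi <= rho by lra.
move=> /(_ prho) key.
have mu0 : 0 < mu G.
  have [a [f [W [fo _ _]]]] := weighting CG n2; exact: fo_gt0 fo.
have v : 8 * pi / rho <= e / 8.
  rewrite ler_pdivrMr //; have := ler_wpM2l (ltW e0) rho8; lra.
set m := mu G in key mu0 *.
have k1 : m * (n%:R / 2 * (1 - e / 8)) <= pi ^+ 2 / (2 * rho) * (1 + e / 8).
  apply: (@le_trans _ _ (m * (n%:R / 2 - 17 * X))).
    by apply: ler_wpM2l; [exact: ltW|lra].
  apply: le_trans key _; apply: ler_wpM2l; last by lra.
  by rewrite divr_ge0 ?sqr_ge0 // mulr_ge0 // ltW.
have k2 : m * n%:R * (1 - e / 8) * rho <= pi ^+ 2 * (1 + e / 8).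
  have r2 : 0 < 2 * rho by rewrite mulr_gt0.
  have := ler_wpM2r (ltW r2) k1.
  have -> : pi ^+ 2 / (2 * rho) * (1 + e / 8) * (2 * rho) = pi ^+ 2 * (1 + e / 8) :> R.
    by field; rewrite lt0r_neq0.
  by have -> : m * (n%:R / 2 * (1 - e / 8)) * (2 * rho) = m * n%:R * (1 - e / 8) * rho by field.
have c0 : 0 < 1 - e / 8 by lra.
have k3 : m * n%:R * (1 - e / 8) * (n%:R * (1 - e / 8)) <= target * (1 + e / 8).
  have mn : 0 <= m * n%:R * (1 - e / 8).
    by apply: mulr_ge0; [apply: mulr_ge0; exact: ltW|exact: ltW].
  apply: le_trans (ler_wpM2l mn rn) _.
  have := ler_wpM2l (ler0n R tau) k2; lra.
have c2 : 0 < (1 - e / 8) ^+ 2 by exact: exprn_gt0.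
rewrite -(ler_pM2r c2).
have -> : n%:R ^+ 2 * m * (1 - e / 8) ^+ 2 = m * n%:R * (1 - e / 8) * (n%:R * (1 - e / 8)) by ring.
apply: le_trans k3 _.
have -> : (1 + e) * target * (1 - e / 8) ^+ 2 = target * ((1 + e) * (1 - e / 8) ^+ 2) by ring.
by apply: ler_wpM2l; [rewrite mulr_ge0 // sqr_ge0|nra].
Qed.

Lemma diameter_connectivity_equivalence (G : forall n, sgraph n) : sequence_in C G ->
  asymp_eq (orders_oo C) (fun n => (diam (G n))%:R : R) (fun n => 3 * n%:R / d.+1%:R) <->
  asymp_eq (orders_oo C) (fun n => mu (G n)) (fun n => tau%:R * pi ^+ 2 / n%:R ^+ 2).
Proof.
move=> CG; have p0 := pi_gt0 R.
have dp : 0 < d.+1%:R :> R by rewrite ltr0n.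
have tp : 0 < target by rewrite mulr_gt0 ?exprn_gt0 // ltr0n; case/andP: tau4.
have gD n : (0 < n)%N -> 0 < 3 * n%:R / d.+1%:R :> R.
  by move=> n0; rewrite divr_gt0 // mulr_gt0 // ltr0n.
have gM n : (0 < n)%N -> 0 < target / n%:R ^+ 2.
  by move=> n0; rewrite divr_gt0 // exprn_gt0 // ltr0n.
have scale n c : (0 < n)%N ->
    (mu (G n) <= c * (target / n%:R ^+ 2)) = (n%:R ^+ 2 * mu (G n) <= c * target).
  by move=> n0; rewrite mulrA ler_pdivlMr ?exprn_gt0 ?ltr0n // [n%:R ^+ 2 * _]mulrC.
have scale' n c : (0 < n)%N ->
    (c * (target / n%:R ^+ 2) <= mu (G n)) = (c * target <= n%:R ^+ 2 * mu (G n)).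
  by move=> n0; rewrite mulrA ler_pdivrMr ?exprn_gt0 ?ltr0n // [n%:R ^+ 2 * _]mulrC.
have near (x t e : R) : (`|x - t| <= e * t) = ((1 - e) * t <= x) && (x <= (1 + e) * t).
  by rewrite ler_norml; congr (_ && _); apply/idP/idP; lra.
rewrite !asymp_eqP //; split => H e e0.
  have [eta eta0 [n1 h1]] := connectivity_upper e0.
  have [n2 h2] := connectivity_lower e0; have [n3 h3] := H eta eta0.
  exists (maxn (maxn 1 n1) (maxn n2 n3)) => n.
  rewrite !geq_max => /andP[/andP[n0 hn1] /andP[hn2 hn3]] On.
  have := h3 n hn3 On; rewrite !near => /andP[lo _].
  by rewrite scale // scale' // h2 ?(h1 n) //; apply: CG.
have [eta eta0 [n1 h1]] := diameter_lower e0.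
have [n2 h2] := diameter_upper e0; have [n3 h3] := H eta eta0.
exists (maxn (maxn 1 n1) (maxn n2 n3)) => n.
rewrite !geq_max => /andP[/andP[n0 hn1] /andP[hn2 hn3]] On.
have := h3 n hn3 On; rewrite !near => /andP[_]; rewrite scale // => up.
by rewrite (h1 n) ?h2 //; apply: CG.
Qed.
End Equivalence.

Theorem theorem3p25 (R : realType) :
  [/\ (forall G : forall n, sgraph n,
        sequence_in (connected_min_degree_ge 3) G ->
        asymp_eq (orders_oo (connected_min_degree_ge 3))
          (fun n => (diam (G n))%:R : R) (fun n => 3 * n%:R / 4) <->
        asymp_eq (orders_oo (connected_min_degree_ge 3))
          (fun n => algebraic_connectivity R (G n))
          (fun n => 2 * pi ^+ 2 / n%:R ^+ 2)),
      (forall G : forall n, sgraph n,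
        sequence_in (connected_regular 4) G ->
        asymp_eq (orders_oo (connected_regular 4))
          (fun n => (diam (G n))%:R : R) (fun n => 3 * n%:R / 5) <->
        asymp_eq (orders_oo (connected_regular 4))
          (fun n => algebraic_connectivity R (G n))
          (fun n => 4 * pi ^+ 2 / n%:R ^+ 2)) &
      (forall G : forall n, sgraph n,
        sequence_in (connected_regular 3) G ->
        asymp_eq (orders_oo (connected_regular 3))
          (fun n => (diam (G n))%:R : R) (fun n => 3 * n%:R / 4) <->
        asymp_eq (orders_oo (connected_regular 3))
          (fun n => algebraic_connectivity R (G n))
          (fun n => 2 * pi ^+ 2 / n%:R ^+ 2))].
Proof.
have min3 n (G : sgraph n) : connected_min_degree_ge 3 G ->
    gconnected G /\ forall x, (3 <= degree G x)%N.
  move=> /andP[cG m3]; split => // x; apply: leq_trans m3 _.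
  by apply: (@bigminn_le _ _ _ (degree G)) => //; exact: mem_index_enum.
have reg k n (G : sgraph n) : connected_regular k G ->
    gconnected G /\ forall x, degree G x = k.
  by move=> /andP[cG /forallP rG]; split => // x; apply/eqP.
split.
- apply: (@diameter_connectivity_equivalence R _ 3 2) => //.
    by move=> n G /min3[cG deg] n1; exact: min_degree3_cut_weighting.
  by move=> n G /min3[cG deg] n1 D3; exact: min_degree3_test_function.
- apply: (@diameter_connectivity_equivalence R _ 4 4) => //.
    by move=> n G /reg[cG deg] n1; exact: regular4_cut_weighting.
  by move=> n G /reg[cG deg] n1 D3; exact: regular4_test_function.
apply: (@diameter_connectivity_equivalence R _ 3 2) => //.
  move=> n G /reg[cG deg] n1; apply: min_degree3_cut_weighting => // x.
  by rewrite deg.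
move=> n G /reg[cG deg] n1 D3; apply: min_degree3_test_function => // x.
by rewrite deg.
Qed.
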